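(* Let $\alpha$ be a peak composition of $n$ and let $\mathscr G:=D(\mathbf Q^{r}_\alpha,\mathrm w_{LT})$. (a) $\overline{\mathsf B}\big([\,w_0(2[\ell(\alpha)-1]),\ w_1(\mathrm{Des}_L(\mathrm w_{LB}(F_{\mathscr G}^{\downarrow})))\,]_L\big)$ is a projective cover of $\mathbf Q^{r}_\alpha$. (b) $\overline{\mathsf B}\big([\,w_0(\mathrm{set}(\alpha^{r})),\ w_1(\mathrm{set}(\alpha^{r}))\,]_L\big)$ is an injective hull of $\mathbf Q^{r}_\alpha$. In particular, it is a projective indecomposable module.
   Context: Permutations. $n$ is a positive integer, $[n]=\{1,\dots,n\}$, $\mathfrak S_n$ the symmetric group (product = composition of maps; permutations written as words), $s_i=(i,i+1)$, $\ell(\sigma)$ Coxeter length, $w_0$ the longest element. $\mathrm{Des}_L(\sigma)=\{i:\ell(s_i\sigma)<\ell(\sigma)\}$, $\mathrm{Des}_R(\sigma)=\{i:\ell(\sigma s_i)<\ell(\sigma)\}$. $\preceq_L$ has covers $\sigma\prec s_i\sigma$, $i\notin\mathrm{Des}_L(\sigma)$; $[\sigma,\rho]_L$ is the interval for $\preceq_L$. For $S\subseteq[n-1]$, $S^{c}=[n-1]\setminus S$; $w_0(S)$ is the longest element of the subgroup generated by $\{s_i:i\in S\}$; $w_1(S)=w_0w_0(S^c)$ is the longest element of $\{z:\mathrm{Des}_R(z)\subseteq S\}$. $2[k]=\{2,4,\dots,2k\}$, $2[0]=\emptyset$. For a composition $\alpha=(\alpha_1,\dots,\alpha_l)$ of $n$,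 $\ell(\alpha)=l$, $\mathrm{set}(\alpha)=\{\alpha_1,\dots,\alpha_1+\dots+\alpha_{l-1}\}$, $\alpha^r=(\alpha_l,\dots,\alpha_1)$. $\alpha$ is a peak composition if $\alpha_i\ne1$ for $1\le i<\ell(\alpha)$. Modules. $H_n(0)$ is the unital associative $\mathbb C$-algebra generated by $\overline\pi_1,\dots,\overline\pi_{n-1}$ with $\overline\pi_i^2=-\overline\pi_i$, $\overline\pi_i\overline\pi_{i+1}\overline\pi_i=\overline\pi_{i+1}\overline\pi_i\overline\pi_{i+1}$, $\overline\pi_i\overline\pi_j=\overline\pi_j\overline\pi_i$ for $|i-j|\ge2$. For a nonempty left weak Bruhat interval $I$, $\overline{\mathsf B}(I)$ is the left $H_n(0)$-module with basis $I$ and $\overline\pi_i\star\gamma=-\gamma$ if $i\in\mathrm{Des}_L(\gamma)$; $=0$ if $i\notin\mathrm{Des}_L(\gamma)$, $s_i\gamma\notin I$; $=s_i\gamma$ if $i\notin\mathrm{Des}_L(\gamma)$, $s_i\gamma\in I$. Projective covers and injective hulls are in the category of finitely generated left $H_n(0)$-modules. Diagrams and tableaux. Boxes are $(x,y)$ with $x$ = column from the left, $y$ = row from the bottom. $\mathrm{tcd}(\alpha)=\{(j,i):1\le i\le\ell(\alpha),1\le j\le\alpha_i\}$. $\mathrm w_{LT}$ (resp. $\mathrm w_{LB}$) reads each row left to right, top (resp. bottom) row first. $F_D^{\downarrow}$ is the filling of $D$ placing $1,\dots,n$ down each column (top to bottom), leftmost column first. $\mathcal T''_\alpha$ is the filling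 of $\mathrm{tcd}(\alpha)$ having in column $1$, bottom to top, the first $\ell(\alpha)$ odd numbers; in column $2$, bottom to top, the first $\ell(\alpha)-1$ or $\ell(\alpha)$ even numbers (according to whether or not $\alpha_{\ell(\alpha)}=1$); and the remaining numbers placed increasingly, left to right in each row, in the remaining boxes, top row first. $\mathbf Q^r_\alpha$ denotes the $H_n(0)$-module $\overline{\mathsf B}([\mathrm w_{LT}(\mathcal T''_\alpha),w_1(\mathrm{set}(\alpha^r))]_L)$ (up to isomorphism); it arises from an $H_n(0)$-module on standard peak immaculate tableaux of shape $\alpha$. $D(\mathbf Q^r_\alpha,\mathrm w_{LT})$ is the diagram whose $j$th row from the bottom ($1\le j\le\ell(\alpha)$) is $\{(j+x-1,j):1\le x\le\alpha_{\ell(\alpha)}\}$ if $j=\ell(\alpha)$, and $\{(j,j),(j+1,j)\}\cup\{(k_j+x,j):3\le x\le\alpha_j\}$ if $j<\ell(\alpha)$, where $k_j=(\ell(\alpha)-1)+\sum_{j<r\le\ell(\alpha)}(\alpha_r-2)$. *)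

(* Defs.v *)
From HB Require Import structures.
From mathcomp Require Import all_boot all_order all_fingroup all_algebra.
From mathcomp Require Import generic_quotient zify boolp reals complex.

Set Implicit Arguments.
Unset Strict Implicit.
Unset Printing Implicit Defensive.

Import GRing.Theory.
Local Open Scope ring_scope.
Local Open Scope quotient_scope.

(* The element [i : 'I_n] stands for the letter [i + 1] of [n] = {1, ..., n},
   and [i : 'I_n.-1] stands for the index [i + 1] of [n - 1]; subsets of [n - 1]
   are terms of type [{set 'I_n.-1}]. *)

Section SymmetricGroup.
Variable n : nat.
Implicit Types (s t : 'S_n) (i : 'I_n.-1) (S : {set 'I_n.-1}).

Definition ord_lo i : 'I_n := widen_ord (leq_pred n) i.

Fact ord_hi_subproof i : (i.+1 < n)%N.
Proof. by case: n i => [[]|m] //= i; rewrite ltnS ltn_ord. Qed.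

Definition ord_hi i : 'I_n := Ordinal (ord_hi_subproof i).

Definition adj i : 'S_n := tperm (ord_lo i) (ord_hi i).

(* The library's product of permutations is the opposite of composition of
   maps: [(t * s)%g x = s (t x)]. *)
Definition pcomp s t : 'S_n := (t * s)%g.

Definition has_word s (k : nat) : bool :=
  [exists w : k.-tuple 'I_n.-1, s == (\prod_(i <- w) adj i)%g].

(* Inversions of the inverse of [s]: pairs of letters [a < b] such that [b] is
   to the left of [a] in the word of [s]. *)
Definition pinv s : {set 'I_n * 'I_n} :=
  [set p : 'I_n * 'I_n | (p.1 < p.2)%N && ((s^-1)%g p.2 < (s^-1)%g p.1)%N].

Lemma tperm_ltn i (a b : 'I_n) : (a < b)%N ->
  (a, b) != (ord_lo i, ord_hi i) -> (adj i a < adj i b)%N.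
Proof.
rewrite xpair_eqE /adj -!val_eqE /= => ab.
by case: tpermP => [/(congr1 val)|/(congr1 val)|/eqP + /eqP];
   case: tpermP => [/(congr1 val)|/(congr1 val)|/eqP + /eqP];
   rewrite -?val_eqE /=; lia.
Qed.

Lemma adjK i : involutive (adj i).
Proof. exact: tpermK. Qed.

Lemma pinv_up i s : ((s^-1)%g (ord_lo i) < (s^-1)%g (ord_hi i))%N ->
  #|pinv (pcomp (adj i) s)| = #|pinv s|.+1.
Proof.
move=> up.
have invE x : ((pcomp (adj i) s)^-1)%g x = (s^-1)%g (adj i x).
  by rewrite /pcomp invMg permM tpermV.
pose f (p : 'I_n * 'I_n) := (adj i p.1, adj i p.2).
have fK : involutive f by case=> a b; rewrite /f /= !adjK.
have lohi : (ord_lo i < ord_hi i)%N by rewrite /=.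
have -> : pinv (pcomp (adj i) s) = (ord_lo i, ord_hi i) |: (f @: pinv s).
  apply/setP=> -[a b]; rewrite !inE /= !invE.
  have -> : ((a, b) \in f @: pinv s) = (f (a, b) \in pinv s).
    apply/imsetP/idP => [[p ps ->]|ps]; first by rewrite fK.
    by exists (f (a, b)) => //; rewrite fK.
  rewrite inE /=.
  have [|nab /=] := eqVneq (a, b) (ord_lo i, ord_hi i).
    by case=> -> -> /=; rewrite /adj tpermL tpermR /= ltnSn up.
  have [ab|ba] := ltnP a b; first by rewrite (tperm_ltn ab).
  case: (ltnP (adj i a)) => //= ab'.
  have [E|nab'] := eqVneq (adj i a, adj i b) (ord_lo i, ord_hi i).
    by case: E => -> ->; rewrite ltnNge ltnW.
  by have := tperm_ltn ab' nab'; rewrite !adjK; lia.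
rewrite cardsU1 card_imset ?add1n; last exact: inv_inj.
suff -> : (ord_lo i, ord_hi i) \notin f @: pinv s by [].
apply/negP=> /imsetP[p ps /(congr1 f)]; rewrite fK => E.
by move: ps; rewrite -E inE /= /adj tpermL tpermR /=; lia.
Qed.

Lemma pcomp_adjK i s : pcomp (adj i) (pcomp (adj i) s) = s.
Proof. by rewrite /pcomp -mulgA /adj tperm2 mulg1. Qed.

Lemma pinv_down i s : ((s^-1)%g (ord_hi i) < (s^-1)%g (ord_lo i))%N ->
  #|pinv s| = #|pinv (pcomp (adj i) s)|.+1.
Proof.
move=> dn; rewrite -(@pinv_up i) ?pcomp_adjK //.
by rewrite /pcomp invMg !permM tpermV /adj tpermL tpermR.
Qed.

Lemma up_or_down i s : ((s^-1)%g (ord_hi i) < (s^-1)%g (ord_lo i))%N =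
  ~~ ((s^-1)%g (ord_lo i) < (s^-1)%g (ord_hi i))%N.
Proof.
have : (s^-1)%g (ord_hi i) != (s^-1)%g (ord_lo i) :> nat.
  by rewrite (inj_eq val_inj) (inj_eq perm_inj) -val_eqE /=; lia.
by lia.
Qed.

Lemma no_descent s :
  (forall i, ((s^-1)%g (ord_lo i) < (s^-1)%g (ord_hi i))%N) -> s = 1%g.
Proof.
move=> up; set p := (s^-1)%g in up.
have mono : {homo p : a b / (a < b)%N}.
  move=> a [b bn] /=; elim: b bn => // b IH bn ab.
  have bn' : (b < n)%N by apply: ltnW.
  have bn1 : (b < n.-1)%N by lia.
  have := up (Ordinal bn1).
  have -> : ord_hi (Ordinal bn1) = Ordinal bn by apply: val_inj.
  have -> : ord_lo (Ordinal bn1) = Ordinal bn' by apply: val_inj.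
  move=> up1; case: (ltngtP a b) => [lt|gt|eq]; first exact: ltn_trans (IH bn' lt) up1.
    by move: ab gt; lia.
  by have -> : a = Ordinal bn' by apply: val_inj.
have monoV : {homo s : a b / (a < b)%N}.
  move=> a b ab; case: (ltngtP (s a) (s b)) => //.
    by move/mono; rewrite /p !permK; lia.
  by move/val_inj/perm_inj => E; rewrite E ltnn in ab.
have ge (q : 'S_n) : {homo q : a b / (a < b)%N} -> forall a : 'I_n, (a <= q a)%N.
  move=> hq [a an] /=; elim: a an => // a IH an.
  have an' : (a < n)%N by apply: ltnW.
  by apply: leq_ltn_trans (IH an') _; apply: hq.
apply/permP=> a; rewrite perm1; apply: val_inj; apply/eqP; rewrite eqn_leq ge // andbT.
by have := ge _ mono (s a); rewrite /p permK.
Qed.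

Lemma has_wordM s i k : has_word s k -> has_word (pcomp (adj i) s) k.+1.
Proof.
move=> /existsP[w /eqP ->]; apply/existsP; exists [tuple of rcons w i].
by rewrite /pcomp /= -cats1 big_cat big_seq1.
Qed.

Lemma has_word_pinv s : has_word s #|pinv s|.
Proof.
move: {2}#|pinv s| (erefl #|pinv s|) => k; elim: k s => [|k IH] s sk.
  rewrite sk; apply/existsP; exists [tuple]; rewrite big_nil; apply/eqP.
  apply: no_descent => i; apply/negPn; rewrite -up_or_down; apply/negP.
  by move/pinv_down; rewrite sk.
case: (boolP [exists i, ((s^-1)%g (ord_hi i) < (s^-1)%g (ord_lo i))%N]).
  case/existsP=> i /pinv_down E; rewrite E -{1}(pcomp_adjK i s).
  by apply/has_wordM/IH; move: E; rewrite sk => -[].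
rewrite negb_exists => /forallP h.
have s1 : s = 1%g by apply: no_descent => i; move: (h i); rewrite up_or_down negbK.
suff pinv1 : pinv s = set0 by move: sk; rewrite pinv1 cards0.
by apply/setP=> -[a b]; rewrite !inE s1 invg1 !perm1 /=; lia.
Qed.

Fact len_subproof s : exists k, has_word s k.
Proof. by exists #|pinv s|; exact: has_word_pinv. Qed.

Definition len s : nat := ex_minn (len_subproof s).

Lemma has_word_ge s k : has_word s k -> (#|pinv s| <= k)%N.
Proof.
case/existsP=> w /eqP ->; rewrite -{2}(size_tuple w).
elim/last_ind: {w}(tval w) => [|w i IH].
  rewrite big_nil leqn0 cards_eq0; apply/eqP/setP=> -[a b].
  by rewrite !inE invg1 !perm1 /=; lia.
rewrite -cats1 big_cat big_seq1 size_cat addn1 /=.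
set u := (\prod_(j <- w) _)%g in IH *; rewrite -/(pcomp (adj i) u).
case: (boolP ((u^-1)%g (ord_lo i) < (u^-1)%g (ord_hi i))%N) => [/pinv_up -> //|].
by rewrite -up_or_down => /pinv_down /= E; apply: leqW; apply: leq_trans IH; rewrite E.
Qed.

Lemma len_pinv s : len s = #|pinv s|.
Proof.
apply/eqP; rewrite eqn_leq /len; case: ex_minnP => k /has_word_ge -> h.
by rewrite h // has_word_pinv.
Qed.

Definition DesL s : {set 'I_n.-1} := [set i | (len (pcomp (adj i) s) < len s)%N].

Lemma DesLE s i :
  (i \in DesL s) = ((s^-1)%g (ord_hi i) < (s^-1)%g (ord_lo i))%N.
Proof.
rewrite inE !len_pinv up_or_down.
case: (boolP ((s^-1)%g (ord_lo i) < _)%N) => [/pinv_up ->|].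
  by rewrite ltnNge leqW.
by rewrite -up_or_down => /pinv_down ->; rewrite ltnS leqnn.
Qed.

(* [wle] is the left weak Bruhat order and [wint] its intervals. *)
Definition lcover s t : bool := [exists i, (i \notin DesL s) && (t == pcomp (adj i) s)].
Definition wle s t : bool := connect lcover s t.
Definition wint s t : {set 'S_n} := [set u | wle s u && wle u t].

(* Meant for sets having a unique element of maximal length; [1] is only the
   default value, and belongs to the set in the two uses below. *)
Definition longest (A : {set 'S_n}) : 'S_n := [arg max_(z > 1%g in A) len z].

Definition w0 : 'S_n := longest [set: 'S_n].
Definition w0S S : 'S_n := longest <<[set adj i | i in S]>>%g.
Definition w1S S : 'S_n := pcomp w0 (w0S (~: S)).

(* The permutation [s(1) s(2) ... s(n)] written as the word [w] in the letters
    [1, ..., n]; [w] is meant to contain each of these letters exactly once,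
    otherwise the value is irrelevant. *)
Definition perm_of_word (w : seq nat) : 'S_n :=
  odflt 1%g [pick s : 'S_n | [forall k : 'I_n, (s k).+1 == nth 0%N w k]].

End SymmetricGroup.

(* [hecke0 F n] is the quotient of the algebra terms over the generators by the
   smallest congruence that contains the axioms of unital associative
   [F]-algebras and the defining relations. *)

Section Hecke.
Variables (F : fieldType) (n : nat).

Inductive hterm : Type :=
| HScal of F
| HGen of 'I_n.-1
| HAdd of hterm & hterm
| HMul of hterm & hterm.

HB.instance Definition _ := gen_eqMixin hterm.
HB.instance Definition _ := gen_choiceMixin hterm.

Inductive hcong : hterm -> hterm -> Prop :=
| HC_refl a : hcong a a
| HC_sym a b : hcong a b -> hcong b a
| HC_trans b a c : hcong a b -> hcong b c -> hcong a c
| HC_add a a' b b' : hcong a a' -> hcong b b' -> hcong (HAdd a b) (HAdd a' b')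
| HC_mul a a' b b' : hcong a a' -> hcong b b' -> hcong (HMul a b) (HMul a' b')
| HC_addA a b c : hcong (HAdd a (HAdd b c)) (HAdd (HAdd a b) c)
| HC_addC a b : hcong (HAdd a b) (HAdd b a)
| HC_add0 a : hcong (HAdd (HScal 0) a) a
| HC_addN a : hcong (HAdd (HMul (HScal (-1)) a) a) (HScal 0)
| HC_mulA a b c : hcong (HMul a (HMul b c)) (HMul (HMul a b) c)
| HC_mul1l a : hcong (HMul (HScal 1) a) a
| HC_mul1r a : hcong (HMul a (HScal 1)) a
| HC_mulDl a b c : hcong (HMul (HAdd a b) c) (HAdd (HMul a c) (HMul b c))
| HC_mulDr a b c : hcong (HMul a (HAdd b c)) (HAdd (HMul a b) (HMul a c))
| HC_scalD c d : hcong (HScal (c + d)) (HAdd (HScal c) (HScal d))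
| HC_scalM c d : hcong (HScal (c * d)) (HMul (HScal c) (HScal d))
| HC_scalC c a : hcong (HMul (HScal c) a) (HMul a (HScal c))
| HC_quad i : hcong (HMul (HGen i) (HGen i)) (HMul (HScal (-1)) (HGen i))
| HC_braid (i j : 'I_n.-1) : j = i.+1 :> nat ->
    hcong (HMul (HMul (HGen i) (HGen j)) (HGen i))
          (HMul (HMul (HGen j) (HGen i)) (HGen j))
| HC_comm (i j : 'I_n.-1) : (i.+2 <= j)%N ->
    hcong (HMul (HGen i) (HGen j)) (HMul (HGen j) (HGen i)).

Definition hrel : rel hterm := fun a b => `[< hcong a b >].

Fact hrel_refl : reflexive hrel.
Proof. by move=> a; apply/asboolP; exact: HC_refl. Qed.
Fact hrel_sym : symmetric hrel.
Proof. by move=> a b; apply/asboolP/asboolP; exact: HC_sym. Qed.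
Fact hrel_trans : transitive hrel.
Proof.
by move=> b a c /asboolP ab /asboolP bc; apply/asboolP; exact: HC_trans ab bc.
Qed.

Canonical hrel_equiv := EquivRel hrel hrel_refl hrel_sym hrel_trans.

Definition hecke0 : Type := {eq_quot hrel}.
HB.instance Definition _ := Choice.on hecke0.
HB.instance Definition _ := EqQuotient.on hecke0.

Definition hcls (a : hterm) : hecke0 := \pi_hecke0 a.

Lemma hclsP a b : hcls a = hcls b <-> hcong a b.
Proof.
split; first by move/eqP; rewrite /hcls eqmodE => /asboolP.
by move=> ab; apply/eqP; rewrite /hcls eqmodE; apply/asboolP.
Qed.

Lemma hclsK (x : hecke0) : hcls (repr x) = x.
Proof. exact: reprK. Qed.

Lemma hcong_repr a : hcong (repr (hcls a)) a.
Proof. by apply/hclsP; rewrite hclsK. Qed.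

Lemma hclsW (P : hecke0 -> Prop) : (forall a, P (hcls a)) -> forall x, P x.
Proof. by move=> h x; rewrite -(hclsK x). Qed.

Definition h_scal (c : F) : hecke0 := hcls (HScal c).
Definition h_add (x y : hecke0) : hecke0 := hcls (HAdd (repr x) (repr y)).
Definition h_mul (x y : hecke0) : hecke0 := hcls (HMul (repr x) (repr y)).
Definition h_opp (x : hecke0) : hecke0 := h_mul (h_scal (-1)) x.

Lemma h_addE a b : h_add (hcls a) (hcls b) = hcls (HAdd a b).
Proof. by apply/hclsP/HC_add; exact: hcong_repr. Qed.
Lemma h_mulE a b : h_mul (hcls a) (hcls b) = hcls (HMul a b).
Proof. by apply/hclsP/HC_mul; exact: hcong_repr. Qed.

Let hE := (h_addE, h_mulE).

Fact h_addA : associative h_add.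
Proof. by do 3 elim/hclsW=> ?; rewrite !hE; apply/hclsP/HC_addA. Qed.
Fact h_addC : commutative h_add.
Proof. by do 2 elim/hclsW=> ?; rewrite !hE; apply/hclsP/HC_addC. Qed.
Fact h_add0 : left_id (h_scal 0) h_add.
Proof. by elim/hclsW=> ?; rewrite !hE; apply/hclsP/HC_add0. Qed.
Fact h_addN : left_inverse (h_scal 0) h_opp h_add.
Proof. by elim/hclsW=> ?; rewrite /h_opp h_mulE h_addE; apply/hclsP/HC_addN. Qed.
Fact h_mulA : associative h_mul.
Proof. by do 3 elim/hclsW=> ?; rewrite !hE; apply/hclsP/HC_mulA. Qed.
Fact h_mul1l : left_id (h_scal 1) h_mul.
Proof. by elim/hclsW=> ?; rewrite !hE; apply/hclsP/HC_mul1l. Qed.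
Fact h_mul1r : right_id (h_scal 1) h_mul.
Proof. by elim/hclsW=> ?; rewrite !hE; apply/hclsP/HC_mul1r. Qed.
Fact h_mulDl : left_distributive h_mul h_add.
Proof. by do 3 elim/hclsW=> ?; rewrite !hE; apply/hclsP/HC_mulDl. Qed.
Fact h_mulDr : right_distributive h_mul h_add.
Proof. by do 3 elim/hclsW=> ?; rewrite !hE; apply/hclsP/HC_mulDr. Qed.

HB.instance Definition _ :=
  GRing.isZmodule.Build hecke0 h_addA h_addC h_add0 h_addN.
HB.instance Definition _ :=
  GRing.Zmodule_isPzRing.Build hecke0 h_mulA h_mul1l h_mul1r h_mulDl h_mulDr.

Definition hgen (i : 'I_n.-1) : hecke0 := hcls (HGen i).

Lemma hclsD a b : hcls (HAdd a b) = hcls a + hcls b.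
Proof. by rewrite -h_addE. Qed.
Lemma hclsM a b : hcls (HMul a b) = hcls a * hcls b.
Proof. by rewrite -h_mulE. Qed.
Lemma h_scalD c d : h_scal (c + d) = h_scal c + h_scal d.
Proof. by rewrite -hclsD; apply/hclsP/HC_scalD. Qed.
Lemma h_scalM c d : h_scal (c * d) = h_scal c * h_scal d.
Proof. by rewrite -hclsM; apply/hclsP/HC_scalM. Qed.
Lemma h_scal1 : h_scal 1 = 1.
Proof. by []. Qed.
Lemma h_scalC c x : h_scal c * x = x * h_scal c.
Proof. by elim/hclsW: x => a; rewrite -!hclsM; apply/hclsP/HC_scalC. Qed.

(* A module is given by linear operators, the actions of the generators,
   satisfying the defining relations. *)

Section OperatorModule.
Variables (V : lmodType F) (op : 'I_n.-1 -> V -> V).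

Record hecke0_rep : Prop := HeckeRep {
  rep_lin : forall i, linear (op i);
  rep_quad : forall i v, op i (op i v) = - op i v;
  rep_braid : forall (i j : 'I_n.-1) v, j = i.+1 :> nat ->
    op i (op j (op i v)) = op j (op i (op j v));
  rep_comm : forall (i j : 'I_n.-1) v, (i.+2 <= j)%N ->
    op i (op j v) = op j (op i v)
}.

Fixpoint hact (a : hterm) (v : V) : V :=
  match a with
  | HScal c => c *: v
  | HGen i => op i v
  | HAdd a b => hact a v + hact b v
  | HMul a b => hact a (hact b v)
  end.

Hypothesis rep : hecke0_rep.

Lemma hact_lin a : linear (hact a).
Proof.
elim: a => [c|i|a IHa b IHb|a IHa b IHb] k u v /=.
- by rewrite scalerDr !scalerA mulrC.
- exact: rep_lin.
- by rewrite IHa IHb scalerDr addrACA.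
- by rewrite IHb IHa.
Qed.

Lemma hact_cong a b : hcong a b -> hact a =1 hact b.
Proof.
have hD c u v : hact c (u + v) = hact c u + hact c v.
  by have := hact_lin c 1 u v; rewrite !scale1r.
have h0 c : hact c 0 = 0.
  by apply: (addrI (hact c 0)); rewrite -hD !addr0.
have hZ c k v : hact c (k *: v) = k *: hact c v.
  by have := hact_lin c k v 0; rewrite h0 !addr0.
elim=> {a b} /=.
- by [].
- by move=> a b _ h v.
- by move=> b a c _ h1 _ h2 v; rewrite h1.
- by move=> a a' b b' _ h1 _ h2 v; rewrite h1 h2.
- by move=> a a' b b' _ h1 _ h2 v; rewrite h2 h1.
- by move=> a b c v; rewrite addrA.
- by move=> a b v; rewrite addrC.
- by move=> a v; rewrite scale0r add0r.
- by move=> a v; rewrite scaleN1r addNr scale0r.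
- by [].
- by move=> a v; rewrite scale1r.
- by move=> a v; rewrite scale1r.
- by [].
- by move=> a b c v; rewrite hD.
- by move=> c d v; rewrite scalerDl.
- by move=> c d v; rewrite scalerA.
- by move=> c a v; rewrite hZ.
- by move=> i v; rewrite rep_quad // scaleN1r.
- by move=> i j ij v; rewrite rep_braid.
- by move=> i j ij v; rewrite rep_comm.
Qed.

Definition opmod of hecke0_rep : Type := V.
HB.instance Definition _ := GRing.Zmodule.copy (opmod rep) V.

Definition opmod_scale (x : hecke0) (v : opmod rep) : opmod rep := hact (repr x) v.

Lemma opmod_scaleE a v : opmod_scale (hcls a) v = hact a v.
Proof. exact: (hact_cong (hcong_repr a)). Qed.

Fact opmod_scaleA (x y : hecke0) v :
  opmod_scale x (opmod_scale y v) = opmod_scale (x * y) v.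
Proof.
by elim/hclsW: x => a; elim/hclsW: y => b; rewrite -hclsM !opmod_scaleE.
Qed.
Fact opmod_scale1 : left_id 1 opmod_scale.
Proof. by move=> v; rewrite -h_scal1 opmod_scaleE /= scale1r. Qed.
Fact opmod_scaleDr : right_distributive opmod_scale +%R.
Proof.
move=> x u v; rewrite /opmod_scale.
by have := hact_lin (repr x) 1 u v; rewrite !scale1r.
Qed.
Fact opmod_scaleDl v : {morph opmod_scale^~ v : x y / x + y}.
Proof.
move=> x y; elim/hclsW: x => a; elim/hclsW: y => b.
by rewrite -hclsD !opmod_scaleE.
Qed.

HB.instance Definition _ := GRing.Zmodule_isLmodule.Build hecke0 (opmod rep)
  opmod_scaleA opmod_scale1 opmod_scaleDr opmod_scaleDl.

End OperatorModule.

Definition hecke0_module (V : lmodType F) (op : 'I_n.-1 -> V -> V)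
  (rep : hecke0_rep op) : lmodType hecke0 := opmod rep.

Fact zero_rep : @hecke0_rep F^o (fun _ _ => 0).
Proof.
split=> //= [i k u v|i v]; last by rewrite oppr0.
by rewrite scaler0 addr0.
Qed.

Fact h_oner_neq0 : (1 : hecke0) != 0.
Proof.
apply/eqP=> /(congr1 (fun x : hecke0 => x *: (1 : hecke0_module zero_rep))).
rewrite scale1r scale0r => /eqP; apply/negP; exact: (oner_neq0 F).
Qed.

HB.instance Definition _ := GRing.PzSemiRing_isNonZero.Build hecke0 h_oner_neq0.

Definition h_scale (c : F) (x : hecke0) : hecke0 := h_scal c * x.

Fact h_scaleA c d x : h_scale c (h_scale d x) = h_scale (c * d) x.
Proof. by rewrite /h_scale mulrA -h_scalM. Qed.
Fact h_scale1 : left_id 1 h_scale.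
Proof. by move=> x; rewrite /h_scale h_scal1 mul1r. Qed.
Fact h_scaleDr : right_distributive h_scale +%R.
Proof. by move=> c x y; rewrite /h_scale mulrDr. Qed.
Fact h_scaleDl x : {morph h_scale^~ x : c d / c + d}.
Proof. by move=> c d; rewrite /h_scale h_scalD mulrDl. Qed.
HB.instance Definition _ := GRing.Zmodule_isLmodule.Build F hecke0
  h_scaleA h_scale1 h_scaleDr h_scaleDl.

Fact h_scaleAl (c : F) (x y : hecke0) : c *: (x * y) = c *: x * y.
Proof. exact: mulrA. Qed.
Fact h_scaleAr (c : F) (x y : hecke0) : c *: (x * y) = x * (c *: y).
Proof. by rewrite /GRing.scale /= /h_scale mulrA h_scalC -mulrA. Qed.
HB.instance Definition _ := GRing.Lmodule_isLalgebra.Build F hecke0 h_scaleAl.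
HB.instance Definition _ := GRing.Lalgebra_isAlgebra.Build F hecke0 h_scaleAr.

Lemma hgen_quad i : hgen i * hgen i = - hgen i.
Proof.
have -> : - hgen i = h_scal (-1) * hgen i by [].
by rewrite -!hclsM; apply/hclsP/HC_quad.
Qed.

Lemma hgen_braid (i j : 'I_n.-1) : j = i.+1 :> nat ->
  hgen i * hgen j * hgen i = hgen j * hgen i * hgen j.
Proof.
have e a b c : hgen a * hgen b * hgen c = hcls (HMul (HMul (HGen a) (HGen b)) (HGen c)).
  by rewrite !hclsM.
by move=> ij; rewrite !e; apply/hclsP/HC_braid.
Qed.

Lemma hgen_comm (i j : 'I_n.-1) : (i.+2 <= j)%N -> hgen i * hgen j = hgen j * hgen i.
Proof. by move=> ij; rewrite -!hclsM; apply/hclsP/HC_comm. Qed.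

Lemma hgen_opmod (V : lmodType F) (op : 'I_n.-1 -> V -> V) (rep : hecke0_rep op) i
  (v : hecke0_module rep) : hgen i *: v = op i v.
Proof. exact: opmod_scaleE. Qed.

Lemma h_scal_opmod (V : lmodType F) (op : 'I_n.-1 -> V -> V) (rep : hecke0_rep op)
  c (v : hecke0_module rep) : (c *: (1 : hecke0)) *: v = c *: (v : V).
Proof.
have -> : c *: (1 : hecke0) = h_scal c by exact: mulr1.
exact: opmod_scaleE.
Qed.

End Hecke.

Section WeakBruhatModule.
Variables (F : fieldType) (n : nat) (s t : 'S_n).
Local Notation lo := (@ord_lo n).
Local Notation hi := (@ord_hi n).

Definition wint_elt : finType := {u : 'S_n | u \in wint s t}.
Definition wb_space : lmodType F := {ffun wint_elt -> F^o}.

Definition wb_basis (u : wint_elt) : wb_space := [ffun v => (v == u)%:R].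

Definition wb_act (i : 'I_n.-1) (u : wint_elt) : wb_space :=
  if i \in DesL (val u) then - wb_basis u
  else if insub (pcomp (adj i) (val u)) is Some v then wb_basis v
  else 0.

Definition wb_op (i : 'I_n.-1) (f : wb_space) : wb_space :=
  \sum_(u : wint_elt) f u *: wb_act i u.

Lemma wb_op_lin i : linear (wb_op i).
Proof.
move=> k f g; rewrite /wb_op scaler_sumr -big_split /=.
by apply: eq_bigr => u _; rewrite !ffunE scalerDl scalerA.
Qed.

Lemma wb_opD i f g : wb_op i (f + g) = wb_op i f + wb_op i g.
Proof. by have := wb_op_lin i 1 f g; rewrite !scale1r. Qed.
Lemma wb_op0 i : wb_op i 0 = 0.
Proof. by apply: (addrI (wb_op i 0)); rewrite -wb_opD !addr0. Qed.
Lemma wb_opZ i k f : wb_op i (k *: f) = k *: wb_op i f.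
Proof. by have := wb_op_lin i k f 0; rewrite wb_op0 !addr0. Qed.
Lemma wb_opN i f : wb_op i (- f) = - wb_op i f.
Proof. by rewrite -!scaleN1r wb_opZ. Qed.

Lemma wb_op_basis i u : wb_op i (wb_basis u) = wb_act i u.
Proof.
rewrite /wb_op (bigD1 u) //= big1 ?addr0; first by rewrite ffunE eqxx scale1r.
by move=> v /negPf vu; rewrite ffunE vu scale0r.
Qed.

Lemma wb_expand (f : wb_space) : f = \sum_u f u *: wb_basis u.
Proof.
apply/ffunP=> v; rewrite sum_ffunE (bigD1 v) //= big1 ?addr0.
  by rewrite !ffunE eqxx; exact: (esym (mulr1 _)).
by move=> u uv; rewrite !ffunE eq_sym (negPf uv) scaler0.
Qed.

Lemma wb_eq_lin (f g : wb_space -> wb_space) : linear f -> linear g ->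
  (forall u, f (wb_basis u) = g (wb_basis u)) -> f =1 g.
Proof.
move=> lf lg fg x.
have sumE (h : wb_space -> wb_space) : linear h ->
    h x = \sum_u x u *: h (wb_basis u).
  move=> lh; have hD : {morph h : a b / a + b}.
    by move=> a b; have := lh 1 a b; rewrite !scale1r.
  have h0 : h 0 = 0 by apply: (addrI (h 0)); rewrite -hD !addr0.
  rewrite {1}(wb_expand x) (big_morph h hD h0); apply: eq_bigr => u _.
  by have := lh (x u) (wb_basis u) 0; rewrite h0 !addr0.
by rewrite !sumE //; apply: eq_bigr => u _; rewrite fg.
Qed.

(* [wb_vec u] is [u] if [u] belongs to the interval, and [0] otherwise *)
Definition wb_vec (u : 'S_n) : wb_space := oapp wb_basis 0 (insub u).

Lemma wb_vecE (u : wint_elt) : wb_vec (val u) = wb_basis u.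
Proof. by rewrite /wb_vec valK. Qed.

Lemma wb_vec_out u : u \notin wint s t -> wb_vec u = 0.
Proof. by move=> h; rewrite /wb_vec insubN. Qed.

Lemma wle_step (u : 'S_n) i : i \notin DesL u -> wle u (pcomp (adj i) u).
Proof. by move=> iu; apply/connect1/existsP; exists i; rewrite iu eqxx. Qed.

Lemma wb_op_vec i (u : 'S_n) : wle s u ->
  wb_op i (wb_vec u) = if i \in DesL u then - wb_vec u else wb_vec (pcomp (adj i) u).
Proof.
move=> su; case: (boolP (u \in wint s t)) => [uI|uI].
  pose v : wint_elt := Sub u uI; have -> : u = val v by [].
  by rewrite wb_vecE wb_op_basis /wb_act; case: ifP.
rewrite (wb_vec_out uI) wb_op0 oppr0; case: ifPn => // iu.
rewrite wb_vec_out //; apply: contra uI; rewrite !inE su => /andP[_].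
by apply: connect_trans; exact: wle_step.
Qed.

Lemma wle_pcomp (u : 'S_n) i : i \notin DesL u -> wle s u -> wle s (pcomp (adj i) u).
Proof. by move=> iu su; apply: connect_trans su (wle_step iu). Qed.

Lemma DesL_pcomp i j (u : 'S_n) : (j \in DesL (pcomp (adj i) u)) =
  ((u^-1)%g (adj i (ord_hi j)) < (u^-1)%g (adj i (ord_lo j)))%N.
Proof. by rewrite DesLE /pcomp invMg !permM tpermV. Qed.

Lemma wint_wle (u : wint_elt) : wle s (val u).
Proof. by have := valP u; rewrite inE => /andP[]. Qed.

Fact wb_rep : hecke0_rep wb_op.
Proof.
have linC i j : linear (wb_op i \o wb_op j).
  by move=> k f g /=; rewrite !wb_op_lin.
split.
- exact: wb_op_lin.
- move=> i; apply: (wb_eq_lin (linC i i)).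
    by move=> k f g; rewrite wb_op_lin opprD scalerN.
  move=> u /=; rewrite -wb_vecE (wb_op_vec _ (wint_wle u)).
  case: ifPn => iu; first by rewrite wb_opN wb_op_vec ?wint_wle // iu.
  rewrite wb_op_vec ?wle_pcomp ?wint_wle // ifT // DesL_pcomp /adj tpermL tpermR.
  by move: iu; rewrite DesLE up_or_down negbK.
- move=> i j + ij; apply: wb_eq_lin.
  + by move=> k f g /=; rewrite !wb_op_lin.
  + by move=> k f g /=; rewrite !wb_op_lin.
  move=> u; rewrite -wb_vecE; move: (val u) (wint_wle u) => {}u su.
  have VE k (w : 'S_n) x : ((pcomp (adj k) w)^-1)%g x = (w^-1)%g (adj k x).
    by rewrite /pcomp invMg permM tpermV.
  have mE : lo j = hi i by apply: val_inj; rewrite /= ij.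
  have il : adj i (lo i) = hi i by rewrite /adj tpermL.
  have im : adj i (hi i) = lo i by rewrite /adj tpermR.
  have ih : adj i (hi j) = hi j by rewrite /adj tpermD // -val_eqE /= ij; lia.
  have jl : adj j (lo i) = lo i by rewrite /adj tpermD // -val_eqE /= ij; lia.
  have jm : adj j (hi i) = hi j by rewrite /adj mE tpermL.
  have jh : adj j (hi j) = hi i by rewrite /adj mE tpermR.
  have aE := (il, im, ih, jl, jm, jh).
  have braidE : pcomp (adj i) (pcomp (adj j) (pcomp (adj i) u)) =
                pcomp (adj j) (pcomp (adj i) (pcomp (adj j) u)).
    rewrite /pcomp -!mulgA; congr (_ * _)%g.
    have J k k' : (adj k * (adj k' * adj k))%g = (adj k' ^ adj k)%g.
      by rewrite /conjg tpermV.
    by rewrite !J ![(_ ^ _)%g]tpermJ mE !aE.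
  have ab : (u^-1)%g (lo i) != (u^-1)%g (hi i) :> nat.
    by rewrite (inj_eq val_inj) (inj_eq perm_inj) -val_eqE /=; lia.
  have bc : (u^-1)%g (hi i) != (u^-1)%g (hi j) :> nat.
    by rewrite (inj_eq val_inj) (inj_eq perm_inj) -val_eqE /=; lia.
  have ac : (u^-1)%g (lo i) != (u^-1)%g (hi j) :> nat.
    by rewrite (inj_eq val_inj) (inj_eq perm_inj) -val_eqE /=; lia.
  have := DesLE u i; have := DesLE u j.
  have := DesLE (pcomp (adj i) u) i; have := DesLE (pcomp (adj i) u) j.
  have := DesLE (pcomp (adj j) u) i; have := DesLE (pcomp (adj j) u) j.
  have := DesLE (pcomp (adj j) (pcomp (adj i) u)) i.
  have := DesLE (pcomp (adj j) (pcomp (adj i) u)) j.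
  have := DesLE (pcomp (adj i) (pcomp (adj j) u)) i.
  have := DesLE (pcomp (adj i) (pcomp (adj j) u)) j.
  rewrite !VE !mE !aE.
  case: (ltngtP ((u^-1)%g (lo i)) ((u^-1)%g (hi i))) ab => // ab _;
    case: (ltngtP ((u^-1)%g (hi i)) ((u^-1)%g (hi j))) bc => // bc _;
    case: (ltngtP ((u^-1)%g (lo i)) ((u^-1)%g (hi j))) ac => // ac _;
    try (exfalso; lia); move=> e1 e2 e3 e4 e5 e6 e7 e8 e9 e10;
    do 4 rewrite ?wb_opN ?wb_op_vec ?wle_pcomp ?(e1, e2, e3, e4, e5, e6, e7, e8, e9, e10) //;
    rewrite ?braidE ?opprK //.
- move=> i j + ij; apply: (wb_eq_lin (linC i j) (linC j i)) => u /=.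
  rewrite -wb_vecE; move: (val u) (wint_wle u) => {}u su.
  have iE : (i \in DesL (pcomp (adj j) u)) = (i \in DesL u).
    by rewrite DesL_pcomp DesLE /adj !tpermD // -val_eqE /=; lia.
  have jE : (j \in DesL (pcomp (adj i) u)) = (j \in DesL u).
    by rewrite DesL_pcomp DesLE /adj !tpermD // -val_eqE /=; lia.
  have ji : pcomp (adj j) (pcomp (adj i) u) = pcomp (adj i) (pcomp (adj j) u).
    rewrite /pcomp -!mulgA; congr (_ * _)%g.
    rewrite conjgC {2}/adj tpermJ /adj !tpermD // -val_eqE /=; lia.
  rewrite !wb_op_vec //.
  case: (boolP (i \in DesL u)) => iu; case: (boolP (j \in DesL u)) => ju;
    rewrite ?wb_opN !wb_op_vec ?wle_pcomp // ?iE ?jE ?(negPf iu) ?(negPf ju) ?iu ?ju //.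
  by rewrite ji.
Qed.

Definition Bbar : lmodType (hecke0 F n) := hecke0_module wb_rep.

Lemma Bbar_gen i (u : wint_elt) : hgen F i *: (wb_basis u : Bbar) = wb_act i u.
Proof. by rewrite hgen_opmod wb_op_basis. Qed.

End WeakBruhatModule.

(* The category is that of finitely generated left [A]-modules: the test
   modules in the definitions below are finitely generated. *)

Section ModuleCategory.
Variable A : pzRingType.
Implicit Types M N P E X : lmodType A.

Definition fin_gen M : Prop :=
  exists s : seq M, forall v, exists c : 'I_(size s) -> A, v = \sum_i c i *: s`_i.

Definition surjective (T U : Type) (f : T -> U) : Prop := forall y, exists x, f x = y.

Definition projective P : Prop := fin_gen P /\
  forall M N (f : {linear M -> N}) (g : {linear P -> N}),
    fin_gen M -> fin_gen N -> surjective f ->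
    exists h : {linear P -> M}, forall x, f (h x) = g x.

Definition injective_module E : Prop := fin_gen E /\
  forall M N (f : {linear M -> N}) (g : {linear M -> E}),
    fin_gen M -> fin_gen N -> injective f ->
    exists h : {linear N -> E}, forall x, h (f x) = g x.

Definition essential_epi P M (f : {linear P -> M}) : Prop := surjective f /\
  forall X (g : {linear X -> P}), fin_gen X ->
    surjective (fun x => f (g x)) -> surjective g.

Definition essential_mono M E (f : {linear M -> E}) : Prop := injective f /\
  forall X (g : {linear E -> X}), fin_gen X ->
    injective (fun x => g (f x)) -> injective g.

Definition projective_cover P M : Prop :=
  projective P /\ exists f : {linear P -> M}, essential_epi f.

Definition injective_hull E M : Prop :=
  injective_module E /\ exists f : {linear M -> E}, essential_mono f.

Definition indecomposable M : Prop := (exists v : M, v != 0) /\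
  forall B C : {pred M}, GRing.submod_closed B -> GRing.submod_closed C ->
    (forall v, exists2 b, b \in B & exists2 c, c \in C & v = b + c) ->
    (forall v, v \in B -> v \in C -> v = 0) ->
    (forall v, v \in B -> v = 0) \/ (forall v, v \in C -> v = 0).

End ModuleCategory.

Local Close Scope ring_scope.
Local Open Scope nat_scope.

Definition is_composition (n : nat) (al : seq nat) : bool :=
  all (leq 1) al && (sumn al == n).

(* [part al i] is the part of index [i] in the 1-based numbering. *)
Definition part (al : seq nat) (i : nat) : nat := nth 0 al i.-1.

Definition is_peak (al : seq nat) : Prop :=
  forall i, 1 <= i < size al -> part al i != 1.

Definition comp_set (n : nat) (al : seq nat) : {set 'I_n.-1} :=
  [set i : 'I_n.-1 | i.+1 \in [seq sumn (take k al) | k <- iota 1 (size al).-1]].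

Definition evens (n k : nat) : {set 'I_n.-1} :=
  [set i : 'I_n.-1 | ~~ odd i.+1 && (i.+1 <= k.*2)].

(* A box is a pair (column from the left, row from the bottom), numbered from 1;
   a diagram is a duplicate-free list of boxes, whose order is irrelevant, and
   the values of a filling outside its diagram are irrelevant. *)
Notation box := (nat * nat)%type.
Notation diagram := (seq box).
Notation filling := (box -> nat).

Definition ord_LT : rel box :=
  fun b c => (c.2 < b.2) || (b.2 == c.2) && (b.1 <= c.1).
Definition ord_LB : rel box :=
  fun b c => (b.2 < c.2) || (b.2 == c.2) && (b.1 <= c.1).
Definition ord_col : rel box :=
  fun b c => (b.1 < c.1) || (b.1 == c.1) && (c.2 <= b.2).

Definition w_LT (D : diagram) (T : filling) : seq nat := [seq T b | b <- sort ord_LT D].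
Definition w_LB (D : diagram) (T : filling) : seq nat := [seq T b | b <- sort ord_LB D].

Definition col_filling (D : diagram) : filling := fun b => (index b (sort ord_col D)).+1.

Definition tcd (al : seq nat) : diagram :=
  [seq (j, i) | i <- iota 1 (size al), j <- iota 1 (part al i)].

Section SourceTableau.
Variable al : seq nat.

Definition first_columns (b : box) : nat := if b.1 == 1 then (b.2).*2.-1 else (b.2).*2.

Definition used_numbers : seq nat := [seq first_columns b | b <- tcd al & b.1 <= 2].

Definition other_numbers : seq nat :=
  [seq k <- iota 1 (sumn al) | k \notin used_numbers].

Definition other_boxes : diagram := sort ord_LT [seq b <- tcd al | 3 <= b.1].

(* The tableau T''_al. *)
Definition source_filling : filling := fun b =>
  if b.1 <= 2 then first_columns b else nth 0 other_numbers (index b other_boxes).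

End SourceTableau.

(* The subtracted term comes last: the sum of the [al_r - 2] has the summand [-1]
   if the last part is 1, but the resulting shift is nonnegative when [al] is a
   peak composition and [j < size al]. *)
Definition row_shift (al : seq nat) (j : nat) : nat :=
  ((size al).-1 + \sum_(j.+1 <= r < (size al).+1) part al r) - 2 * (size al - j).

Definition cover_row (al : seq nat) (j : nat) : diagram :=
  if j == size al then [seq (j + x - 1, j) | x <- iota 1 (part al j)]
  else [:: (j, j); (j.+1, j)] ++
       [seq (row_shift al j + x, j) | x <- iota 1 (part al j) & 3 <= x].

(* The diagram D(Q^r_al, w_LT). *)
Definition cover_diagram (al : seq nat) : diagram :=
  flatten [seq cover_row al j | j <- iota 1 (size al)].

(* The module Q^r_al. *)
Definition Qr (F : fieldType) (n : nat) (al : seq nat) : lmodType (hecke0 F n) :=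
  Bbar F (perm_of_word n (w_LT (tcd al) (source_filling al)))
         (w1S (comp_set n (rev al))).

(* Main.v *)
(* Bruhat intervals from [w0S T] to [w1S S] consist of the [w] with right descent set
   between [T] and [S]. Sums over cosets of parabolic subgroups give a basis of the
   regular module, unitriangular in the standard one, that exhibits the modules of
   these intervals as direct summands; the coefficient of [w0] is a Frobenius form on
   the regular module, so the summands are both projective and injective. For [T = S]
   the socle is simple, spanned by [w1S S], because an eigenvector of the regular
   module is determined by its character up to a scalar; hence the summand is
   indecomposable and the injective hull of each of its submodules spanned by an upper
   interval, such as [Qr], whose source tableau has right descent set [S].

   For the projective cover, relabelling the boxes of [tcd alpha] by those of the cover
   diagram identifies the basis of [Qr] with a lower set of the interval of the cover,
   with the same left descents, and so gives an epimorphism. It is essential because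
   the functionals on the cover on which every generator acts by a scalar are supported
   on a Young subgroup, and this lower set contains the elements of the interval lying
   in that subgroup. *)

Require Import Defs.
From mathcomp Require Import all_boot all_order all_fingroup all_algebra.
From mathcomp Require Import reals complex.
From HB Require Import structures.
From mathcomp Require Import boolp zify.

Set Implicit Arguments.
Unset Strict Implicit.
Unset Printing Implicit Defensive.

Import GRing.Theory.

(* [ssrfun] has a function of the same name. *)
Local Notation pcomp := Defs.pcomp.

(** The algebra is given by generators and relations, so neither a basis nor its dimension is known
    at the start. The regular module is therefore modelled by the interval from the identity to
    [w0], whose basis exists by construction; Matsumoto's theorem makes it free on the identity.
    Questions about the weak order become questions about inversions of positions, and parabolic
    subgroups become partitions of the positions into blocks.

    The set 2[l-1], with l the number of rows, comes from the shape of the cover diagram. For 0 < j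
    < l, its column j+1 consists of the first box of row j+1 and, below it, the second box of row j;
    numbering down the columns gives them 2j and 2j+1. A right descent at 2j is thus exactly the
    inequality that a standard peak immaculate tableau demands between neighbouring rows. The boxes
    from the third on occupy successive groups of columns, top row first, so that the column order
    runs through them as [w_LT] does. *)

Section WeakOrder.

(** * The left weak order in terms of inversions and descents *)

Variable n : nat.
Implicit Types (s t u v w z : 'S_n) (i j k : 'I_n.-1) (J S T : {set 'I_n.-1})
  (a b c : 'I_n).

Definition DesR w : {set 'I_n.-1} := [set k | (w (ord_hi k) < w (ord_lo k))%N].

Lemma DesRE w k : (k \in DesR w) = (w (ord_hi k) < w (ord_lo k))%N.
Proof. by rewrite inE. Qed.

Lemma lo_neq_hi k : ord_lo k != ord_hi k.
Proof. by rewrite -val_eqE /=; lia. Qed.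

Lemma ltn_permN w k : (w (ord_lo k) < w (ord_hi k))%N = (k \notin DesR w).
Proof.
rewrite DesRE -leqNgt ltn_neqAle.
by rewrite (inj_eq val_inj) (inj_eq perm_inj) lo_neq_hi.
Qed.

Lemma DesLN w k :
  (k \notin DesL w) = ((w^-1)%g (ord_lo k) < (w^-1)%g (ord_hi k))%N.
Proof. by rewrite DesLE up_or_down negbK. Qed.

Lemma DesL_inv w : DesL (w^-1)%g = DesR w.
Proof. by apply/setP=> k; rewrite DesLE DesRE invgK. Qed.

Lemma pcompE s t a : pcomp s t a = s (t a).
Proof. by rewrite /pcomp permM. Qed.

Lemma pcompVE s t a : ((pcomp s t)^-1)%g a = (t^-1)%g ((s^-1)%g a).
Proof. by rewrite /pcomp invMg permM. Qed.

Lemma adjV i : ((adj i)^-1)%g = adj i.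
Proof. exact: tpermV. Qed.

Lemma adj_lo i : adj i (ord_lo i) = ord_hi i.
Proof. exact: tpermL. Qed.

Lemma adj_hi i : adj i (ord_hi i) = ord_lo i.
Proof. exact: tpermR. Qed.

Lemma pcomp_adjC i s t : pcomp (adj i) (pcomp s t) = pcomp (pcomp (adj i) s) t.
Proof. by rewrite /pcomp mulgA. Qed.

Lemma DesL_adj w i : (i \in DesL (pcomp (adj i) w)) = (i \notin DesL w).
Proof. by rewrite DesLE !pcompVE adjV adj_lo adj_hi DesLN. Qed.

Lemma inversion_up w i a b : i \notin DesL w -> (a < b)%N -> (w b < w a)%N ->
  (pcomp (adj i) w b < pcomp (adj i) w a)%N.
Proof.
rewrite DesLN => up ab ba; rewrite !pcompE; apply: tperm_ltn => //.
apply: contraTneq up => -[<- <-]; rewrite !permK; lia.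
Qed.

Lemma DesR_up w i : i \notin DesL w -> DesR w \subset DesR (pcomp (adj i) w).
Proof.
by move=> up; apply/subsetP=> k; rewrite !DesRE; apply: inversion_up => //=.
Qed.

(** A cover adds one inversion of positions and keeps the others. Conversely, if [s] differs from
    [t] and all its inversions are inversions of [t], two neighbouring values of [s] can be
    exchanged so as to add an inversion of [t]. The induction is on the number of pairs outside of
    [pinv s]. *)
Lemma wleP s t :
  reflect (forall a b, (a < b)%N -> (s b < s a)%N -> (t b < t a)%N) (wle s t).
Proof.
apply: (iffP idP).
  case/connectP=> p + ->; elim: p s => [|x p IH] s //=.
  case/andP=> /existsP[i /andP[up /eqP ->]] px a b ab sab.
  by apply: (IH _ px) => //; apply: inversion_up.
have [m] := ubnP (n * n - #|pinv s|); elim: m s => // m IH s lem st.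
have [->|ne] := eqVneq s t; first exact: connect0.
(* This is a descent of the map [t] after the inverse of [s]; without one that map would be
   increasing, hence the identity. *)
have [i i_desc] : exists i, (t ((s^-1)%g (ord_hi i)) < t ((s^-1)%g (ord_lo i)))%N.
  apply/existsP; apply: contraNT ne; rewrite negb_exists => /forallP h.
  suff E : (t^-1 * s)%g = 1%g by apply/eqP/(mulgI (t^-1)%g); rewrite E mulVg.
  apply: no_descent => i; rewrite invMg invgK !permM.
  have := h i; rewrite -leqNgt leq_eqVlt => /orP[|//].
  rewrite (inj_eq val_inj) !(inj_eq perm_inj) => /eqP E.
  by have := lo_neq_hi i; rewrite E eqxx.
have up : i \notin DesL s.
  rewrite DesLN ltnNge leq_eqVlt negb_or -leqNgt (inj_eq val_inj) (inj_eq perm_inj).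
  rewrite eq_sym lo_neq_hi /= leqNgt; apply/negP=> lt.
  have := st _ _ lt; rewrite !permKV /= ltnSn => /(_ isT); lia.
apply: connect_trans (wle_step up) _; apply: IH.
  have /pinv_up E : ((s^-1)%g (ord_lo i) < (s^-1)%g (ord_hi i))%N by rewrite -DesLN.
  have := max_card [in pinv (pcomp (adj i) s)]; rewrite card_prod card_ord.
  by move: lem; rewrite E; lia.
move=> a b ab; rewrite !pcompE.
case: (ltngtP (s a) (s b)) => [lt h|gt _|/val_inj/perm_inj E]; last by rewrite E ltnn in ab.
- have [[sa sb]|ne'] := eqVneq (s a, s b) (ord_lo i, ord_hi i).
    by move: i_desc; rewrite -sa -sb !permK.
  by have := tperm_ltn lt ne'; lia.
- exact: st.
Qed.

(* [a] and [b] lie in the same orbit of the parabolic subgroup generated by the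
   [adj k] with [k] in [J]; these orbits are intervals. *)
Definition blk J a b : bool :=
  [forall k : 'I_n.-1, (minn a b <= k < maxn a b)%N ==> (k \in J)].

Lemma blkP J a b :
  reflect (forall k : 'I_n.-1, (minn a b <= k < maxn a b)%N -> k \in J) (blk J a b).
Proof. exact: forall_inP. Qed.

Lemma blk_refl J a : blk J a a.
Proof. by apply/blkP=> k; lia. Qed.

Lemma blk_sym J a b : blk J a b = blk J b a.
Proof. by rewrite /blk minnC maxnC. Qed.

Lemma blk_trans J a b c : blk J a b -> blk J b c -> blk J a c.
Proof.
move=> /blkP ab /blkP bc; apply/blkP=> k hk.
have /orP[] : (minn a b <= k < maxn a b)%N || (minn b c <= k < maxn b c)%N by lia.
- exact: ab.
- exact: bc.
Qed.

Lemma blkS J1 J2 a b : J1 \subset J2 -> blk J1 a b -> blk J2 a b.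
Proof. by move=> /subsetP J12 /blkP ab; apply/blkP=> k /ab/J12. Qed.

Lemma blk_lo_hi J k : blk J (ord_lo k) (ord_hi k) = (k \in J).
Proof.
apply/blkP/idP => [h|kJ j hj]; first by apply: h => /=; lia.
by have -> : j = k by apply: val_inj => /=; move: hj => /=; lia.
Qed.

Lemma blk_adj J k a : k \in J -> blk J a (adj k a).
Proof.
rewrite -blk_lo_hi => kJ.
rewrite /adj; case: tpermP => [->|->|_ _] //; first by rewrite blk_sym.
exact: blk_refl.
Qed.

(** Some index outside of [J] separates [a] from [b], and moving inside a block cannot cross it. *)
Lemma blk_ltn J a b a' b' : (a < b)%N -> ~~ blk J a b -> blk J a a' -> blk J b b' ->
  (a' < b')%N.
Proof.
move=> ab /forall_inPn[k hk kJ] /blkP aa' /blkP bb'; rewrite ltnNge; apply/negP=> ba'.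
have /orP[/aa'|/bb'] : (minn a a' <= k < maxn a a')%N || (minn b b' <= k < maxn b b')%N.
  by move: hk ab ba'; rewrite unfold_in; lia.
- by apply/negP.
- by apply/negP.
Qed.

Lemma blk_homo (r : rel 'I_n) J : transitive r ->
  {in J, forall k, r (ord_lo k) (ord_hi k)} ->
  forall a b, (a < b)%N -> blk J a b -> r a b.
Proof.
move=> r_trans rJ a [b bn] /=; elim: b bn => // b IH bn ab /blkP h.
have bn' : (b < n)%N by apply: ltnW.
have bn1 : (b < n.-1)%N by lia.
have hiE : ord_hi (Ordinal bn1) = Ordinal bn by apply: val_inj.
have loE : ord_lo (Ordinal bn1) = Ordinal bn' by apply: val_inj.
have rb : r (Ordinal bn') (Ordinal bn).
  by rewrite -hiE -loE; apply: rJ; apply: h => /=; lia.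
move: ab; rewrite ltnS leq_eqVlt => /orP[/eqP ab|ab].
  by have -> : a = Ordinal bn' by apply: val_inj.
apply: r_trans rb; apply: IH => //.
by apply/blkP=> k /= hk; apply: h => /=; lia.
Qed.

Lemma blk_increasing J w : [disjoint DesR w & J] ->
  forall a b, (a < b)%N -> blk J a b -> (w a < w b)%N.
Proof.
move=> dJ; apply: (@blk_homo (fun a b => w a < w b)%N) => [b a c|k kJ].
  exact: ltn_trans.
by rewrite ltn_permN (disjointFl dJ kJ).
Qed.

Lemma blk_decreasing J w : J \subset DesR w ->
  forall a b, (a < b)%N -> blk J a b -> (w b < w a)%N.
Proof.
move=> /subsetP sJ; apply: (@blk_homo (fun a b => w b < w a)%N) => [b a c h1 h2|k kJ].
  exact: ltn_trans h2 h1.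
by rewrite -DesRE sJ.
Qed.

Lemma len_inv w : len (w^-1)%g = len w.
Proof.
rewrite !len_pinv; pose f (p : 'I_n * 'I_n) := ((w^-1)%g p.2, (w^-1)%g p.1).
have f_inj : injective f by move=> [a b] [c d] [/perm_inj -> /perm_inj ->].
rewrite -[RHS](card_imset _ f_inj); congr #|pred_of_set _|; apply/setP=> -[a b].
rewrite [LHS]inE /= invgK; apply/andP/imsetP => [[ab wba]|[[c d]]].
  by exists (w b, w a); rewrite ?inE /f /= !permK ?wba.
by rewrite inE /= => /andP[cd dc] [-> ->]; rewrite !permKV.
Qed.

(** An ascent of [longest A] at [k] in [J] would make its product with [adj k] a longer element of
    [A]. *)
Lemma longest_DesR (A : {set 'S_n}) J : (1%g \in A) ->
  (forall z k, z \in A -> k \in J -> pcomp z (adj k) \in A) ->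
  longest A \in A /\ J \subset DesR (longest A).
Proof.
move=> A1 Acl; rewrite /longest; case: arg_maxnP => // z zA zmax; split=> //.
apply/subsetP=> k kJ; apply/negPn/negP; rewrite -DesL_inv DesLN => /pinv_up.
have -> : pcomp (adj k) (z^-1)%g = ((pcomp z (adj k))^-1)%g by rewrite /pcomp invMg adjV.
rewrite -!len_pinv !len_inv => E.
by have := zmax _ (Acl _ _ zA kJ); rewrite /= E ltnn.
Qed.

Definition young J : {set 'S_n} := [set w : 'S_n | [forall a, blk J a (w a)]].

Lemma youngP J w : reflect (forall a, blk J a (w a)) (w \in young J).
Proof. by rewrite inE; exact: forallP. Qed.

Lemma young_group J : group_set (young J).
Proof.
apply/group_setP; split=> [|v w /youngP hv /youngP hw]; apply/youngP => a.
  by rewrite perm1 blk_refl.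
by rewrite permM; apply: blk_trans (hv a) (hw _).
Qed.

Lemma gen_adj_young J : <<[set adj i | i in J]>>%g \subset young J.
Proof.
rewrite -[young J]/(gval (Group (young_group J))) gen_subG.
by apply/subsetP=> w /imsetP[k kJ ->]; apply/youngP=> a; apply: blk_adj.
Qed.

(** Descents at all of [T] make [w0S T] decreasing on each block, and membership in the Young
    subgroup keeps the order between different blocks. *)
Lemma w0S_inversion T a b : (a < b)%N -> (w0S T b < w0S T a)%N = blk T a b.
Proof.
move=> ab; have [|k z zA kJ|zA sT] := @longest_DesR <<[set adj i | i in T]>>%g T.
- exact: group1.
- by rewrite /pcomp groupM // mem_gen // imset_f.
apply/idP/idP => [|bab]; last exact: blk_decreasing sT _ _ ab bab.
apply: contraTT => nab; move/(subsetP (gen_adj_young T))/youngP in zA.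
by rewrite -leqNgt ltnW //; apply: blk_ltn nab _ _.
Qed.

Lemma w0_inversion a b : (a < b)%N -> (w0 n b < w0 n a)%N.
Proof.
move=> ab; have [|k z|_ sT] := @longest_DesR [set: 'S_n] setT.
- by rewrite inE.
- by rewrite !inE.
by apply: blk_decreasing sT _ _ ab _; apply/blkP=> k _; rewrite inE.
Qed.

(** [w0] reverses every comparison, so the inversions are the pairs that [w0S (~: S)] leaves in
    order. *)
Lemma w1S_inversion S a b : (a < b)%N -> (w1S S b < w1S S a)%N = ~~ blk (~: S) a b.
Proof.
move=> ab; rewrite /w1S !pcompE -(w0S_inversion _ ab).
have : w0S (~: S) a != w0S (~: S) b :> nat.
  by rewrite (inj_eq val_inj) (inj_eq perm_inj) -val_eqE /=; lia.
have := @w0_inversion (w0S (~: S) a) (w0S (~: S) b).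
have := @w0_inversion (w0S (~: S) b) (w0S (~: S) a).
by case: (ltngtP (w0S (~: S) a) (w0S (~: S) b)) => [_ _ /(_ isT)|_ /(_ isT)|] //; lia.
Qed.

Lemma wle_w0S T w : wle (w0S T) w = (T \subset DesR w).
Proof.
apply/wleP/subsetP => [h k kT|sT a b ab].
  by rewrite DesRE; apply: h => //=; rewrite w0S_inversion ?blk_lo_hi //=.
by rewrite w0S_inversion //; apply: blk_decreasing => //; apply/subsetP.
Qed.

Lemma wle_w1S S w : wle w (w1S S) = (DesR w \subset S).
Proof.
apply/wleP/subsetP => [h k|sS a b ab].
  rewrite DesRE => /(h (ord_lo k) (ord_hi k) (ltnSn k)).
  by rewrite w1S_inversion //= blk_lo_hi inE negbK.
rewrite w1S_inversion //; apply: contraTN => bab.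
rewrite -leqNgt ltnW //; apply: blk_increasing bab => //.
by rewrite -subsets_disjoint; apply/subsetP.
Qed.

Lemma wint_descent T S w :
  (w \in wint (w0S T) (w1S S)) = (T \subset DesR w) && (DesR w \subset S).
Proof. by rewrite inE wle_w0S wle_w1S. Qed.

Lemma DesR_w0S T : DesR (w0S T) = T.
Proof. by apply/setP=> k; rewrite DesRE w0S_inversion //= blk_lo_hi. Qed.

Lemma DesR_w1S S : DesR (w1S S) = S.
Proof.
by apply/setP=> k; rewrite DesRE w1S_inversion //= blk_lo_hi inE negbK.
Qed.

End WeakOrder.

(** * Matsumoto's theorem: products over reduced words *)

Section Matsumoto.
Variables (n : nat) (A : pzRingType) (a : 'I_n.-1 -> A).
Local Open Scope ring_scope.
Hypothesis a_braid : forall i j : 'I_n.-1, j = i.+1 :> nat ->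
  a i * a j * a i = a j * a i * a j.
Hypothesis a_comm : forall i j : 'I_n.-1, (i.+2 <= j)%N -> a i * a j = a j * a i.
Implicit Types (w : 'S_n) (i j : 'I_n.-1).

Fixpoint word_prod_rec (m : nat) w : A :=
  if m is m'.+1 then
    if [pick i in DesL w] is Some i then a i * word_prod_rec m' (pcomp (adj i) w) else 1
  else 1.

(* Matsumoto's theorem: by [word_prod_down] the choice of the descents, that is, of
   the reduced word, is immaterial. *)
Definition word_prod w : A := locked_with tt (word_prod_rec (len w) w).

Lemma word_prodE w : word_prod w = word_prod_rec (len w) w.
Proof. by rewrite /word_prod unlock. Qed.

Lemma len_up i w : i \notin DesL w -> len (pcomp (adj i) w) = (len w).+1.
Proof. by rewrite DesLN !len_pinv => /pinv_up. Qed.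

Lemma len_down i w : i \in DesL w -> len w = (len (pcomp (adj i) w)).+1.
Proof. by rewrite DesLE !len_pinv => /pinv_down. Qed.

Lemma adj_commute i j : (i.+2 <= j)%N -> (adj i * adj j = adj j * adj i)%g.
Proof.
move=> ij; rewrite conjgC {2}/adj tpermJ /adj !tpermD // -val_eqE /=; lia.
Qed.

Lemma adj_braid i j : j = i.+1 :> nat ->
  (adj i * (adj j * adj i) = adj j * (adj i * adj j))%g.
Proof.
move=> ij; have hl : ord_hi i = ord_lo j by apply: val_inj; rewrite /= ij.
have J k k' : (adj k * (adj k' * adj k))%g = (adj k' ^ adj k)%g.
  by rewrite /conjg tpermV.
have aih : adj i (ord_hi j) = ord_hi j by rewrite /adj tpermD // -val_eqE /=; lia.
have ajl : adj j (ord_lo i) = ord_lo i by rewrite /adj tpermD // -val_eqE /=; lia.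
by rewrite !J ![(_ ^ _)%g]tpermJ aih ajl hl adj_lo -hl adj_hi.
Qed.

Lemma pcomp_commute i j w : (i.+2 <= j)%N ->
  pcomp (adj i) (pcomp (adj j) w) = pcomp (adj j) (pcomp (adj i) w).
Proof. by move=> ij; rewrite /Defs.pcomp -!mulgA (adj_commute ij). Qed.

Lemma pcomp_braid i j w : j = i.+1 :> nat ->
  pcomp (adj i) (pcomp (adj j) (pcomp (adj i) w)) =
  pcomp (adj j) (pcomp (adj i) (pcomp (adj j) w)).
Proof. by move=> ij; rewrite /Defs.pcomp -!mulgA (adj_braid ij). Qed.

Lemma word_prod1 : word_prod 1%g = 1.
Proof.
rewrite word_prodE; case: (len _) => //= m; case: pickP => // i.
by rewrite DesLE invg1 !perm1 /=; lia.
Qed.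

Lemma DesL_far i j w : (i.+2 <= j)%N || (j.+2 <= i)%N ->
  (j \in DesL (pcomp (adj i) w)) = (j \in DesL w).
Proof.
by move=> ij; rewrite DesL_pcomp DesLE /adj !tpermD // -val_eqE /=; lia.
Qed.

(** When [w] has two left descents [i] and [j], a reduced word of the longest element of the group
    generated by [adj i] and [adj j] can be peeled off [w], starting with either letter. The
    induction hypothesis covers the shorter elements met on both ways, and the commutation or braid
    relation of [a] identifies the two results. *)
Lemma word_prod_down i w : i \in DesL w ->
  word_prod w = a i * word_prod (pcomp (adj i) w).
Proof.
have [m] := ubnP (len w); elim: m w i => // m IH w i lew iw.
have [j jw E] : exists2 j, j \in DesL w & word_prod w = a j * word_prod (pcomp (adj j) w).
  rewrite {1}word_prodE (len_down iw) /=; case: pickP => [j jw|/(_ i)]; last by rewrite iw.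
  exists j => //; congr (_ * _); rewrite word_prodE; congr word_prod_rec.
  by have := len_down jw; rewrite (len_down iw) => -[].
rewrite {}E; have [->//|ne] := eqVneq i j.
have lt k (u v : 'S_n) : k \in DesL u -> (len u <= len v)%N -> (len v <= m)%N ->
  (len (pcomp (adj k) u) < m)%N.
  by move=> ku; rewrite (len_down ku); lia.
have IHi k l : k \in DesL w -> l \in DesL (pcomp (adj k) w) ->
  word_prod (pcomp (adj k) w) = a l * word_prod (pcomp (adj l) (pcomp (adj k) w)).
  by move=> kw; apply: IH; apply: (lt _ _ w).
wlog ij : i j iw jw ne / (i < j)%N.
  move=> W; case: (ltngtP i j) => [|ji|/val_inj E]; first exact: W.
    by symmetry; apply: W; rewrite // eq_sym.
  by rewrite E eqxx in ne.
have [far|near] := ltnP i.+1 j.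
  have ji : j \in DesL (pcomp (adj i) w) by rewrite DesL_far ?far.
  have ij' : i \in DesL (pcomp (adj j) w) by rewrite DesL_far ?far ?orbT.
  apply: etrans (congr1 (GRing.mul (a j)) (IHi j i jw ij')) _.
  apply: etrans _ (esym (congr1 (GRing.mul (a i)) (IHi i j iw ji))).
  by rewrite !mulrA (a_comm far) (pcomp_commute _ far).
have {near ij} ij : j = i.+1 :> nat by lia.
have hl : ord_hi i = ord_lo j by apply: val_inj; rewrite /= ij.
have ahj : adj i (ord_hi j) = ord_hi j by rewrite /adj tpermD // -val_eqE /=; lia.
have alj : adj j (ord_lo i) = ord_lo i by rewrite /adj tpermD // -val_eqE /=; lia.
have [iw' jw'] := (iw, jw); rewrite !DesLE -hl in iw' jw'.
have ji : j \in DesL (pcomp (adj i) w).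
  by rewrite DesL_pcomp -hl ahj adj_hi; apply: ltn_trans jw' iw'.
have ij' : i \in DesL (pcomp (adj j) w).
  by rewrite DesL_pcomp alj hl adj_lo; apply: ltn_trans jw' iw'.
apply: etrans (congr1 (GRing.mul (a j)) (IHi j i jw ij')) _.
apply: etrans _ (esym (congr1 (GRing.mul (a i)) (IHi i j iw ji))).
have lji : (len (pcomp (adj j) (pcomp (adj i) w)) < m)%N.
  by apply: (lt _ _ w) => //; rewrite (len_down iw).
have lij : (len (pcomp (adj i) (pcomp (adj j) w)) < m)%N.
  by apply: (lt _ _ w) => //; rewrite (len_down jw).
rewrite (IH _ i lji); last first.
  by rewrite DesL_pcomp !pcompVE adjV alj (adj_lo i) hl (adj_lo j) ahj -hl.
rewrite (IH _ j lij); last first.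
  by rewrite DesL_pcomp !pcompVE adjV -hl ahj (adj_hi i) alj (adj_hi j) -hl.
by rewrite !mulrA (a_braid ij) (pcomp_braid _ ij).
Qed.

Lemma word_prod_up i w : i \notin DesL w -> a i * word_prod w = word_prod (pcomp (adj i) w).
Proof.
rewrite -DesL_adj => iw; apply: etrans (esym (word_prod_down iw)).
by rewrite pcomp_adjK.
Qed.

Lemma DesL_exists w : w != 1%g -> exists i, i \in DesL w.
Proof.
move=> w1; apply/existsP; apply: contraNT w1 => /existsPn h.
by apply/eqP/no_descent => i; rewrite -DesLN.
Qed.

(** The recursion only peels letters on the left. Removing a left descent [j] creates no right
    descent, so the right factor can be absorbed by the shorter element before [j] is put back. *)
Lemma word_prod_upr i w : i \notin DesR w ->
  word_prod w * a i = word_prod (pcomp w (adj i)).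
Proof.
have [m] := ubnP (len w); elim: m w => // m IH w lew iw.
have [->|/DesL_exists[j jw]] := eqVneq w 1%g.
  have E : pcomp 1%g (adj i) = pcomp (adj i) 1%g by rewrite /Defs.pcomp mulg1 mul1g.
  rewrite E -word_prod_up ?word_prod1 ?mul1r ?mulr1 // DesLN invg1 !perm1 /=; lia.
pose v := pcomp (adj j) w; have vw : w = pcomp (adj j) v by rewrite pcomp_adjK.
have jv : j \notin DesL v by rewrite DesL_adj jw.
have iv : i \notin DesR v by apply: contra iw; rewrite vw; apply/subsetP/DesR_up.
rewrite vw -(word_prod_up jv) -mulrA IH //; last by move: lew; rewrite (len_down jw).
rewrite -pcomp_adjC word_prod_up //.
(* Putting [j] back requires it to be an ascent of [pcomp v (adj i)], which follows by comparing
   lengths. *)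
have lenr u : i \notin DesR u -> len (pcomp u (adj i)) = (len u).+1.
  rewrite -DesL_inv => /len_up; rewrite len_inv => <-; rewrite -len_inv.
  by rewrite /Defs.pcomp invMg adjV.
rewrite inE pcomp_adjC -vw !lenr // (len_down jw) -/v; lia.
Qed.

End Matsumoto.

(** * Linear maps over the 0-Hecke algebra and coordinates in interval modules *)

Section HeckeModules.
Variables (F : fieldType) (n : nat).
Local Open Scope ring_scope.
Local Notation H := (hecke0 F n).
Local Notation sc := (h_scal n).

Lemma h_scal0 : sc (0 : F) = 0.
Proof. by []. Qed.

(** The quadratic relation cancels the square against one linear term; apart from the braid word,
    what is left is symmetric in the two generators. *)
Lemma hgen_braid_plus (i j : 'I_n.-1) : j = i.+1 :> nat ->
  (hgen F i + 1) * (hgen F j + 1) * (hgen F i + 1) =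
  (hgen F j + 1) * (hgen F i + 1) * (hgen F j + 1).
Proof.
move=> ij.
have expand (x y : H) : x * x = - x ->
    (x + 1) * (y + 1) * (x + 1) = x * y * x + (x * y + (y * x + (y + (x + 1)))).
  move=> xx; have q : (y + 1) * (x + 1) = y * x + (y + (x + 1)).
    by rewrite mulrDl mulrDr mulr1 mul1r -addrA.
  rewrite -mulrA q mulrDl mul1r !mulrDr xx mulr1 addNr addr0 mulrA.
  by rewrite -addrA.
rewrite !expand ?hgen_quad // (hgen_braid F ij); congr (_ + _).
by rewrite addrCA; congr (_ + (_ + _)); rewrite addrCA.
Qed.

(** Every element of the algebra is the class of a term, so compatibility with scalars and
    generators propagates by induction on terms. *)
Lemma hecke_linear (M N : lmodType H) (h : M -> N) :
  {morph h : x y / x + y} ->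
  (forall c x, h (sc c *: x) = sc c *: h x) ->
  (forall i x, h (hgen F i *: x) = hgen F i *: h x) ->
  exists g : {linear M -> N}, g =1 h.
Proof.
move=> hD hS hG.
have lin : linear h.
  move=> a x y; rewrite hD; congr (_ + _); elim/hclsW: a => t.
  elim: t x {y} => [c|i|s IHs t IHt|s IHs t IHt] x.
  - exact: hS.
  - exact: hG.
  - by rewrite hclsD !scalerDl hD IHs IHt.
  - by rewrite hclsM -!scalerA IHs IHt.
pose hL := GRing.isLinear.Build H M N *:%R h lin.
pose g : {linear M -> N} := HB.pack h hL.
by exists g.
Qed.

Section Interval.
Variables s t : 'S_n.
Local Notation B := (Bbar F s t).
Local Notation I := (wint s t).

Definition bvec (u : 'S_n) : B := wb_vec F s t u.

(** Extended by zero outside of the interval, so that coefficients can be compared at arbitrary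
    permutations. *)
Definition bcoef (x : B) (u : 'S_n) : F :=
  if insub u is Some v then (x : wb_space F s t) v else 0.

Lemma bcoefE x (u : wint_elt s t) : bcoef x (val u) = (x : wb_space F s t) u.
Proof. by rewrite /bcoef valK. Qed.

Lemma bcoef_out x u : u \notin I -> bcoef x u = 0.
Proof. by move=> uI; rewrite /bcoef insubN. Qed.

Lemma bvec_out u : u \notin I -> bvec u = 0.
Proof. exact: wb_vec_out. Qed.

Lemma bcoef_ext (x y : B) : bcoef x =1 bcoef y -> x = y.
Proof. by move=> xy; apply/ffunP=> u; rewrite -!bcoefE. Qed.

Lemma bcoefD (x y : B) u : bcoef (x + y) u = bcoef x u + bcoef y u.
Proof. by rewrite /bcoef; case: insub => [v|]; rewrite ?addr0 // ffunE. Qed.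

Lemma Bbar_scal c (x : B) : sc c *: x = (c *: (x : wb_space F s t) : wb_space F s t).
Proof. exact: opmod_scaleE. Qed.

Lemma bcoefZ c (x : B) u : bcoef (sc c *: x) u = c * bcoef x u.
Proof.
by rewrite Bbar_scal /bcoef; case: insub => [v|]; rewrite ?mulr0 // ffunE.
Qed.

Lemma bcoef0 u : bcoef 0 u = 0.
Proof. by apply: (addrI (bcoef 0 u)); rewrite -bcoefD !addr0. Qed.

Lemma bcoef_sum (J : Type) (r : seq J) (P : pred J) (f : J -> B) u :
  bcoef (\sum_(j <- r | P j) f j) u = \sum_(j <- r | P j) bcoef (f j) u.
Proof.
by apply: (big_morph (fun x => bcoef x u)) => [x y|]; rewrite ?bcoefD ?bcoef0.
Qed.

Lemma bcoef_vec u v : bcoef (bvec u) v = ((v \in I) && (u == v))%:R.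
Proof.
have [vI|vI] := boolP (v \in I); last by rewrite bcoef_out.
pose v' : wint_elt s t := Sub v vI; have vE : v = val v' by rewrite SubK.
rewrite vE bcoefE /bvec /wb_vec andTb; case: insubP => [w _ <-|uI] /=.
  by rewrite ffunE -(inj_eq val_inj) eq_sym.
by rewrite ffunE; case: eqP => // uv; rewrite uv vI in uI.
Qed.

Lemma bexpand (x : B) : x = \sum_(u in I) sc (bcoef x u) *: bvec u.
Proof.
apply: bcoef_ext => v; rewrite bcoef_sum.
have [vI|vI] := boolP (v \in I); last first.
  by rewrite bcoef_out // big1 // => u _; rewrite bcoef_out.
rewrite (bigD1 v) //= big1 ?addr0 => [|u /andP[_ uv]].
  by rewrite bcoefZ bcoef_vec vI eqxx mulr1.
by rewrite bcoefZ bcoef_vec (negPf uv) andbF mulr0.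
Qed.

Lemma hgen_bvec i u : u \in I ->
  hgen F i *: bvec u = if i \in DesL u then - bvec u else bvec (pcomp (adj i) u).
Proof. by rewrite inE => /andP[su _]; rewrite hgen_opmod wb_op_vec. Qed.

Lemma Bbar_map (M : lmodType H) (phi : 'S_n -> M) :
  (forall u i, u \in I -> hgen F i *: phi u =
     if i \in DesL u then - phi u
     else if pcomp (adj i) u \in I then phi (pcomp (adj i) u) else 0) ->
  exists g : {linear B -> M}, forall u, u \in I -> g (bvec u) = phi u.
Proof.
move=> phiP.
pose h (x : B) := \sum_(u in I) sc (bcoef x u) *: phi u.
have hD : {morph h : x y / x + y}.
  by move=> x y; rewrite -big_split; apply: eq_bigr => u _; rewrite bcoefD h_scalD scalerDl.
have hS c x : h (sc c *: x) = sc c *: h x.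
  by rewrite scaler_sumr; apply: eq_bigr => u _; rewrite bcoefZ h_scalM scalerA.
have h0 : h 0 = 0 by apply: (addrI (h 0)); rewrite -hD !addr0.
have hN x : h (- x) = - h x by apply: (addrI (h x)); rewrite -hD !subrr.
have hvec u : u \in I -> h (bvec u) = phi u.
  move=> uI; rewrite /h (bigD1 u) //= big1 ?addr0 => [|v /andP[vI vu]].
    by rewrite bcoef_vec uI eqxx scale1r.
  by rewrite bcoef_vec eq_sym (negPf vu) andbF; exact: scale0r.
have hG i x : h (hgen F i *: x) = hgen F i *: h x.
  rewrite {1}(bexpand x) scaler_sumr (big_morph h hD h0) scaler_sumr.
  apply: eq_bigr => u uI.
  rewrite scalerA -h_scalC -scalerA hS scalerA -h_scalC -scalerA; congr (_ *: _).
  rewrite hgen_bvec // phiP //; case: ifP => _; first by rewrite hN hvec.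
  by case: ifPn => [/hvec//|out]; rewrite bvec_out.
have [g gh] := hecke_linear hD hS hG.
by exists g => u uI; rewrite gh hvec.
Qed.

End Interval.
End HeckeModules.

(** * The regular module, free on one generator and projective *)

Section Regular.
Variables (F : fieldType) (n : nat).
Local Open Scope ring_scope.
Local Notation H := (hecke0 F n).
Local Notation sc := (h_scal n).
Local Notation gen := (hgen F).
Implicit Types (w u v : 'S_n) (i : 'I_n.-1).

Definition hT w : H := word_prod (fun i => gen i) w.

(** The elements [gen i + 1] are idempotents annihilated by [gen i] and satisfy the same braid and
    commutation relations, so Matsumoto's theorem yields a second family of products. *)
Definition hP w : H := word_prod (fun i => gen i + 1) w.

Lemma hT1 : hT 1%g = 1.
Proof. exact: word_prod1. Qed.

Lemma hT_up i w : i \notin DesL w -> gen i * hT w = hT (pcomp (adj i) w).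
Proof. by apply: word_prod_up; [exact: hgen_braid | exact: hgen_comm]. Qed.

Lemma hT_upr i w : i \notin DesR w -> hT w * gen i = hT (pcomp w (adj i)).
Proof. by apply: word_prod_upr; [exact: hgen_braid | exact: hgen_comm]. Qed.

Lemma hT_down i w : i \in DesL w -> gen i * hT w = - hT w.
Proof.
move=> iw; have E : hT w = gen i * hT (pcomp (adj i) w).
  by apply: word_prod_down iw; [exact: hgen_braid | exact: hgen_comm].
by rewrite E mulrA hgen_quad mulNr.
Qed.

Lemma DesR_adj w i : (i \in DesR (pcomp w (adj i))) = (i \notin DesR w).
Proof. by rewrite -ltn_permN DesRE !pcompE adj_lo adj_hi. Qed.

Lemma pcompr_adjK w i : pcomp (pcomp w (adj i)) (adj i) = w.
Proof. by rewrite /Defs.pcomp mulgA /adj tperm2 mul1g. Qed.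

Lemma hT_downr i w : i \in DesR w -> hT w * gen i = - hT w.
Proof.
move=> iw; have iw' : i \notin DesR (pcomp w (adj i)) by rewrite DesR_adj iw.
have := hT_upr iw'; rewrite pcompr_adjK => <-.
by rewrite -mulrA hgen_quad mulrN.
Qed.

Lemma hP1 : hP 1%g = 1.
Proof. exact: word_prod1. Qed.

Lemma hP_comm (i j : 'I_n.-1) : (i.+2 <= j)%N ->
  (gen i + 1) * (gen j + 1) = (gen j + 1) * (gen i + 1).
Proof.
move=> ij; rewrite !(mulrDl, mulrDr, mulr1, mul1r) hgen_comm // -!addrA.
by congr (_ + _); rewrite addrCA.
Qed.

Lemma hP_up i w : i \notin DesL w -> gen i * hP w = hP (pcomp (adj i) w) - hP w.
Proof.
move=> iw; apply/(canRL (addrK _)); rewrite -[X in _ + X]mul1r -mulrDl.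
by apply: word_prod_up iw; [exact: hgen_braid_plus | exact: hP_comm].
Qed.

Lemma hP_down i w : i \in DesL w -> gen i * hP w = 0.
Proof.
move=> iw; have E : hP w = (gen i + 1) * hP (pcomp (adj i) w).
  by apply: word_prod_down iw; [exact: hgen_braid_plus | exact: hP_comm].
by rewrite E mulrA mulrDr mulr1 hgen_quad addNr mul0r.
Qed.

Definition regular : lmodType H := Bbar F 1%g (w0 n).
Definition rvec w : regular := bvec F 1%g (w0 n) w.

Lemma wint_regular w : w \in wint 1%g (w0 n).
Proof.
rewrite inE; apply/andP; split; apply/wleP=> a b ab.
  by rewrite !perm1; lia.
by move=> _; apply: w0_inversion.
Qed.

Lemma regular_map (M : lmodType H) (m : M) :
  exists g : {linear regular -> M}, forall w, g (rvec w) = hT w *: m.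
Proof.
have [|g gP] := @Bbar_map F n 1%g (w0 n) M (fun w => hT w *: m).
  move=> u i _; rewrite wint_regular scalerA; case: ifPn => iu.
    by rewrite hT_down // scaleNr.
  by rewrite hT_up.
by exists g => w; apply: gP; apply: wint_regular.
Qed.

Lemma hgen_rvec i w :
  gen i *: rvec w = if i \in DesL w then - rvec w else rvec (pcomp (adj i) w).
Proof. by rewrite hgen_bvec ?wint_regular. Qed.

Lemma rvecE w : rvec w = hT w *: rvec 1%g.
Proof.
have [m] := ubnP (len w); elim: m w => // m IH w lew.
have [->|/DesL_exists[i iw]] := eqVneq w 1%g; first by rewrite hT1 scale1r.
have iw' : i \notin DesL (pcomp (adj i) w) by rewrite DesL_adj iw.
have := hT_up iw'; rewrite pcomp_adjK => <-; rewrite -scalerA -IH.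
  by rewrite hgen_rvec (negPf iw') pcomp_adjK.
by move: lew; rewrite (len_down iw).
Qed.

Lemma rexpand (x : regular) : x = \sum_w sc (bcoef x w) *: rvec w.
Proof.
rewrite {1}(bexpand x); apply: eq_bigl => w; exact: wint_regular.
Qed.

(** The action on [rvec 1%g] yields the coefficients: the linear map from [regular] to the algebra
    that sends [rvec 1%g] to 1 sends [a *: rvec 1%g] back to [a]. *)
Lemma hecke_span (a : H) : a = \sum_w sc (bcoef (a *: rvec 1%g : regular) w) * hT w.
Proof.
have [g gP] := regular_map (1 : H^o).
have g1 : g (rvec 1%g) = 1 by rewrite gP hT1 scale1r.
have E : g (a *: rvec 1%g) = a by rewrite linearZ /= g1; exact: mulr1.
rewrite -[LHS]E {1}(rexpand (a *: rvec 1%g)) linear_sum.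
apply: eq_bigr => w _; rewrite linearZ gP.
by have -> : hT w *: (1 : H^o) = hT w by exact: mulr1.
Qed.

Lemma fin_gen_cyclic (M : lmodType H) (m : M) :
  (forall x, exists a : H, x = a *: m) -> fin_gen M.
Proof.
move=> h; exists [:: m] => x; have [a ->] := h x.
by exists (fun=> a); rewrite big_ord_recl big_ord0 addr0.
Qed.

Lemma fin_gen_regular : fin_gen regular.
Proof.
apply: (@fin_gen_cyclic _ (rvec 1%g)) => x.
exists (\sum_w sc (bcoef x w) * hT w); rewrite {1}(rexpand x) scaler_suml.
by apply: eq_bigr => w _; rewrite -scalerA -rvecE.
Qed.

Lemma regular_eq (M : lmodType H) (f g : {linear regular -> M}) :
  f (rvec 1%g) = g (rvec 1%g) -> f =1 g.
Proof.
move=> fg x; rewrite (rexpand x) !linear_sum; apply: eq_bigr => w _.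
by rewrite !linearZ rvecE !linearZ fg.
Qed.

Lemma projective_regular : projective regular.
Proof.
split=> [|M N f g _ _ fs]; first exact: fin_gen_regular.
have [m fm] := fs (g (rvec 1%g)); have [h hP] := regular_map m.
exists h => x; apply: (@regular_eq N (f \o h) g).
by rewrite /= hP hT1 scale1r.
Qed.

End Regular.

Section Retract.
Variable A : pzRingType.
Variables (P Q : lmodType A) (r : {linear Q -> P}) (i : {linear P -> Q}).
Hypothesis iK : cancel i r.

Lemma fin_gen_retract : fin_gen Q -> fin_gen P.
Proof.
move=> [s hs]; exists (map r s) => v; have [c cv] := hs (i v).
rewrite size_map; exists c; rewrite -[LHS]iK cv linear_sum; apply: eq_bigr => k _.
by rewrite linearZ (nth_map 0%R).
Qed.

Lemma projective_retract : projective Q -> projective P.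
Proof.
move=> [fgQ pQ]; split=> [|M N f g fgM fgN fs]; first exact: fin_gen_retract.
have [h hE] := pQ M N f (g \o r)%R fgM fgN fs.
by exists (h \o i)%R => x; rewrite /= hE /= iK.
Qed.

Lemma injective_retract : injective_module Q -> injective_module P.
Proof.
move=> [fgQ pQ]; split=> [|M N f g fgM fgN fi]; first exact: fin_gen_retract.
have [h hE] := pQ M N f (i \o g)%R fgM fgN fi.
by exists (r \o h)%R => x; rewrite /= hE /= iK.
Qed.

End Retract.

Lemma wle_eq_or_len n (s t : 'S_n) : wle s t -> s = t \/ (len s < len t)%N.
Proof.
case/connectP=> p + ->; elim: p s => [|x p IH] s /=; first by left.
case/andP=> /existsP[i /andP[si /eqP ->]] /IH; rewrite len_up // => h; right.
by case: h => [<-|h]; [rewrite len_up | exact: ltnW h].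
Qed.

(** * Sums over cosets of parabolic subgroups *)

Section CosetSums.
Variables (F : fieldType) (n : nat).
Local Open Scope ring_scope.
Local Notation H := (hecke0 F n).
Local Notation sc := (h_scal n).
Local Notation gen := (hgen F).
Local Notation rvec := (rvec F).
Implicit Types (w u v z : 'S_n) (i : 'I_n.-1) (J : {set 'I_n.-1}).

(* [w] lies in the coset [z W_J] of the parabolic subgroup [W_J]. *)
Definition same_coset J z w : bool := [forall x, blk J ((w^-1)%g x) ((z^-1)%g x)].

Lemma same_cosetP J z w :
  reflect (forall x, blk J ((w^-1)%g x) ((z^-1)%g x)) (same_coset J z w).
Proof. exact: forallP. Qed.

Lemma same_coset_refl J z : same_coset J z z.
Proof. by apply/same_cosetP=> x; exact: blk_refl. Qed.

Definition coset_sum J z : regular F n := \sum_(w | same_coset J z w) rvec w.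

Lemma bcoef_coset_sum J z w : bcoef (coset_sum J z) w = (same_coset J z w)%:R.
Proof.
rewrite bcoef_sum; case: (boolP (same_coset J z w)) => zw.
  rewrite (bigD1 w) //= big1 ?addr0 => [|u /andP[_ uw]].
    by rewrite bcoef_vec wint_regular eqxx.
  by rewrite bcoef_vec (negPf uw) andbF.
rewrite big1 // => u zu; rewrite bcoef_vec.
by case: eqP zu => [->|_ _]; rewrite ?(negPf zw) ?andbF.
Qed.

Lemma same_coset_mul J z w i :
  same_coset J (pcomp (adj i) z) (pcomp (adj i) w) = same_coset J z w.
Proof.
apply/same_cosetP/same_cosetP => h x; last by rewrite !pcompVE.
by have := h (adj i x); rewrite !pcompVE adjV adjK.
Qed.

Lemma pcomp_adj_inj i : injective (pcomp (adj i)).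
Proof. by apply: (can_inj (g := pcomp (adj i))) => w; rewrite pcomp_adjK. Qed.

(** The disjointness makes [z] increasing on blocks, hence the shortest element of its coset. Let
    [x] and [y] be the positions in [z] of the values that [adj i] exchanges. In different blocks
    their order is the same throughout the coset: either all elements have the descent [i], or
    [adj i] carries the coset onto that of [pcomp (adj i) z]. In one block, [adj i] preserves the
    coset and the terms cancel in pairs. *)
Lemma hgen_coset_sum J z i : [disjoint DesR z & J] ->
  gen i *: coset_sum J z = if i \in DesL z then - coset_sum J z
    else if [disjoint DesR (pcomp (adj i) z) & J] then coset_sum J (pcomp (adj i) z)
    else 0.
Proof.
move=> zJ; have incr := blk_increasing zJ.
set x := (z^-1)%g (ord_lo i); set y := (z^-1)%g (ord_hi i).
have zx : z x = ord_lo i by rewrite permKV.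
have zy : z y = ord_hi i by rewrite permKV.
rewrite scaler_sumr; case: ifPn => iz.
  rewrite -sumrN; apply: eq_bigr => w /same_cosetP zw; rewrite hgen_rvec ifT //.
  have yx : (y < x)%N by rewrite DesLE in iz.
  have nb : ~~ blk J y x by apply/negP => /(incr _ _ yx); rewrite zx zy /=; lia.
  by rewrite DesLE; apply: blk_ltn yx nb _ _; rewrite blk_sym; exact: zw.
have xy : (x < y)%N by rewrite DesLN in iz.
case: (boolP (blk J x y)) => bxy.
  rewrite ifF; last first.
    apply/negP => /blk_increasing/(_ x y xy bxy).
    by rewrite !pcompE zx zy adj_lo adj_hi /=; lia.
  have stab w : same_coset J z (pcomp (adj i) w) = same_coset J z w.
    have half u : same_coset J z u -> same_coset J z (pcomp (adj i) u).
      move=> /same_cosetP h; apply/same_cosetP=> a; rewrite pcompVE adjV.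
      apply: blk_trans (h _) _; rewrite /adj; case: tpermP => [->|->|_ _].
      - by rewrite blk_sym.
      - by [].
      - exact: blk_refl.
    by apply/idP/idP => /half; rewrite ?pcomp_adjK.
  rewrite (bigID (fun w => i \in DesL w)) /= [X in X + _](_ : _ = - \sum_(w | same_coset J z w && (i \notin DesL w)) rvec (pcomp (adj i) w)).
    apply/eqP; rewrite addrC subr_eq0; apply/eqP/eq_bigr => w /andP[_ iw].
    by rewrite hgen_rvec (negPf iw).
  rewrite (reindex_inj (@pcomp_adj_inj i)) -sumrN /=; apply: eq_big => w.
    by rewrite stab DesL_adj.
  by rewrite DesL_adj => /andP[_ iw]; rewrite hgen_rvec DesL_adj iw.
rewrite ifT; last first.
  apply/pred0P => k /=; apply/negbTE/negP => /andP[+ kJ]; apply/negP.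
  rewrite -ltn_permN !pcompE; apply: tperm_ltn.
    by apply: incr; rewrite ?blk_lo_hi //=.
  apply: contra bxy => /eqP[zl zh]; rewrite /x /y -zl -zh !permK.
  by rewrite blk_lo_hi.
rewrite /coset_sum [RHS](reindex_inj (@pcomp_adj_inj i)) /=.
apply: eq_big => w; first by rewrite same_coset_mul.
move=> /same_cosetP zw; rewrite hgen_rvec ifF // DesLE; apply/negbTE.
rewrite -leqNgt ltnW //; apply: blk_ltn xy bxy _ _; rewrite blk_sym; exact: zw.
Qed.

(** All inversions of [z] are between different blocks, so every [w] in the coset has them too; this
    compares the inverses in the weak order. *)
Lemma same_coset_len J z w : [disjoint DesR z & J] -> same_coset J z w ->
  w = z \/ (len z < len w)%N.
Proof.
move=> zJ /same_cosetP zw; have incr := blk_increasing zJ.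
have /wle_eq_or_len : wle (z^-1)%g (w^-1)%g.
  apply/wleP=> a b ab zba.
  have nb : ~~ blk J ((z^-1)%g b) ((z^-1)%g a).
    by apply/negP => /(incr _ _ zba); rewrite !permKV; lia.
  by apply: (blk_ltn zba nb); rewrite blk_sym; exact: zw.
by rewrite !len_inv => -[/invg_inj ->|]; [left | right].
Qed.

(** The matrix of the family is an endomorphism of a finite-dimensional space; being injective it is
    invertible, and its inverse supplies the coordinates [c]. *)
Lemma unitriangular_basis (b : 'S_n -> regular F n) :
  (forall z, bcoef (b z) z = 1) ->
  (forall z w, bcoef (b z) w != 0 -> w = z \/ (len z < len w)%N) ->
  exists c : regular F n -> 'S_n -> F,
    [/\ forall x y z, c (x + y) z = c x z + c y z,
        forall k x z, c (sc k *: x) z = k * c x z,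
        forall x, x = \sum_z sc (c x z) *: b z &
        forall z z', c (b z) z' = (z == z')%:R].
Proof.
move=> b1 btri; pose V := {ffun 'S_n -> F^o}.
pose th0 (f : V) : V := [ffun w => \sum_z f z * bcoef (b z) w].
have th_lin : linear th0.
  move=> k f g; apply/ffunP => w; rewrite !ffunE scaler_sumr -big_split.
  by apply: eq_bigr => z _; rewrite !ffunE mulrDl -scalerAl.
pose th0L := GRing.isLinear.Build F V V *:%R th0 th_lin.
pose th1 : {linear V -> V} := HB.pack th0 th0L.
pose th := linfun th1.
have thE f w : th f w = \sum_z f z * bcoef (b z) w by rewrite lfunE /= ffunE.
have ker0 : lker th == 0%VS.
  apply/lker0P; apply: raddf_inj => f thf.
  apply/ffunP=> w; rewrite ffunE; apply/eqP; apply: contraT => fw.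
  (* At a shortest [z] in the support of [f], no other member of the family contributes, so the
     coefficient there is [f z]. *)
  have [z fz zmin] := @arg_minnP _ w (fun z => f z != 0) (@len n) fw.
  have : th f z = 0 by rewrite thf ffunE.
  rewrite thE (bigD1 z) //= b1 mulr1 big1 => [|v vz]; first by rewrite addr0; move/eqP: fz.
  have [->|fv] := eqVneq (f v) 0; first by rewrite mul0r.
  have [->|/btri] := eqVneq (bcoef (b v) z) 0; first by rewrite mulr0.
  by case=> [zv|]; [rewrite zv eqxx in vz | rewrite ltnNge zmin].
pose co (x : regular F n) : V := [ffun w => bcoef x w].
pose c x := (th^-1)%VF (co x).
have cth x w : bcoef x w = \sum_z c x z * bcoef (b z) w.
  by rewrite -thE /c lker0_lfunVK // ffunE.
have coD x y : co (x + y) = co x + co y by apply/ffunP=> w; rewrite !ffunE bcoefD.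
have coZ k x : co (sc k *: x) = k *: co x by apply/ffunP=> w; rewrite !ffunE bcoefZ.
exists (fun x z => c x z); split.
- by move=> x y z; rewrite /c coD linearD ffunE.
- by move=> k x z; rewrite /c coZ linearZ ffunE.
- move=> x; apply: bcoef_ext => w; rewrite bcoef_sum cth.
  by apply: eq_bigr => z _; rewrite bcoefZ.
- move=> z z'; rewrite /c; have -> : co (b z) = th [ffun v => (z == v)%:R].
    apply/ffunP=> w; rewrite thE ffunE (bigD1 z) //= ffunE eqxx mul1r.
    by rewrite big1 ?addr0 // => v vz; rewrite ffunE eq_sym (negPf vz) mul0r.
  by rewrite lker0_lfunK // ffunE.
Qed.

End CosetSums.

(** * Interval modules as direct summands of the regular module *)

Section DescentIntervals.
Variables (F : fieldType) (n : nat) (T S : {set 'I_n.-1}).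
Local Open Scope ring_scope.
Local Notation H := (hecke0 F n).
Local Notation sc := (h_scal n).
Local Notation gen := (hgen F).
Local Notation I := (wint (w0S T) (w1S S)).
Local Notation P := (Bbar F (w0S T) (w1S S)).
Local Notation pvec := (bvec F (w0S T) (w1S S)).
Local Notation reg := (regular F n).

(* The coset sums [b z] of the [z] in the interval span a direct summand of the
   regular module isomorphic to [P]; a complement is spanned by the coset sums of the
   [z] outside of the interval, taken with respect to the complement of [DesR z]. *)
Lemma descent_interval_retract :
  exists (i : {linear P -> reg}) (r : {linear reg -> P}), cancel i r /\
    forall z, z \in I -> i (pvec z) = coset_sum F (~: S) z.
Proof.
pose D z := if z \in I then S else DesR z.
pose b z := coset_sum F (~: D z) z.
have zD z : [disjoint DesR z & ~: D z].
  rewrite -subsets_disjoint /D; case: ifP => //; rewrite wint_descent.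
  by case/andP.
(* Going up only enlarges [DesR]. From inside the interval, a nonzero result keeps its descents
   between [T] and [S]; from outside, it has the same descents as [z] and so remains outside. Hence
   both spans are submodules. *)
have actb i z : gen i *: b z = if i \in DesL z then - b z
    else if DesR (pcomp (adj i) z) \subset D z then b (pcomp (adj i) z) else 0.
  rewrite /b hgen_coset_sum // -subsets_disjoint; case: ifPn => // iz.
  case: ifPn => // sub; congr (coset_sum F (~: _) _); rewrite /D wint_descent.
  have up := DesR_up iz; move: sub; rewrite /D !wint_descent.
  case: ifPn => [/andP[h1 h2] sub|nI sub]; first by rewrite sub (subset_trans h1 up).
  have E : DesR (pcomp (adj i) z) = DesR z by apply/eqP; rewrite eqEsubset sub up.
  by rewrite E (negPf nI).
have [] := @unitriangular_basis F n b.
- by move=> z; rewrite bcoef_coset_sum same_coset_refl.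
- move=> z w; rewrite bcoef_coset_sum; case: (boolP (same_coset _ _ _)) => [zw _|];
  last by rewrite eqxx.
  exact: same_coset_len zw.
move=> c [cD cS cE cb].
pose r0 (x : reg) := \sum_(z in I) sc (c x z) *: pvec z.
have rD : {morph r0 : x y / x + y}.
  by move=> x y; rewrite -big_split; apply: eq_bigr => z _; rewrite cD h_scalD scalerDl.
have rS k x : r0 (sc k *: x) = sc k *: r0 x.
  by rewrite scaler_sumr; apply: eq_bigr => z _; rewrite cS h_scalM scalerA.
have r00 : r0 0 = 0 by apply: (addrI (r0 0)); rewrite -rD !addr0.
have rN x : r0 (- x) = - r0 x by apply: (addrI (r0 x)); rewrite -rD !subrr.
have rb z : r0 (b z) = pvec z.
  have [zI|zI] := boolP (z \in I).
    rewrite /r0 (bigD1 z) //= cb eqxx big1 ?addr0 => [|v /andP[_ vz]];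
      first by rewrite h_scal1 scale1r.
    by rewrite cb eq_sym (negPf vz) h_scal0 scale0r.
  rewrite bvec_out // /r0 big1 // => v vI; rewrite cb.
  by case: eqP vI => [<-|_ _]; [rewrite (negPf zI) | rewrite h_scal0 scale0r].
have rG i x : r0 (gen i *: x) = gen i *: r0 x.
  rewrite (cE x) scaler_sumr !(big_morph r0 rD r00) scaler_sumr.
  apply: eq_bigr => z _; rewrite scalerA -h_scalC -scalerA !rS scalerA -h_scalC -scalerA.
  congr (_ *: _); rewrite actb rb; have [zI|zI] := boolP (z \in I).
    rewrite hgen_bvec // (fun_if r0) rN rb; case: ifPn => // iz.
    rewrite (fun_if r0) rb r00; case: ifPn => // out; rewrite bvec_out // wint_descent.
    by apply: contra out => /andP[_]; rewrite /D zI.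
  rewrite bvec_out // scaler0 (fun_if r0) rN rb bvec_out // oppr0; case: ifPn => // iz.
  rewrite (fun_if r0) rb r00; case: ifPn => // sub; rewrite bvec_out // wint_descent.
  rewrite /D (negPf zI) in sub.
  have -> : DesR (pcomp (adj i) z) = DesR z by apply/eqP; rewrite eqEsubset sub DesR_up.
  by rewrite -wint_descent.
have [r rE] := hecke_linear rD rS rG.
have [|i iE] := @Bbar_map F n (w0S T) (w1S S) reg b.
  move=> z i zI; rewrite actb; case: ifPn => // iz.
  have -> // : (pcomp (adj i) z \in I) = (DesR (pcomp (adj i) z) \subset D z).
  rewrite /D zI wint_descent; move: zI; rewrite wint_descent => /andP[h _].
  by rewrite (subset_trans h (DesR_up iz)).
exists i, r; split=> [x|z zI]; last by rewrite iE // /b /D zI.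
rewrite (bexpand x) !linear_sum; apply: eq_bigr => z zI.
by rewrite !linearZ iE // rE rb.
Qed.

End DescentIntervals.

(** * Linear functionals, the Frobenius form and self-injectivity *)

Section Functionals.
Variables (F : fieldType) (n : nat).
Local Open Scope ring_scope.
Local Notation H := (hecke0 F n).
Local Notation sc := (h_scal n).
Local Notation gen := (hgen F).
Local Notation hT := (hT F).
Local Notation rvec := (rvec F).

Lemma h_scalN1 : sc (-1 : F) = -1.
Proof. by apply: (addrI 1); rewrite subrr -h_scal1 -h_scalD subrr. Qed.

Definition functional (M : lmodType H) (psi : M -> F) : Prop :=
  forall c x y, psi (sc c *: x + y) = c * psi x + psi y.

Section Functional.
Variables (M : lmodType H) (psi : M -> F).
Hypothesis psiL : functional psi.

Lemma functionalD x y : psi (x + y) = psi x + psi y.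
Proof. by have := psiL 1 x y; rewrite h_scal1 scale1r mul1r. Qed.

Lemma functional0 : psi 0 = 0.
Proof. by apply: (addrI (psi 0)); rewrite -functionalD !addr0. Qed.

Lemma functionalZ c x : psi (sc c *: x) = c * psi x.
Proof. by rewrite -[sc c *: x]addr0 psiL functional0 addr0. Qed.

Lemma functionalN x : psi (- x) = - psi x.
Proof. by rewrite -scaleN1r -h_scalN1 functionalZ mulN1r. Qed.

Lemma functional_sum (J : Type) (r : seq J) (Q : pred J) (f : J -> M) :
  psi (\sum_(j <- r | Q j) f j) = \sum_(j <- r | Q j) psi (f j).
Proof. exact: (big_morph psi functionalD functional0). Qed.

Lemma functionalM (a : H) : functional (fun x => psi (a *: x)).
Proof. by move=> c x y; rewrite scalerDr scalerA -h_scalC -scalerA psiL. Qed.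

End Functional.

Section Extension.
Variable N : lmodType H.
Implicit Types (G : N -> F -> Prop) (x y v : N).

(* Functionals defined on a subspace are represented by their graphs. *)
Definition partial_functional G : Prop :=
  [/\ G 0 0, (forall c x a y b, G x a -> G y b -> G (sc c *: x + y) (c * a + b)) &
      forall a, G 0 a -> a = 0].

Lemma partial_functional_uniq G x a b : partial_functional G -> G x a -> G x b -> a = b.
Proof.
move=> [_ Gl G0] xa xb; apply/eqP; rewrite eq_sym -subr_eq0; apply/eqP/G0.
by have := Gl (-1) _ _ _ _ xa xb; rewrite h_scalN1 scaleN1r addNr mulN1r addrC.
Qed.

(** The extension takes the value 1 at the new vector [v]. *)
Lemma partial_functional_extend1 G v : partial_functional G -> (forall a, ~ G v a) ->
  partial_functional (fun x a => exists k b, G (x - sc k *: v) b /\ a = b + k).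
Proof.
move=> [G0 Gl Gz] nv; split.
- by exists 0, 0; rewrite h_scal0 scale0r subr0 addr0.
- move=> c x a y b [k [a' [xa ->]]] [l [b' [yb ->]]].
  exists (c * k + l), (c * a' + b'); split; last by rewrite mulrDr addrACA.
  have -> : sc c *: x + y - sc (c * k + l) *: v =
            sc c *: (x - sc k *: v) + (y - sc l *: v).
    by rewrite h_scalD h_scalM scalerDl opprD addrACA scalerBr scalerA.
  exact: Gl.
- move=> a [k [b [Gb ->]]]; have [k0|k0] := eqVneq k 0.
    by move: Gb; rewrite k0 h_scal0 scale0r subr0 addr0 => /Gz.
  (* A nonzero multiple of [v] lies in the old domain, hence [v] does, against [nv]. *)
  case: (nv (- k^-1 * b + 0)); rewrite -[v]addr0.
  have -> : v = sc (- k^-1) *: (0 - sc k *: v).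
    rewrite sub0r scalerN scalerA -h_scalM mulNr mulVf //.
    by rewrite h_scalN1 scaleN1r opprK.
  exact: Gl.
Qed.

Lemma partial_functional_extend G (s : seq N) : partial_functional G ->
  exists2 G', partial_functional G' &
    (forall x a, G x a -> G' x a) /\ (forall v, v \in s -> exists a, G' v a).
Proof.
elim: s G => [|v s IH] G Gp; first by exists G.
have [G1 G1p [GG1 [a va]]] : exists2 G1, partial_functional G1 &
    (forall x a, G x a -> G1 x a) /\ exists a, G1 v a.
  have [[a va]|nv] := pselect (exists a, G v a).
    by exists G => //; split=> //; exists a.
  have nv' a : ~ G v a by move=> va; apply: nv; exists a.
  exists (fun x a => exists k b, G (x - sc k *: v) b /\ a = b + k).
    exact: partial_functional_extend1.
  split=> [x a xa|]; first by exists 0, a; rewrite h_scal0 scale0r subr0 addr0.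
  exists 1, 1, 0; rewrite h_scal1 scale1r subrr add0r; split=> //.
  by case: Gp.
have [G' G'p [G1G' sG']] := IH _ G1p.
exists G' => //; split=> [x b /GG1/G1G'//|u]; rewrite inE => /predU1P[->|/sG'//].
by exists a; apply: G1G'.
Qed.

(** The products [hT w *: v], with [v] in a finite generating list, span the module over the field,
    so finitely many one-step extensions suffice. *)
Lemma functional_extension G : fin_gen N -> partial_functional G ->
  exists2 psi : N -> F, functional psi & forall x a, G x a -> psi x = a.
Proof.
move=> [s sP] Gp.
have [G' G'p [GG' sG']] :=
  partial_functional_extend [seq hT w *: v | v <- s, w <- enum {: 'S_n}] Gp.
have [G0 Gl _] := G'p.
have dD x y : (exists a, G' x a) -> (exists a, G' y a) -> exists a, G' (x + y) a.
  move=> [a xa] [b yb]; exists (1 * a + b).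
  by have := Gl 1 _ _ _ _ xa yb; rewrite h_scal1 scale1r.
have dS (J : finType) (f : J -> N) :
    (forall j, exists a, G' (f j) a) -> exists a, G' (\sum_j f j) a.
  move=> h; elim/big_ind: _ => [|x y|j _]; [by exists 0 | exact: dD | exact: h].
have tot x : exists a, G' x a.
  have [c ->] := sP x; apply: (dS) => i; rewrite (hecke_span (c i)) scaler_suml.
  apply: (dS) => w; rewrite -scalerA.
  have [|a wa] := sG' (hT w *: s`_i).
    by apply: allpairs_f; rewrite ?mem_nth ?mem_enum.
  set k := bcoef _ _; exists (k * a + 0); rewrite -[sc k *: _]addr0; exact: Gl.
have [psi psiP] := choice tot; exists psi.
  by move=> c x y; apply: (partial_functional_uniq G'p (psiP _)); apply: Gl; exact: psiP.
by move=> x a /GG' xa; apply: (partial_functional_uniq G'p (psiP _)).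
Qed.

End Extension.

Lemma functional_extension_mono (M N : lmodType H) (f : {linear M -> N}) (psi : M -> F) :
  fin_gen N -> injective f -> functional psi ->
  exists2 psi' : N -> F, functional psi' & forall x, psi' (f x) = psi x.
Proof.
move=> fgN fi psiL.
have [|psi' psi'L psi'E] := @functional_extension N (fun y a =>
  exists2 x, y = f x & a = psi x) fgN.
  split.
  - by exists 0; rewrite ?linear0 ?(functional0 psiL).
  - move=> c _ _ _ _ [x -> ->] [y -> ->]; exists (sc c *: x + y); first by rewrite linearP.
    by rewrite psiL.
  - by move=> a [x]; rewrite -(linear0 f) => /fi <- ->; rewrite functional0.
by exists psi' => // x; apply: psi'E; exists x.
Qed.

Implicit Types (w u v : 'S_n) (i : 'I_n.-1).

(* [hT] and [D u = hP (u^-1 w0)] applied to the cyclic vector are dual bases for the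
   Frobenius form given by the coefficient of [w0]. *)
Definition dual_vec u : regular F n := hP F (pcomp (u^-1)%g (w0 n)) *: rvec 1%g.

Lemma hgen_dual_vec i u : gen i *: dual_vec u =
  if i \in DesR u then dual_vec (pcomp u (adj i)) - dual_vec u else 0.
Proof.
have E : i \in DesL (pcomp (u^-1)%g (w0 n)) = (i \notin DesR u).
  rewrite -DesL_inv !DesLE !pcompVE.
  set x := ((u^-1)^-1)%g (ord_lo i); set y := ((u^-1)^-1)%g (ord_hi i).
  have xy : x != y :> nat.
    by rewrite (inj_eq val_inj) (inj_eq perm_inj) lo_neq_hi.
  have anti (a b : 'I_n) : (a < b)%N -> (((w0 n)^-1)%g b < ((w0 n)^-1)%g a)%N.
    move=> ab; rewrite ltnNge leq_eqVlt negb_or (inj_eq val_inj) (inj_eq perm_inj).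
    apply/andP; split; first by rewrite neq_ltn ab.
    by apply/negP => /w0_inversion; rewrite !permKV; lia.
  move: (anti x y) (anti y x).
  by case: (ltngtP x y) xy => // _ _ h1 h2; [have := h1 isT | have := h2 isT]; lia.
rewrite /dual_vec scalerA; case: ifPn => iu; last by rewrite hP_down ?E // scale0r.
rewrite hP_up ?E ?iu // scalerBl; congr (_ *: _ - _).
by rewrite pcomp_adjC /Defs.pcomp invMg adjV.
Qed.

(** This is the Frobenius property: a functional determines a map into the regular module. Moving
    [gen i] onto [hT u] from the right and reindexing the ascents by [pcomp u (adj i)] produces the
    differences of [hgen_dual_vec]. *)
Lemma coinduced_map (M : lmodType H) (psi : M -> F) : functional psi ->
  exists g : {linear M -> regular F n},
    forall x, g x = \sum_u sc (psi (hT u *: x)) *: dual_vec u.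
Proof.
move=> psiL; pose h x := \sum_u sc (psi (hT u *: x)) *: dual_vec u.
have [|||g gh] := @hecke_linear F n M (regular F n) h; last by exists g.
- move=> x y; rewrite -big_split; apply: eq_bigr => u _.
  by rewrite scalerDr (functionalD psiL) h_scalD scalerDl.
- move=> c x; rewrite scaler_sumr; apply: eq_bigr => u _.
  by rewrite scalerA -h_scalC -scalerA (functionalZ psiL) h_scalM scalerA.
move=> i x; rewrite scaler_sumr /h.
rewrite (bigID (fun u => i \in DesR u)) [RHS](bigID (fun u => i \in DesR u)) /=.
rewrite [X in _ = _ + X]big1 => [|u iu]; last first.
  by rewrite scalerA -h_scalC -scalerA hgen_dual_vec (negPf iu) scaler0.
rewrite addr0 addrC (reindex_inj (h := fun u => pcomp u (adj i))) /=; last first.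
  exact: can_inj (fun u => pcompr_adjK u i).
under eq_bigl do rewrite DesR_adj negbK.
rewrite -big_split; apply: eq_bigr => u iu /=.
rewrite [RHS]scalerA -h_scalC -[RHS]scalerA hgen_dual_vec iu scalerBr.
rewrite [hT _ *: (gen i *: x)]scalerA hT_upr ?DesR_adj ?iu // pcompr_adjK; congr (_ + _).
by rewrite scalerA hT_downr // scaleNr (functionalN psiL) -mulN1r h_scalM h_scalN1 mulN1r scaleNr.
Qed.

(** The map coinduced by the coefficient of [w0] fixes the cyclic vector, because only the summand
    at [w0] survives there; hence it is the identity. *)
Lemma dual_vec_span (y : regular F n) :
  y = \sum_u sc (bcoef (hT u *: y) (w0 n)) *: dual_vec u.
Proof.
have [|g gE] := @coinduced_map (regular F n) (fun x => bcoef x (w0 n)).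
  by move=> c x z; rewrite bcoefD bcoefZ.
rewrite -gE; apply: (@regular_eq F n (regular F n) idfun g).
rewrite gE (bigD1 (w0 n)) //= big1 => [|u uw].
  rewrite -rvecE bcoef_vec wint_regular eqxx h_scal1 scale1r addr0 /dual_vec.
  by rewrite /Defs.pcomp mulgV hP1 scale1r.
by rewrite -rvecE bcoef_vec (negPf uw) andbF h_scal0 scale0r.
Qed.

(** The map [g] is determined by its coefficient of [w0]; that functional is extended along [f] and
    the extension is coinduced. *)
Lemma injective_regular : injective_module (regular F n).
Proof.
split=> [|M N f g _ fgN fi]; first exact: fin_gen_regular.
have psiL : functional (fun x => bcoef (g x) (w0 n)).
  by move=> c x y; rewrite linearP bcoefD bcoefZ.
have [psi' psi'L psi'E] := functional_extension_mono fgN fi psiL.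
have [h hE] := coinduced_map psi'L.
exists h => x; rewrite hE [RHS]dual_vec_span; apply: eq_bigr => u _.
by rewrite -!linearZ psi'E.
Qed.

End Functionals.

(** * Eigenvectors, simple socles and injective hulls *)

Section Socle.
Variables (F : fieldType) (n : nat).
Local Open Scope ring_scope.
Local Notation H := (hecke0 F n).
Local Notation sc := (h_scal n).
Local Notation gen := (hgen F).
Local Notation hT := (hT F).
Implicit Types (w u v : 'S_n) (i : 'I_n.-1) (K S T : {set 'I_n.-1}).

Definition eigenvector (M : lmodType H) K (y : M) : Prop :=
  forall i, gen i *: y = if i \in K then - y else 0.

Definition hecke_eigenvalue K i : F := - (i \in K)%:R.

(** The value at [hT w] of the one-dimensional representation in which [gen i] acts by -1 for [i] in
    [K] and by 0 otherwise. *)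
Definition chi K w : F := word_prod (hecke_eigenvalue K) w.

Lemma chi1 K : chi K 1%g = 1.
Proof. exact: word_prod1. Qed.

Lemma chi_up K i w : i \notin DesL w ->
  hecke_eigenvalue K i * chi K w = chi K (pcomp (adj i) w).
Proof.
apply: word_prod_up => a b _; rewrite /hecke_eigenvalue; last by rewrite mulrC.
by case: (a \in K); case: (b \in K); rewrite ?oppr0 ?(mulr0, mul0r).
Qed.

Lemma eigenvector_hT (M : lmodType H) K (y : M) w :
  eigenvector K y -> hT w *: y = sc (chi K w) *: y.
Proof.
move=> yK; have [m] := ubnP (len w); elim: m w => // m IH w lew.
have [->|/DesL_exists[i iw]] := eqVneq w 1%g.
  by rewrite hT1 chi1 h_scal1.
have iw' : i \notin DesL (pcomp (adj i) w) by rewrite DesL_adj iw.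
have := hT_up F iw'; have := chi_up K iw'; rewrite pcomp_adjK => <- <-.
rewrite -scalerA IH; last by move: lew; rewrite (len_down iw).
rewrite scalerA -h_scalC -scalerA yK [hecke_eigenvalue K i * _]mulrC h_scalM -scalerA.
congr (_ *: _); rewrite /hecke_eigenvalue; case: (i \in K).
  by rewrite h_scalN1 scaleN1r.
by rewrite oppr0 h_scal0 scale0r.
Qed.

(** For a longest [w] with [hT w *: x] nonzero, a generator either negates this vector or leads to a
    longer element, where the product vanishes. *)
Lemma eigenvector_exists (M : lmodType H) (x : M) : x != 0 ->
  exists w, hT w *: x != 0 /\ exists K, eigenvector K (hT w *: x).
Proof.
move=> x0; have h1 : hT 1%g *: x != 0 by rewrite hT1 scale1r.
have [w wx wmax] := @arg_maxnP _ 1%g (fun w => hT w *: x != 0) (@len n) h1.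
exists w; split=> //; exists (DesL w) => i; rewrite scalerA; case: ifPn => iw.
  by rewrite hT_down // scaleNr.
rewrite hT_up //; apply/eqP; apply: contraT => /wmax.
by rewrite /= len_up // ltnn.
Qed.

Definition socle_vec K : regular F n := \sum_u sc (chi K u) *: dual_vec F u.

Lemma eigenvector_socle_vec K (y : regular F n) : eigenvector K y ->
  y = sc (bcoef y (w0 n)) *: socle_vec K.
Proof.
move=> yK; rewrite {1}(dual_vec_span y) scaler_sumr; apply: eq_bigr => u _.
by rewrite (eigenvector_hT u yK) bcoefZ mulrC h_scalM scalerA.
Qed.

Lemma wle_maximal s t i : i \notin DesL t -> pcomp (adj i) t \notin wint s t.
Proof.
move=> it; rewrite inE negb_and; apply/orP; right; apply/negP => /wle_eq_or_len.
rewrite len_up // => -[E|]; last lia.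
by have := len_up it; rewrite E; lia.
Qed.

Lemma w1S_wint S : w1S S \in wint (w0S S) (w1S S).
Proof. by rewrite wint_descent DesR_w1S !subxx. Qed.

Section Summand.
Variable S : {set 'I_n.-1}.
Local Notation P := (Bbar F (w0S S) (w1S S)).
Local Notation top := (bvec F (w0S S) (w1S S) (w1S S)).

Lemma top_neq0 : top != 0.
Proof.
apply/eqP => /(congr1 (fun x => bcoef x (w1S S))).
rewrite bcoef_vec w1S_wint eqxx bcoef0; apply/eqP; exact: oner_neq0.
Qed.

Lemma top_eigenvector : eigenvector (DesL (w1S S)) top.
Proof.
move=> i; rewrite hgen_bvec ?w1S_wint //; case: ifPn => // iw.
by rewrite bvec_out // wle_maximal.
Qed.

End Summand.

Lemma eigenvector_map (M N : lmodType H) (f : {linear M -> N}) K y :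
  eigenvector K y -> eigenvector K (f y).
Proof. by move=> yK i; rewrite -linearZ yK; case: ifP; rewrite ?linearN ?linear0. Qed.

(* Eigenvectors of the regular module for the same character are proportional;
   compare the shortest elements of their supports. *)
Lemma eigenvector_descent S S' (y : Bbar F (w0S S) (w1S S)) :
  y != 0 -> eigenvector (DesL (w1S S')) y -> S = S'.
Proof.
move=> y0 yK; have [iS [rS [iSK iSE]]] := descent_interval_retract F S S.
have [iS' [rS' [iSK' iSE']]] := descent_interval_retract F S' S'.
have /eigenvector_socle_vec := eigenvector_map iS yK; set a := bcoef _ _ => Ea.
have /eigenvector_socle_vec := eigenvector_map iS' (@top_eigenvector S').
set b := bcoef _ _ => Eb.
have b0 : b != 0.
  apply: contraTneq (top_neq0 S') => b0; rewrite negbK.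
  by rewrite -[top in top == 0](iSK') Eb b0 h_scal0 scale0r linear0.
have a0 : a != 0.
  apply: contraNneq y0 => a0; by rewrite -[y]iSK Ea a0 h_scal0 scale0r linear0.
(* Both vectors are nonzero multiples of one [socle_vec], so they share their support, which is the
   coset of [w1S S']. *)
have supp w : (bcoef (iS y) w != 0) = same_coset (~: S') (w1S S') w.
  rewrite Ea bcoefZ mulf_eq0 (negPf a0) /=.
  rewrite -[LHS]/(true && (bcoef (socle_vec (DesL (w1S S'))) w != 0)) -b0 -negb_or -mulf_eq0.
  rewrite -bcoefZ -Eb iSE' ?w1S_wint // bcoef_coset_sum.
  by case: same_coset; rewrite ?eqxx ?oner_neq0.
have bcE w : bcoef (iS y) w = \sum_(z in wint (w0S S) (w1S S)) bcoef y z * (same_coset (~: S) z w)%:R.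
  rewrite {1}(bexpand y) linear_sum bcoef_sum; apply: eq_bigr => z zI.
  by rewrite linearZ bcoefZ iSE // bcoef_coset_sum.
have dis X w : DesR w = X -> [disjoint DesR w & ~: X].
  by move=> ->; rewrite -subsets_disjoint.
have DI z : z \in wint (w0S S) (w1S S) -> DesR z = S.
  by rewrite wint_descent => /andP[h1 h2]; apply/eqP; rewrite eqEsubset h1 h2.
have : bcoef (iS y) (w1S S') != 0 by rewrite supp same_coset_refl.
rewrite bcE => h; have [z zI hz] : exists2 z, z \in wint (w0S S) (w1S S) &
    bcoef y z * (same_coset (~: S) z (w1S S'))%:R != 0.
  apply/exists_inP; apply: contraNT h; rewrite negb_exists_in => /forall_inP h.
  by apply/eqP/big1 => z /h; rewrite negbK => /eqP.
move: hz; rewrite mulf_eq0 negb_or => /andP[yz].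
have [zw _|//] := boolP (same_coset _ _ _); last by rewrite eqxx.
(* Elements of the interval have descent set [S], so each is the shortest in its coset and different
   ones lie in different cosets: nothing cancels the term at [z]. *)
have : bcoef (iS y) z != 0.
  rewrite bcE (bigD1 z) //= same_coset_refl mulr1 big1 ?addr0 // => v /andP[vI vz].
  case: (boolP (same_coset _ _ _)) => [vz'|]; last by rewrite mulr0.
  have zv' : same_coset (~: S) z v by apply/same_cosetP=> x; rewrite blk_sym;
    apply/same_cosetP.
  have [E|lt] := same_coset_len (dis _ _ (DI _ vI)) vz'; first by rewrite E eqxx in vz.
  have [E|lt'] := same_coset_len (dis _ _ (DI _ zI)) zv';
    last by have := ltn_trans lt lt'; rewrite ltnn.
  by rewrite E eqxx in vz.
rewrite supp => wz.
have [zE|lt] := same_coset_len (dis _ _ (DI _ zI)) zw.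
  by rewrite -(DI _ zI) -zE DesR_w1S.
have [zE|lt'] := same_coset_len (dis _ _ (DesR_w1S S')) wz;
  last by have := ltn_trans lt lt'; rewrite ltnn.
by rewrite -(DI _ zI) zE DesR_w1S.
Qed.

(** On a finite set an injective map is bijective, so every character is that of the top element of
    some interval; [simple_socle] uses its inverse. *)
Lemma DesL_w1S_inj : injective (fun S => DesL (w1S S)).
Proof.
move=> S S' E; apply: (@eigenvector_descent S S' _ (top_neq0 S)).
by rewrite -E; exact: top_eigenvector.
Qed.

Section SimpleSocle.
Variable S : {set 'I_n.-1}.
Local Notation P := (Bbar F (w0S S) (w1S S)).
Local Notation top := (bvec F (w0S S) (w1S S) (w1S S)).

Lemma simple_socle (x : P) : x != 0 ->
  exists w c, c != 0 /\ hT w *: x = sc c *: top.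
Proof.
move=> /eigenvector_exists[w [y0 [K yK]]]; exists w.
move: (hT w *: x) y0 yK => y y0.
have [S' ->] : exists S', K = DesL (w1S S').
  by exists (invF DesL_w1S_inj K); rewrite (f_invF DesL_w1S_inj K).
move=> yK; have E := eigenvector_descent y0 yK.
move: yK; rewrite -E => yK.
have [i [r [iK _]]] := descent_interval_retract F S S.
have /eigenvector_socle_vec := eigenvector_map i yK; set a := bcoef _ _ => Ea.
have /eigenvector_socle_vec := eigenvector_map i (@top_eigenvector S).
set b := bcoef _ _ => Eb.
have b0 : b != 0.
  apply: contraTneq (top_neq0 S) => b0; rewrite negbK.
  by rewrite -[top in top == 0](iK) Eb b0 h_scal0 scale0r linear0.
have a0 : a != 0.
  by apply: contraNneq y0 => a0; rewrite -[y]iK Ea a0 h_scal0 scale0r linear0.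
exists (a / b); split; first by rewrite mulf_neq0 ?invr_eq0.
apply: (can_inj iK); rewrite linearZ Ea Eb /= scalerA -h_scalM.
by rewrite divfK.
Qed.

Lemma indecomposable_descent : indecomposable P.
Proof.
split=> [|B C Bsub Csub _ BC]; first by exists top; exact: top_neq0.
have topP (D : {pred P}) : GRing.submod_closed D ->
    ~ (forall x, x \in D -> x = 0) -> top \in D.
  move=> [D0 Dl] nD; have [x [xD /eqP x0]] : exists x, x \in D /\ x <> 0.
    by apply: contra_notP nD => nx x xD; apply: contra_notP nx => x0; exists x.
  have [w [c [c0 E]]] := simple_socle x0.
  have -> : top = (sc c^-1 * hT w) *: x + 0.
    by rewrite addr0 -scalerA E scalerA -h_scalM mulVf // h_scal1 scale1r.
  exact: Dl.
have [|nB] := pselect (forall x, x \in B -> x = 0); first by left.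
have [|nC] := pselect (forall x, x \in C -> x = 0); first by right.
by case/eqP: (top_neq0 S); apply: BC; apply: topP.
Qed.

Lemma injective_descent : injective_module P.
Proof.
have [i [r [iK _]]] := descent_interval_retract F S S.
exact: injective_retract iK (injective_regular F n).
Qed.

(** A nonzero kernel of [g] would contain [top], which lies in the image of [f]. *)
Lemma essential_mono_descent (M : lmodType H) (f : {linear M -> P}) m :
  injective f -> f m = top -> essential_mono f.
Proof.
move=> fi fm; split=> // X g _ gfi; apply: raddf_inj => x gx.
apply/eqP; apply: contraT => /simple_socle[w [c [c0 E]]].
have fE : f (sc c *: m) = sc c *: top by rewrite linearZ fm.
have : g (f (sc c *: m)) = g (f 0) by rewrite !linear0 fE -E linearZ /= gx scaler0.
move=> /gfi/(congr1 f); rewrite linear0 fE.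
move=> /(congr1 (fun x => sc c^-1 *: x)); rewrite scalerA -h_scalM mulVf //.
by rewrite h_scal1 scale1r scaler0 => /eqP; rewrite (negPf (top_neq0 S)).
Qed.

End SimpleSocle.

Lemma projective_descent T S : projective (Bbar F (w0S T) (w1S S)).
Proof.
have [i [r [iK _]]] := descent_interval_retract F T S.
exact: projective_retract iK (projective_regular F n).
Qed.

Lemma injective_hull_descent S u : DesR u = S ->
  injective_hull (Bbar F (w0S S) (w1S S)) (Bbar F u (w1S S)).
Proof.
move=> uS; split; first exact: injective_descent.
have su : wle (w0S S) u by rewrite wle_w0S uS.
have ut : wle u (w1S S) by rewrite wle_w1S uS.
have sub w : w \in wint u (w1S S) -> w \in wint (w0S S) (w1S S).
  by rewrite !inE => /andP[uw ->]; rewrite andbT; exact: connect_trans su uw.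
have [|f fE] := @Bbar_map F n u (w1S S) _ (bvec F (w0S S) (w1S S)).
  move=> w i wI; rewrite hgen_bvec ?sub //; case: ifPn => // iw.
  case: ifPn => // out; rewrite bvec_out //; move: out; apply: contra.
  rewrite !inE => /andP[_ ->]; rewrite andbT.
  by move: wI; rewrite inE => /andP[uw _]; exact: wle_pcomp.
exists f; apply: (@essential_mono_descent S _ f (bvec F u (w1S S) (w1S S))).
  have coefE x w : w \in wint u (w1S S) -> bcoef (f x) w = bcoef x w.
    move=> wI; rewrite {1}(bexpand x) linear_sum bcoef_sum (bigD1 w) //= big1 ?addr0.
      by rewrite linearZ bcoefZ fE // bcoef_vec sub // eqxx mulr1.
    move=> v /andP[vI vw]; rewrite linearZ bcoefZ fE // bcoef_vec (negPf vw) andbF.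
    by rewrite mulr0.
  move=> x y xy; apply: bcoef_ext => w; have [wI|wI] := boolP (w \in wint u (w1S S)).
    by rewrite -!coefE // xy.
  by rewrite !bcoef_out.
by rewrite fE // inE ut; exact: connect0.
Qed.

End Socle.

(** * Characters on interval modules and essential epimorphisms *)

Section TopCharacters.
Variables (F : fieldType) (n : nat).
Local Open Scope ring_scope.
Local Notation H := (hecke0 F n).
Local Notation sc := (h_scal n).
Local Notation gen := (hgen F).
Local Notation hT := (hT F).
Implicit Types (u v w z : 'S_n) (i : 'I_n.-1) (K S T : {set 'I_n.-1}).

Lemma young_w0S T : w0S T \in young T.
Proof.
have [||zA _] := @longest_DesR n <<[set adj i | i in T]>>%g T.
- exact: group1.
- by move=> z k zA kT; rewrite /Defs.pcomp groupM // mem_gen // imset_f.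
exact: (subsetP (gen_adj_young T)).
Qed.

Lemma youngS K T : K \subset T -> young K \subset young T.
Proof. by move=> KT; apply/subsetP=> w /youngP h; apply/youngP=> a; apply: blkS (h a). Qed.

Lemma young_adj K i w : i \in K -> (pcomp (adj i) w \in young K) = (w \in young K).
Proof.
move=> iK; have half v : v \in young K -> pcomp (adj i) v \in young K.
  move=> /youngP h; apply/youngP=> a; rewrite pcompE.
  exact: blk_trans (h a) (blk_adj _ iK).
by apply/idP/idP => /half; rewrite ?pcomp_adjK.
Qed.

Lemma young_ltn K w (a b : 'I_n) : w \in young K -> (a < b)%N -> ~~ blk K a b ->
  (w a < w b)%N.
Proof. by move=> /youngP h ab nb; apply: (blk_ltn ab nb). Qed.

Lemma young_inv K w : w \in young K -> (w^-1)%g \in young K.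
Proof. exact: (@groupVr _ (Group (young_group K))). Qed.

Lemma young_DesL K w : w \in young K -> DesL w \subset K.
Proof.
move=> /young_inv wK; apply/subsetP=> i; apply: contraTT => iK.
by rewrite DesLN; apply: young_ltn wK _ _; rewrite ?blk_lo_hi /=.
Qed.

Lemma DesL_w0S T : T \subset DesL (w0S T).
Proof.
apply/subsetP=> i iT; rewrite DesLE ltnNge leq_eqVlt negb_or.
rewrite (inj_eq val_inj) (inj_eq perm_inj) lo_neq_hi /=; apply/negP => lt.
have /youngP h := young_inv (young_w0S T).
have bT : blk T (((w0S T)^-1)%g (ord_lo i)) (((w0S T)^-1)%g (ord_hi i)).
  have loT : blk T (((w0S T)^-1)%g (ord_lo i)) (ord_lo i) by rewrite blk_sym h.
  have lohi : blk T (ord_lo i) (ord_hi i) by rewrite blk_lo_hi.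
  exact: blk_trans loT (blk_trans lohi (h _)).
by have := w0S_inversion T lt; rewrite bT !permKV /=; lia.
Qed.

Lemma wle_last s t : wle s t ->
  s = t \/ exists i, i \in DesL t /\ wle s (pcomp (adj i) t).
Proof.
case/connectP=> p; case/lastP: p => [|p x]; first by move=> _ ->; left.
rewrite rcons_path last_rcons => /andP[sp /existsP[i /andP[si /eqP xE]]] ->.
right; exists i; rewrite xE DesL_adj si pcomp_adjK; split=> //.
by apply/connectP; exists p.
Qed.

Lemma hgen_bvec_wle s t u i : wle s u ->
  gen i *: bvec F s t u = if i \in DesL u then - bvec F s t u else bvec F s t (pcomp (adj i) u).
Proof. by move=> su; rewrite hgen_opmod wb_op_vec. Qed.

Section Character.
Variables T S : {set 'I_n.-1}.
Local Notation P := (Bbar F (w0S T) (w1S S)).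
Local Notation pvec := (bvec F (w0S T) (w1S S)).
Local Notation I := (wint (w0S T) (w1S S)).

Variables (K : {set 'I_n.-1}) (ch : P -> F).
Hypothesis chL : functional ch.
Hypothesis chK : forall i x, ch (gen i *: x) = hecke_eigenvalue F K i * ch x.

Lemma hecke_eigenvalue_neq0 i : (hecke_eigenvalue F K i != 0) = (i \in K).
Proof.
rewrite /hecke_eigenvalue; case: (i \in K); last by rewrite oppr0 eqxx.
by rewrite oppr_eq0 oner_neq0.
Qed.

(** Each step up from [w0S T] multiplies [ch] by the eigenvalue of its letter, which is nonzero
    exactly for letters in [K]. *)
Lemma character_support w : T \subset K -> wle (w0S T) w ->
  (ch (pvec w) != 0) = (ch (pvec (w0S T)) != 0) && (w \in young K).
Proof.
move=> TK; have [m] := ubnP (len w); elim: m w => // m IH w lew.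
case/wle_last => [<-|[i [iw le]]].
  by rewrite (subsetP (youngS TK)) ?andbT // young_w0S.
have up : i \notin DesL (pcomp (adj i) w) by rewrite DesL_adj iw.
have := hgen_bvec_wle (w1S S) i le; rewrite (negPf up) pcomp_adjK => <-.
rewrite chK mulf_eq0 negb_or hecke_eigenvalue_neq0 (IH _ _ le); last first.
  by rewrite -ltnS -(len_down iw).
case: (boolP (i \in K)) => iK; first by rewrite young_adj.
have -> : (w \in young K) = false.
  by apply: contraNF iK => /young_DesL/subsetP/(_ _ iw).
by rewrite andbF.
Qed.

Lemma character_subset : ch (pvec (w0S T)) != 0 -> T \subset K.
Proof.
move=> c0; apply/subsetP=> i /(subsetP (DesL_w0S T)) iT.
have := chK i (pvec (w0S T)); rewrite hgen_bvec_wle ?iT; last exact: connect0.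
rewrite (functionalN chL) -hecke_eigenvalue_neq0 => E; apply: contraNneq c0 => e0.
by rewrite -oppr_eq0 E e0 mul0r.
Qed.

Lemma character_generator x : ch x != 0 -> ch (pvec (w0S T)) != 0.
Proof.
apply: contraNneq => c0; rewrite (bexpand x) (functional_sum chL) big1 // => w.
rewrite inE => /andP[le _]; rewrite (functionalZ chL).
suff -> : ch (pvec w) = 0 by rewrite mulr0.
have [m] := ubnP (len w); elim: m w le => // m IH w + lew.
case/wle_last => [<- //|[i [iw le]]].
have up : i \notin DesL (pcomp (adj i) w) by rewrite DesL_adj iw.
have := hgen_bvec_wle (w1S S) i le; rewrite (negPf up) pcomp_adjK => <-.
by rewrite chK (IH _ le) ?mulr0 // -ltnS -(len_down iw).
Qed.

(** For [i] in [K] but not in [S], the element [w0S (i |: T)] lies outside of the interval, so its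
    vector is 0; as it lies in the Young subgroup of [K], [character_support] would make the value
    of [ch] there nonzero. *)
Lemma character_subset_max : ch (pvec (w0S T)) != 0 -> K \subset S.
Proof.
move=> c0; have TK := character_subset c0; apply/subsetP=> i iK; apply/negPn/negP => iS.
have le : wle (w0S T) (w0S (i |: T)) by rewrite wle_w0S DesR_w0S subsetUr.
have out : w0S (i |: T) \notin I.
  rewrite wint_descent DesR_w0S negb_and; apply/orP; right.
  by apply/subsetPn; exists i; rewrite ?setU11.
have := character_support TK le; rewrite c0 bvec_out // (functional0 chL) eqxx.
move=> /esym/negbT/negP; apply; apply: (subsetP (youngS _)) (young_w0S _).
by apply/subsetP=> j; rewrite !inE => /predU1P[->|/(subsetP TK)].
Qed.

Lemma character_vanish x : (forall w, w \in I -> w \in young S -> bcoef x w = 0) ->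
  ch x = 0.
Proof.
move=> h; apply/eqP/negPn/negP => cx; move: (cx).
have c0 := character_generator cx.
have KS := youngS (character_subset_max c0).
rewrite (bexpand x) (functional_sum chL) big1 ?eqxx // => w wI.
rewrite (functionalZ chL); have [wK|wK] := boolP (w \in young K).
  by rewrite h ?mul0r // (subsetP KS).
have /andP[le _] : wle (w0S T) w && wle w (w1S S) by rewrite inE in wI.
have := character_support (character_subset c0) le.
by rewrite (negPf wK) andbF => /negbFE/eqP->; rewrite mulr0.
Qed.

End Character.

(* A proper submodule would be killed by a nonzero functional on which all generators
   act by scalars; such a functional vanishes on the basis elements outside of the
   Young subgroup, hence on the kernel of [f]. *)
Lemma essential_epi_descent T S (M : lmodType H)
    (f : {linear Bbar F (w0S T) (w1S S) -> M}) :
  surjective f ->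
  (forall x, f x = 0 -> forall w, w \in wint (w0S T) (w1S S) -> w \in young S ->
     bcoef x w = 0) ->
  essential_epi f.
Proof.
set P := Bbar F _ _ => fs fker; split=> // X g _ fgs y.
apply: contrapT => ny.
(* The functional that vanishes on the image of [g] and is 1 at [y]; it is well defined since [y] is
   not in that image. *)
have Gp : partial_functional (fun p a => exists x, p = g x + sc a *: y).
  split.
  - by exists 0; rewrite linear0 h_scal0 scale0r addr0.
  - move=> c _ a _ b [x1 ->] [x2 ->]; exists (sc c *: x1 + x2).
    by rewrite linearP scalerDr scalerA -h_scalM h_scalD scalerDl addrACA.
  - move=> a [x E]; apply/eqP/negPn/negP => a0; apply: ny; exists (- (sc a^-1 *: x)).
    have -> : g (- (sc a^-1 *: x)) = sc a^-1 *: - g x by rewrite linearN linearZ scalerN.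
    have -> : - g x = sc a *: y by apply: (addrI (g x)); rewrite subrr.
    by rewrite scalerA -h_scalM mulVf // h_scal1 scale1r.
have [psi psiL psiE] := functional_extension (projective_descent F T S).1 Gp.
have psig x : psi (g x) = 0 by apply: psiE; exists x; rewrite h_scal0 scale0r addr0.
have psiy : psi y = 1 by apply: psiE; exists 0; rewrite linear0 add0r h_scal1 scale1r.
have h1 : `[< exists x, psi (hT 1%g *: x) != 0 >].
  by apply/asboolP; exists y; rewrite hT1 scale1r psiy oner_neq0.
(* For a longest [w] such that [psi] does not vanish on all [hT w *: x], each generator acts by a
   scalar: on the right of [hT w] it changes the sign or produces a longer element, where [psi]
   vanishes. *)
have [w /asboolP[x wx] wmax] :=
  @arg_maxnP _ 1%g (fun w => `[< exists x, psi (hT w *: x) != 0 >]) (@len n) h1.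
have chK i p : psi (hT w *: (gen i *: p)) = hecke_eigenvalue F (DesR w) i * psi (hT w *: p).
  rewrite scalerA /hecke_eigenvalue; case: (boolP (i \in DesR w)) => iw.
    by rewrite hT_downr // scaleNr (functionalN psiL) mulN1r.
  rewrite hT_upr // oppr0 mul0r; apply/eqP; apply: contraT => h.
  have /= := wmax (pcomp w (adj i)) (asboolT (ex_intro _ p h)).
  rewrite -len_inv -(len_inv w);
    have -> : ((pcomp w (adj i))^-1)%g = pcomp (adj i) (w^-1)%g.
    by rewrite /Defs.pcomp invMg adjV.
  by rewrite len_up ?ltnn // DesL_inv.
have [z fz] := fgs (f x).
(* The difference is in the kernel of [f], and [psi] vanishes on the submodule of all [g z]; so the
   value at [x] would be 0. *)
suff : psi (hT w *: (x - g z)) = 0.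
  rewrite scalerBr (functionalD psiL) -linearZ (functionalN psiL) psig oppr0 addr0.
  by move=> E; rewrite E eqxx in wx.
apply: (character_vanish (functionalM psiL (hT w)) chK).
by apply: fker; rewrite linearB -fz subrr.
Qed.

(** The map sends [w] to [pcomp w kap], or to 0 if that is outside of the target. Equality of left
    descents and [hdown] make it linear, [hup] makes it surjective, and [hyoung] keeps the Young
    subgroup out of the supports of kernel elements. *)
Lemma essential_epi_translate T S' S u (kap : 'S_n) :
  (forall w, w \in wint (w0S T) (w1S S') -> pcomp w kap \in wint u (w1S S) ->
     DesL (pcomp w kap) = DesL w) ->
  (forall w i, w \in wint (w0S T) (w1S S') -> i \notin DesL w ->
     pcomp (adj i) w \in wint (w0S T) (w1S S') ->
     pcomp (pcomp (adj i) w) kap \in wint u (w1S S) -> pcomp w kap \in wint u (w1S S)) ->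
  (forall w, pcomp w kap \in wint u (w1S S) -> w \in wint (w0S T) (w1S S')) ->
  (forall w, w \in wint (w0S T) (w1S S') -> w \in young S' ->
     pcomp w kap \in wint u (w1S S)) ->
  exists f : {linear Bbar F (w0S T) (w1S S') -> Bbar F u (w1S S)}, essential_epi f.
Proof.
set I := wint (w0S T) _; set Q := wint u _ => hDes hdown hup hyoung.
set pvec := bvec F (w0S T) (w1S S'); set qvec := bvec F u (w1S S).
have [|f fE] := @Bbar_map F n (w0S T) (w1S S') _ (fun w => qvec (pcomp w kap)).
  move=> w i wI; have [wQ|wQ] := boolP (pcomp w kap \in Q).
    rewrite hgen_bvec // hDes //; case: ifPn => // iw; rewrite pcomp_adjC.
    by case: ifPn => // out; rewrite /qvec bvec_out //; apply: contra out => /hup.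
  rewrite /qvec (bvec_out _ wQ) scaler0 oppr0; case: ifPn => // iw.
  case: ifPn => // siw; rewrite bvec_out //; apply: contra wQ; exact: hdown.
have kapK z : pcomp (pcomp z (kap^-1)%g) kap = z.
  by rewrite /Defs.pcomp mulgA mulgV mul1g.
have kap_inj v w : pcomp v kap = pcomp w kap -> v = w by apply: mulgI.
exists f; apply: essential_epi_descent => [y|x fx w wI wS].
  exists (\sum_(z in Q) sc (bcoef y z) *: pvec (pcomp z (kap^-1)%g)).
  rewrite linear_sum [RHS]bexpand; apply: eq_bigr => z zQ.
  by rewrite linearZ fE ?kapK //; apply: hup; rewrite kapK.
have : bcoef (f x) (pcomp w kap) = 0 by rewrite fx bcoef0.
rewrite {1}(bexpand x) linear_sum bcoef_sum (bigD1 w) //= big1 ?addr0.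
  by rewrite linearZ bcoefZ fE // bcoef_vec hyoung // eqxx mulr1.
move=> v /andP[vI vw]; rewrite linearZ bcoefZ fE // bcoef_vec.
case: eqP => [/kap_inj E|_]; last by rewrite andbF mulr0.
by rewrite E eqxx in vw.
Qed.

End TopCharacters.

(** * Positions in sorted lists and permutations given by words *)

Section SortIndex.
Variables (T : eqType) (leT : rel T).
Hypotheses (leT_total : total leT) (leT_trans : transitive leT)
  (leT_anti : antisymmetric leT).
Variable s : seq T.
Hypothesis s_uniq : uniq s.

Lemma index_sort_lt b c : b \in s -> c \in s ->
  (index b (sort leT s) < index c (sort leT s)) = (b != c) && leT b c.
Proof.
move=> bs cs; have idx := @sorted_ltn_index _ _ leT_trans _ (sort_sorted leT_total s).
have [bs' cs'] : b \in sort leT s /\ c \in sort leT s by rewrite !mem_sort.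
have [->|bc] /= := eqVneq b c; first by rewrite ltnn.
apply/idP/idP => [|lbc]; first exact: idx.
rewrite ltnNge leq_eqVlt negb_or; apply/andP; split.
  by apply: contra bc => /eqP/index_inj -> //; rewrite eqxx.
apply/negP => /idx-/(_ cs' bs') lcb; case/eqP: bc; apply: leT_anti.
by rewrite lbc lcb.
Qed.

Lemma index_sort_count b : b \in s ->
  index b (sort leT s) = count (fun c => (c != b) && leT c b) s.
Proof.
move=> bs; set s' := sort leT s; set p := fun c => _.
have s'_uniq : uniq s' by rewrite sort_uniq.
have bs' : b \in s' by rewrite mem_sort.
have pE c : c \in s' -> p c = (index c s' < index b s').
  by rewrite mem_sort => cs; rewrite index_sort_lt.
have <- : count p s' = count p s by apply/seq.permP; rewrite perm_sort.
rewrite -[s' in RHS](cat_take_drop (index b s')) count_cat.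
have -> : count p (take (index b s') s') = index b s'.
  have -> : count p (take (index b s') s') = size (take (index b s') s').
    apply/eqP; rewrite -all_count; apply/allP => c ct.
    by rewrite pE ?(mem_take ct) // index_ltn.
  by rewrite size_take index_mem bs'.
apply/eqP; rewrite -{1}[index b s']addn0 eqn_add2l eq_sym eqn0Ngt -has_count.
apply/hasPn => c cd; rewrite pE ?(mem_drop cd) // -in_take ?(mem_drop cd) //.
move: s'_uniq; rewrite -{1}[s'](cat_take_drop (index b s')) cat_uniq.
by case/and3P=> _ /hasPn/(_ c cd).
Qed.

End SortIndex.

Lemma ord_LT_total : total ord_LT.
Proof. by move=> b c; rewrite /ord_LT; lia. Qed.
Lemma ord_LT_trans : transitive ord_LT.
Proof. by move=> b c d; rewrite /ord_LT; lia. Qed.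
Lemma ord_LT_anti : antisymmetric ord_LT.
Proof. by move=> [x i] [y j]; rewrite /ord_LT /= => ?; congr (_, _); lia. Qed.

Lemma ord_LB_total : total ord_LB.
Proof. by move=> b c; rewrite /ord_LB; lia. Qed.
Lemma ord_LB_trans : transitive ord_LB.
Proof. by move=> b c d; rewrite /ord_LB; lia. Qed.
Lemma ord_LB_anti : antisymmetric ord_LB.
Proof. by move=> [x i] [y j]; rewrite /ord_LB /= => ?; congr (_, _); lia. Qed.

Lemma ord_col_total : total ord_col.
Proof. by move=> b c; rewrite /ord_col; lia. Qed.
Lemma ord_col_trans : transitive ord_col.
Proof. by move=> b c d; rewrite /ord_col; lia. Qed.
Lemma ord_col_anti : antisymmetric ord_col.
Proof. by move=> [x i] [y j]; rewrite /ord_col /= => ?; congr (_, _); lia. Qed.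

(** The hypotheses make the word a permutation of 1, ..., n, so the default value of [perm_of_word]
    is never reached. *)
Lemma perm_of_wordE n (w : seq nat) (k : 'I_n) : uniq w -> size w = n ->
  (forall x, x \in w -> 0 < x <= n) -> (perm_of_word n w k).+1 = nth 0 w k.
Proof.
move=> w_uniq w_size w_range; rewrite /perm_of_word.
have wk (j : 'I_n) : 0 < nth 0 w j <= n by apply: w_range; rewrite mem_nth ?w_size.
have wk' (j : 'I_n) : (nth 0 w j).-1 < n by have := wk j; lia.
case: pickP => [s /forallP/(_ k)/eqP //|no].
pose f (j : 'I_n) := Ordinal (wk' j).
have f_inj : injective f.
  move=> i j /(congr1 val) /= E; apply: ord_inj; apply/eqP.
  rewrite -(nth_uniq 0 _ _ w_uniq) ?w_size //; apply/eqP.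
  have /andP[wi _] := wk i; have /andP[wj _] := wk j.
  by rewrite -(prednK wi) -(prednK wj) E.
have /negP[] := negbT (no (perm f_inj)); apply/forallP => j.
by rewrite permE /= prednK //; have /andP[] := wk j.
Qed.

Lemma tcdP (al : seq nat) (x j : nat) : ((x, j) \in tcd al) = (0 < j <= size al) && (0 < x <= part al j).
Proof.
apply/allpairsPdep/idP => [[i [y [+ + [-> ->]]]]|h]; first by rewrite !mem_iota; lia.
by exists j, x; rewrite !mem_iota; split=> //; lia.
Qed.

Lemma tcd_uniq (al : seq nat) : uniq (tcd al).
Proof.
apply: allpairs_uniq_dep => [|i _|[i x] [j y] _ _ /= [-> ->]] //; exact: iota_uniq.
Qed.

Lemma tcd_count (al : seq nat) p : count p (tcd al) =
  sumn [seq count (fun x => p (x, i)) (iota 1 (part al i)) | i <- iota 1 (size al)].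
Proof.
by rewrite /tcd count_flatten -map_comp; congr sumn; apply: eq_map => i;
  rewrite /= count_map.
Qed.

(** * Positions of the boxes in the two diagrams *)

Section Composition.
Variables (n : nat) (al : seq nat).
Hypotheses (al_comp : is_composition n al) (al_peak : is_peak al).
Local Notation l := (size al).
Implicit Types (x y i j k m v : nat) (b c : nat * nat).

Lemma sumn_al : sumn al = n.
Proof. by case/andP: al_comp => _ /eqP. Qed.

Lemma comp_part_gt0 j : 0 < j <= l -> 0 < part al j.
Proof.
move=> jl; case/andP: al_comp => /all_nthP-/(_ 0 j.-1) h _; apply: h; lia.
Qed.

Lemma comp_part_ge2 j : 0 < j < l -> 1 < part al j.
Proof. by move=> jl; have := al_peak jl; have := @comp_part_gt0 j; lia. Qed.

Lemma size_gt0 : 0 < n -> 0 < l.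
Proof. by rewrite -sumn_al; case: (al). Qed.

(* The number of boxes of [tcd al] in the rows above row [j], rows being numbered
   from 1. *)
Definition above j : nat := sumn (drop j al).

Lemma aboveS j : j < l -> above j = part al j.+1 + above j.+1.
Proof. by move=> jl; rewrite /above (drop_nth 0). Qed.

Lemma above_size : above l = 0.
Proof. by rewrite /above drop_size. Qed.

Lemma above_sum j : j <= l -> above j = \sum_(j.+1 <= r < l.+1) part al r.
Proof.
move=> jl; have [m] := ubnP (l - j); elim: m j jl => // m IH j jl h.
have [E|jl'] : j = l \/ j < l by lia.
  by rewrite E above_size big_geq.
by rewrite big_ltn // aboveS // IH //; lia.
Qed.

(** The peak condition gives at least two boxes to each row strictly between [j] and [i]. *)
Lemma above_ge j i : 0 < i -> j < i <= l -> above i + part al i + 2 * (i.-1 - j) <= above j.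
Proof.
move=> i0 ji; have [m] := ubnP (i - j); elim: m j ji => // m IH j ji h.
have [E|ji'] : i = j.+1 \/ j.+1 < i by lia.
  have jl : j < l by lia.
  by rewrite (aboveS jl) E /=; lia.
have jl : j < l by lia.
by have := IH j.+1; rewrite (aboveS jl); have := @comp_part_ge2 j.+1; lia.
Qed.

Lemma tcd_size : size (tcd al) = n.
Proof.
rewrite /tcd size_allpairs_dep -sumn_al; congr sumn.
apply: (@eq_from_nth _ 0) => [|i]; rewrite size_map size_iota // => il.
by rewrite (nth_map 0) ?size_iota ?nth_iota.
Qed.

(* The diagrams [cover_diagram al] and [tcd al] have the same row lengths; boxes are
   matched within each row. *)
Definition cover_box (b : nat * nat) : nat * nat :=
  (if (b.2 == l) || (b.1 <= 2) then b.2 + b.1 - 1 else row_shift al b.2 + b.1, b.2).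

Lemma cover_diagramE : cover_diagram al = map cover_box (tcd al).
Proof.
rewrite /cover_diagram /tcd map_flatten -map_comp; congr flatten.
apply/eq_in_map => j; rewrite mem_iota => jl /=; rewrite -map_comp /cover_row.
case: eqP => [E|/eqP jl'].
  by apply: eq_map => x /=; rewrite /cover_box /= E eqxx.
have p2 : 1 < part al j by apply: comp_part_ge2; lia.
have -> : part al j = 2 + (part al j - 2) by lia.
rewrite iotaD map_cat filter_cat /=; congr [:: _, _ & _].
- by rewrite /cover_box orbT /=; congr (_, _); lia.
- by rewrite /cover_box orbT /=; congr (_, _); lia.
rewrite (eq_in_filter (a2 := predT)) ?filter_predT; last first.
  by move=> x; rewrite mem_iota => /andP[h _]; exact: h.
apply/eq_in_map => x; rewrite mem_iota /= => hx.
by rewrite /cover_box /= (negPf jl') ifF //; lia.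
Qed.

Lemma row_shiftE j : 0 < j < l -> row_shift al j + 2 * (l - j) = l.-1 + above j.
Proof.
move=> jl; rewrite /row_shift -above_sum; last lia.
have := @above_ge j l; have := @comp_part_gt0 l; rewrite above_size; lia.
Qed.

(** The shift of row [j] exceeds that of row [i] by the sum of [part al r - 2] over j < r <= i, so
    row [i] ends before the third box of row [j] begins. *)
Lemma cover_box_lt_shift j x i : 0 < j < i -> (x, i) \in tcd al ->
  (cover_box (x, i)).1 < row_shift al j + 3.
Proof.
move=> ji; rewrite tcdP => h; have := @row_shiftE j; have := @above_ge j i.
rewrite /cover_box /=; have [E|il] /= := eqVneq i l.
  by subst i; rewrite above_size; lia.
case: ifP => x2; last by have := @row_shiftE i; lia.
by have := @above_ge j l; have := @comp_part_gt0 l; rewrite above_size; lia.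
Qed.

Lemma cover_box_first j x : x <= 2 -> cover_box (x, j) = (j + x - 1, j).
Proof. by rewrite /cover_box /= => ->; rewrite orbT. Qed.

Lemma cover_box_row x x' j : (x, j) \in tcd al -> (x', j) \in tcd al -> x < x' ->
  (cover_box (x, j)).1 < (cover_box (x', j)).1.
Proof.
rewrite !tcdP /cover_box /= => hx hx' xx'.
have [jl|jl] /= := eqVneq j l; first lia.
have := @cover_box_lt_shift j 1 l; rewrite cover_box_first // tcdP /=.
by have := @comp_part_gt0 l; do 2 case: ifP; lia.
Qed.

Lemma cover_box_inj : {in tcd al &, injective cover_box}.
Proof.
move=> [x j] [x' j'] hb hb' E; have := congr1 snd E; rewrite /= => jj'; subst j'.
congr (_, _); case: (ltngtP x x') => // h.
- by have := cover_box_row hb hb' h; rewrite E ltnn.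
- by have := cover_box_row hb' hb h; rewrite E ltnn.
Qed.

Lemma cover_uniq : uniq (cover_diagram al).
Proof. by rewrite cover_diagramE map_inj_in_uniq ?tcd_uniq //; exact: cover_box_inj. Qed.

Lemma cover_size : size (cover_diagram al) = n.
Proof. by rewrite cover_diagramE size_map tcd_size. Qed.

Definition posP b : nat := index (cover_box b) (sort ord_col (cover_diagram al)).
Definition posQ b : nat := index b (sort ord_LT (tcd al)).

Lemma cover_box_mem b : b \in tcd al -> cover_box b \in cover_diagram al.
Proof. by rewrite cover_diagramE => /(map_f cover_box). Qed.

Lemma posP_lt b c : b \in tcd al -> c \in tcd al ->
  (posP b < posP c) = (b != c) && ord_col (cover_box b) (cover_box c).
Proof.
move=> hb hc; rewrite /posP index_sort_lt ?cover_box_mem ?cover_uniq //.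
- by rewrite (inj_in_eq cover_box_inj).
- exact: ord_col_total.
- exact: ord_col_trans.
- exact: ord_col_anti.
Qed.

Lemma posQ_lt b c : b \in tcd al -> c \in tcd al ->
  (posQ b < posQ c) = (b != c) && ord_LT b c.
Proof.
move=> hb hc; apply: index_sort_lt; rewrite ?tcd_uniq //.
- exact: ord_LT_total.
- exact: ord_LT_trans.
- exact: ord_LT_anti.
Qed.

Lemma posP_row x x' j : (x, j) \in tcd al -> (x', j) \in tcd al -> x < x' ->
  posP (x, j) < posP (x', j).
Proof.
move=> hb hb' xx'; rewrite posP_lt // xpair_eqE (ltn_eqF xx') /=.
by rewrite /ord_col cover_box_row.
Qed.

(** From its third box on, a row lies to the right of all higher rows. *)
Lemma posP_up x x' j j' : (x, j) \in tcd al -> (x', j') \in tcd al -> j < j' ->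
  posP (x, j) < posP (x', j') -> x <= 2.
Proof.
move=> hb hb' jj'; rewrite posP_lt // xpair_eqE => /andP[_].
have := @cover_box_lt_shift j x' j'; rewrite hb' /ord_col.
move: hb hb'; rewrite !tcdP [cover_box (x, j)]/cover_box => hb hb'.
move: (cover_box (x', j')).1 => c /=.
have [?|il] /= := eqVneq j l; first lia.
by case: ifP; lia.
Qed.

Lemma sumn_two_step m (a b : nat) :
  sumn [seq (i <= a) + (i < b) | i <- iota 1 m] = minn m a + minn m b.-1.
Proof.
elim: m => [|m IH]; first by rewrite !min0n.
by rewrite -[m.+1]addn1 iotaD map_cat sumn_cat IH /=; lia.
Qed.

Lemma count_iota_two (p : pred nat) m : (forall x, 2 < x <= m -> ~~ p x) ->
  count p (iota 1 m) = (0 < m) && p 1 + (1 < m) && p 2.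
Proof.
case: m => [|[|m]] // h.
rewrite -[m.+2]add2n iotaD count_cat /= addn0 -[RHS]addn0; congr (_ + _).
apply/eqP; rewrite eqn0Ngt -has_count; apply/hasPn => x; rewrite mem_iota => hx.
by apply: h; lia.
Qed.

Lemma cover_box_third x j : (x, j) \in tcd al -> 2 < x -> l < (cover_box (x, j)).1.
Proof.
rewrite tcdP => h x3; have := @cover_box_lt_shift j 1 l.
rewrite cover_box_first // tcdP /=.
rewrite /cover_box /=; have := @comp_part_gt0 l.
by have [E|jl] /= := eqVneq j l; [lia | rewrite ifF; lia].
Qed.

Lemma posP_count b : b \in tcd al -> posP b =
  sumn [seq count (fun x => (cover_box (x, i) != cover_box b) &&
                            ord_col (cover_box (x, i)) (cover_box b)) (iota 1 (part al i))
       | i <- iota 1 l].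
Proof.
move=> hb; rewrite /posP index_sort_count ?cover_uniq ?cover_box_mem //.
- by rewrite [in LHS]cover_diagramE count_map tcd_count.
- exact: ord_col_total.
- exact: ord_col_trans.
- exact: ord_col_anti.
Qed.

Lemma posP_first j : 0 < j < l -> posP (1, j.+1) = j.*2.-1.
Proof.
move=> jl; rewrite posP_count ?tcdP; last by have := @comp_part_gt0 j.+1; lia.
(* The first two boxes of row [i] are in columns [i] and [i.+1], and the target is the top box of
   column [j.+1]; third boxes lie beyond column [l]. *)
transitivity (sumn [seq (i <= j) + (i < j) | i <- iota 1 l]); last first.
  by rewrite sumn_two_step; lia.
congr sumn; apply/eq_in_map => i; rewrite mem_iota => hi.
have pi0 : 0 < part al i by apply: comp_part_gt0; lia.
rewrite count_iota_two => [|x hx].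
  rewrite !cover_box_first // /ord_col !xpair_eqE /=.
  by have := @comp_part_ge2 i; lia.
rewrite [cover_box (1, _)]cover_box_first // /ord_col.
by have := @cover_box_third x i; rewrite tcdP; case: (cover_box (x, i)) => c r /=; lia.
Qed.

Lemma posP_second j : 0 < j < l -> posP (2, j) = j.*2.
Proof.
move=> jl; rewrite posP_count ?tcdP; last by have := @comp_part_ge2 j; lia.
transitivity (sumn [seq (i <= j.+1) + (i < j) | i <- iota 1 l]); last first.
  by rewrite sumn_two_step; lia.
congr sumn; apply/eq_in_map => i; rewrite mem_iota => hi.
have pi0 : 0 < part al i by apply: comp_part_gt0; lia.
rewrite count_iota_two => [|x hx].
  rewrite !cover_box_first // /ord_col !xpair_eqE /=.
  by have := @comp_part_ge2 i; lia.
rewrite [cover_box (2, _)]cover_box_first // /ord_col.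
by have := @cover_box_third x i; rewrite tcdP; case: (cover_box (x, i)) => c r /=; lia.
Qed.

Lemma count_iota_lt x m : count (fun y => y < x) (iota 1 m) = minn m x.-1.
Proof.
elim: m => [|m IH]; first by rewrite min0n.
by rewrite -[m.+1]addn1 iotaD count_cat IH /= addn0; lia.
Qed.

Lemma posQ_row x j : (x, j) \in tcd al -> posQ (x, j) = above j + x.-1.
Proof.
move=> hb; rewrite /posQ index_sort_count ?tcd_uniq //; first last.
- exact: ord_LT_anti.
- exact: ord_LT_trans.
- exact: ord_LT_total.
rewrite tcd_count; move: hb; rewrite tcdP => h.
have -> : iota 1 l = iota 1 j.-1 ++ j :: iota j.+1 (l - j).
  have E : j.-1 + (1 + (l - j)) = l by lia.
  by rewrite -{1}E !iotaD (_ : 1 + j.-1 = j) ?addn1 //; lia.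
rewrite map_cat sumn_cat /= -[RHS]add0n; congr (_ + _).
  rewrite sumnE big_map big1_seq // => i; rewrite mem_iota /= => hi.
  apply/eqP; rewrite eqn0Ngt -has_count; apply/hasPn => y _.
  by rewrite /ord_LT /=; lia.
rewrite addnC; congr (_ + _); last first.
  rewrite (eq_count (a2 := fun y => y < x)) ?count_iota_lt; first lia.
  by move=> y; rewrite /ord_LT xpair_eqE /=; lia.
rewrite above_sum; last lia.
rewrite /index_iota subSS -[RHS]/(\sum_(r <- _) _) -(big_map (part al) predT id) -sumnE.
congr sumn; apply/eq_in_map => i; rewrite mem_iota => hi.
rewrite -[RHS](size_iota 1) -[RHS]count_predT; apply: eq_count => y.
by rewrite /ord_LT xpair_eqE /=; lia.
Qed.

End Composition.

(** * Comparison of entries in the source tableau *)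

Section SourceFilling.
Variables (n : nat) (al : seq nat).
Hypotheses (al_comp : is_composition n al) (al_peak : is_peak al).
Hypothesis n_gt0 : 0 < n.
Local Notation l := (size al).
Implicit Types (x y i j k m v : nat) (b c : nat * nat).
Local Notation src := (source_filling al).
Let part_gt0 := comp_part_gt0 al_comp.
Let part_ge2 := comp_part_ge2 al_comp al_peak.
Let l_gt0 : 0 < l := size_gt0 al_comp n_gt0.

(* The first two columns of the source tableau contain exactly the numbers
   [1, ..., used_bound]. *)
Definition used_bound : nat := if 1 < part al l then l.*2 else l.*2.-1.

Lemma used_bound_le : used_bound <= n.
Proof.
have <- : above al 0 = n by rewrite /above drop0 (sumn_al al_comp).
rewrite /used_bound.
have := above_ge al_comp al_peak (j := 0) (i := l); have := @part_gt0 l.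
by case: ifP; lia.
Qed.

Lemma used_numbersE v : (v \in used_numbers al) = (0 < v <= used_bound).
Proof.
apply/mapP/idP => [[[x j]]|hv].
  rewrite mem_filter tcdP /= /first_columns /used_bound /= => h ->.
  have := @part_gt0 j; have [E|?] := eqVneq j l; last first.
    by do 2 case: ifP; lia.
  by subst j; do 2 case: ifP; lia.
pose j := v.+1./2; have jv : v = j.*2.-1 \/ v = j.*2 by rewrite /j; lia.
have jl : 0 < j <= l by move: hv; rewrite /used_bound; case: ifP; lia.
have pj := @part_gt0 j jl.
have vj : (v = j.*2 -> 1 < part al j).
  move=> E; have [jE|?] := eqVneq j l; last by apply: part_ge2; lia.
  by move: hv; rewrite /used_bound jE; case: ifP; lia.
case: jv => E; [exists (1, j) | exists (2, j)] => //; rewrite mem_filter tcdP /=; lia.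
Qed.

Lemma other_numbersE v : (v \in other_numbers al) = (used_bound < v <= n).
Proof.
rewrite mem_filter used_numbersE mem_iota (sumn_al al_comp).
by have := used_bound_le; lia.
Qed.

Lemma other_boxesE x j : ((x, j) \in other_boxes al) = (2 < x) && ((x, j) \in tcd al).
Proof. by rewrite mem_sort mem_filter. Qed.

(** Keeps the default value of [nth] in [source_filling] from being reached. *)
Lemma size_other : size (other_boxes al) <= size (other_numbers al).
Proof.
rewrite size_sort !size_filter.
have := count_predC (fun b : nat * nat => 2 < b.1) (tcd al); rewrite (tcd_size al_comp).
have := count_predC (fun k => k \notin used_numbers al) (iota 1 (sumn al)).
rewrite size_iota (sumn_al al_comp).
have : count (predC (fun k => k \notin used_numbers al)) (iota 1 n) <= size (used_numbers al).
  rewrite -size_filter; apply: uniq_leq_size; first by rewrite filter_uniq ?iota_uniq.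
  by move=> v; rewrite mem_filter /= negbK => /andP[].
rewrite size_map size_filter.
rewrite (eq_count (a1 := predC _) (a2 := fun b : nat * nat => b.1 <= 2)); last first.
  by move=> b /=; rewrite -leqNgt.
move=> h1 h2 h3; rewrite -(leq_add2r (count (fun b : nat * nat => b.1 <= 2) (tcd al))).
by rewrite h3 -[X in X <= _]h2 leq_add2l.
Qed.

Lemma source_first x j : x <= 2 -> src (x, j) = first_columns (x, j).
Proof. by rewrite /source_filling /= => ->. Qed.

Lemma source_used x j : x <= 2 -> (x, j) \in tcd al -> 0 < src (x, j) <= used_bound.
Proof.
move=> x2 hb; rewrite source_first // -used_numbersE.
by apply: map_f; rewrite mem_filter x2.
Qed.

Lemma source_other x j : 2 < x -> (x, j) \in tcd al -> used_bound < src (x, j) <= n.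
Proof.
move=> x3 hb; rewrite /source_filling /= (leqNgt x) x3 /= -other_numbersE mem_nth //.
by apply: leq_trans size_other; rewrite index_mem other_boxesE x3.
Qed.

Lemma source_other_lt b c : b \in other_boxes al -> c \in other_boxes al ->
  b != c -> ord_LT b c -> src b < src c.
Proof.
move=> hb hc bc lbc.
have b3 : 2 < b.1 by case: b hb {bc lbc} => x j; rewrite other_boxesE => /andP[].
have c3 : 2 < c.1 by case: c hc {bc lbc} => x j; rewrite other_boxesE => /andP[].
rewrite /source_filling (leqNgt b.1) (leqNgt c.1) b3 c3 /=.
have sorted_others : sorted ltn (other_numbers al).
  by apply: sorted_filter; [exact: ltn_trans | exact: iota_ltn_sorted].
apply: (sorted_ltn_nth ltn_trans 0 sorted_others).
- by rewrite inE; apply: leq_trans size_other; rewrite index_mem.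
- by rewrite inE; apply: leq_trans size_other; rewrite index_mem.
move: hb hc; rewrite !mem_sort => hb hc.
rewrite /other_boxes index_sort_lt ?filter_uniq ?(tcd_uniq al) ?bc //.
- exact: ord_LT_total.
- exact: ord_LT_trans.
- exact: ord_LT_anti.
Qed.

Lemma source_row x x' j : (x, j) \in tcd al -> (x', j) \in tcd al -> x < x' ->
  src (x, j) < src (x', j).
Proof.
move=> hb hb' xx'; have := hb; rewrite tcdP => hx.
have [x2|x3] := leqP x' 2.
  rewrite !source_first //; try lia.
  by rewrite /first_columns /=; do 2 case: ifP; lia.
have [x2|x3'] := leqP x 2.
  by have := source_used x2 hb; have := source_other x3 hb'; lia.
apply: source_other_lt; rewrite ?other_boxesE ?x3 ?x3' //.
  by rewrite xpair_eqE; lia.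
by rewrite /ord_LT /=; lia.
Qed.

Lemma source_low x x' j j' : (x, j) \in tcd al -> (x', j') \in tcd al -> j < j' ->
  x <= 2 -> src (x, j) < src (x', j').
Proof.
move=> hb hb' jj' x2; have [x2'|x3] := leqP x' 2.
  rewrite !source_first // /first_columns /=.
  by move: hb hb'; rewrite !tcdP; do 2 case: ifP; lia.
by have := source_used x2 hb; have := source_other x3 hb'; lia.
Qed.

Lemma source_high x x' j j' : (x, j) \in tcd al -> (x', j') \in tcd al -> j < j' ->
  2 < x -> src (x', j') < src (x, j).
Proof.
move=> hb hb' jj' x3; have [x2'|x3'] := leqP x' 2.
  by have := source_used x2' hb'; have := source_other x3 hb; lia.
apply: source_other_lt; rewrite ?other_boxesE ?x3 ?x3' //.
  by rewrite xpair_eqE; lia.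
by rewrite /ord_LT /=; lia.
Qed.

Lemma source_inj : {in tcd al &, injective src}.
Proof.
move=> [x j] [x' j'] hb hb' E.
have [jj'|jj'|?] := ltngtP j j'.
- have [x2|x3] := leqP x 2; first by have := source_low hb hb' jj' x2; rewrite E ltnn.
  by have := source_high hb hb' jj' x3; rewrite E ltnn.
- have [x2|x3] := leqP x' 2; first by have := source_low hb' hb jj' x2; rewrite E ltnn.
  by have := source_high hb' hb jj' x3; rewrite E ltnn.
subst j'; congr (_, _); case: (ltngtP x x') => // h.
- by have := source_row hb hb' h; rewrite E ltnn.
- by have := source_row hb' hb h; rewrite E ltnn.
Qed.

Lemma source_range b : b \in tcd al -> 0 < src b <= n.
Proof.
case: b => x j hb; have := used_bound_le; have [x2|x3] := leqP x 2.
  by have := source_used x2 hb; lia.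
by have := source_other x3 hb; lia.
Qed.

Definition box_at (k : nat) : nat * nat := nth (0, 0) (sort ord_LT (tcd al)) k.

Lemma box_at_mem k : k < n -> box_at k \in tcd al.
Proof. by move=> kn; rewrite -(mem_sort ord_LT) mem_nth // size_sort (tcd_size al_comp). Qed.

Lemma posQ_box_at k : k < n -> posQ al (box_at k) = k.
Proof.
by move=> kn; rewrite /posQ index_uniq ?sort_uniq ?(tcd_uniq al) // size_sort (tcd_size al_comp).
Qed.

Lemma box_at_posQ b : b \in tcd al -> box_at (posQ al b) = b.
Proof. by move=> hb; rewrite /box_at nth_index ?mem_sort. Qed.

Lemma source_perm (k : 'I_n) :
  (perm_of_word n (w_LT (tcd al) src) k).+1 = src (box_at k).
Proof.
have sz : size (sort ord_LT (tcd al)) = n by rewrite size_sort (tcd_size al_comp).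
rewrite perm_of_wordE /w_LT ?size_map //.
- by rewrite (nth_map (0, 0)) ?sz.
- rewrite map_inj_in_uniq ?sort_uniq ?(tcd_uniq al) // => b c.
  by rewrite !mem_sort; exact: source_inj.
- by move=> _ /mapP[b + ->]; rewrite mem_sort; exact: source_range.
Qed.

Lemma cover_perm (k : 'I_n) :
  val (perm_of_word n (w_LB (cover_diagram al) (col_filling (cover_diagram al))) k) =
  index (nth (0, 0) (sort ord_LB (cover_diagram al)) k) (sort ord_col (cover_diagram al)).
Proof.
have cs := cover_size al_comp al_peak; have cu := cover_uniq al_comp al_peak.
have sz : size (sort ord_LB (cover_diagram al)) = n by rewrite size_sort.
apply: succn_inj; rewrite [val _]/(nat_of_ord _) perm_of_wordE /w_LB ?size_map //.
- by rewrite (nth_map (0, 0)) ?sz.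
- rewrite map_inj_in_uniq ?sort_uniq // => b c; rewrite !mem_sort => hb hc [].
  by move/index_inj; rewrite !mem_sort; apply.
- move=> _ /mapP[b + ->]; rewrite mem_sort /col_filling => hb.
  by rewrite /= -[n in _ <= n]cs -(size_sort ord_col) index_mem mem_sort.
Qed.

End SourceFilling.

(** * The interval of [Qr] as a lower set in the interval of its cover *)

Section QuotientInterval.
Variables (n : nat) (al : seq nat).
Hypotheses (al_comp : is_composition n al) (al_peak : is_peak al).
Hypothesis n_gt0 : 0 < n.
Local Notation l := (size al).
Implicit Types (x y i j k m : nat) (b c : nat * nat) (w z : 'S_n).
Local Notation src := (source_filling al).
Local Notation G := (cover_diagram al).
Local Notation B := (tcd al).
Let part_gt0 := comp_part_gt0 al_comp.
Let part_ge2 := comp_part_ge2 al_comp al_peak.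

Definition ordP b : 'I_n := insubd (Ordinal n_gt0) (posP al b).
Definition ordQ b : 'I_n := insubd (Ordinal n_gt0) (posQ al b).

Lemma ordPE b : b \in B -> ordP b = posP al b :> nat.
Proof.
move=> hb; rewrite /ordP val_insubd ifT // -[X in _ < X](cover_size al_comp al_peak).
by rewrite -(size_sort ord_col) index_mem mem_sort (cover_box_mem al_comp al_peak).
Qed.

Lemma ordQE b : b \in B -> ordQ b = posQ al b :> nat.
Proof.
move=> hb; rewrite /ordQ val_insubd ifT // -[X in _ < X](tcd_size al_comp).
by rewrite -(size_sort ord_LT) index_mem mem_sort.
Qed.

Lemma ordP_inj : {in B &, injective ordP}.
Proof.
move=> b c hb hc /(congr1 val); rewrite /= !ordPE // => E.
apply: (cover_box_inj al_comp al_peak) => //.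
by apply: (index_inj (0, 0)) E; rewrite mem_sort (cover_box_mem al_comp al_peak).
Qed.

Lemma ordQ_inj : {in B &, injective ordQ}.
Proof.
by move=> b c hb hc /(congr1 val); rewrite /= !ordQE // => /(index_inj (0, 0)); apply;
  rewrite mem_sort.
Qed.

Lemma ordP_surj (k : 'I_n) : exists2 b, b \in B & ordP b = k.
Proof.
have sz : size (sort ord_col G) = n by rewrite size_sort (cover_size al_comp al_peak).
have : nth (0, 0) (sort ord_col G) k \in G by rewrite -(mem_sort ord_col) mem_nth // sz.
rewrite [X in _ \in X](cover_diagramE al_comp al_peak) => /mapP[b hb E].
exists b => //; apply: val_inj; rewrite /= ordPE // /posP -E index_uniq ?sz //.
by rewrite sort_uniq (cover_uniq al_comp al_peak).
Qed.

Lemma ordQ_box_at (k : 'I_n) : ordQ (box_at al k) = k.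
Proof. by apply: val_inj; rewrite /= ordQE ?(box_at_mem al_comp) // (posQ_box_at al_comp). Qed.

Lemma ordQ_surj (k : 'I_n) : exists2 b, b \in B & ordQ b = k.
Proof. by exists (box_at al k); [exact: (box_at_mem al_comp) | exact: ordQ_box_at]. Qed.

Lemma relabel_inj : injective (fun k : 'I_n => ordP (box_at al k)).
Proof.
move=> k m /ordP_inj E; rewrite -(ordQ_box_at k) -(ordQ_box_at m) E //;
  exact: (box_at_mem al_comp).
Qed.

(* Sends the position of a box of [tcd al] in the reading order of [w_LT] to the
   position of the corresponding box of [cover_diagram al] in the column order. *)
Definition relabel : 'S_n := perm relabel_inj.

Lemma relabelE b : b \in B -> relabel (ordQ b) = ordP b.
Proof. by move=> hb; rewrite permE /= ordQE // box_at_posQ. Qed.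

(* The inequalities defining the standard peak immaculate tableaux, which index the
   basis of [Qr]. *)
Definition peak_filling (f : nat * nat -> nat) : Prop :=
  (forall x j, 0 < x -> (x.+1, j) \in B -> f (x, j) < f (x.+1, j)) /\
  (forall j, 0 < j < l -> f (2, j) < f (1, j.+1)).

Section PeakFilling.
Variable f : nat * nat -> nat.
Hypothesis f_peak : peak_filling f.

Lemma peak_row x x' j : (x, j) \in B -> (x', j) \in B -> x < x' -> f (x, j) < f (x', j).
Proof.
rewrite !tcdP => hx; elim: x' => // x' IH hx' xx'.
have step : f (x', j) < f (x'.+1, j) by apply: f_peak.1; rewrite ?tcdP; lia.
have [->//|lt] : x = x' \/ x < x' by lia.
by apply: ltn_trans step; apply: IH; lia.
Qed.

(** The values increase along the staircase (2, j), (1, j+1), (2, j+1), (1, j+2), ..., since every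
    row below the top one has two boxes. *)
Lemma peak_chain j j' : 0 < j -> j < j' <= l -> f (2, j) < f (1, j').
Proof.
move=> j0; elim: j' => // j' IH jj'.
have [->|lt] : j = j' \/ j < j' by lia.
  by apply: f_peak.2; lia.
apply: ltn_trans (IH _) _; first lia.
have p2 := @part_ge2 j'.
apply: ltn_trans (peak_row (x := 1) (x' := 2) _ _ _) _; rewrite ?tcdP //; try lia.
by apply: f_peak.2; lia.
Qed.

Lemma peak_lt x x' j j' : (x, j) \in B -> (x', j') \in B -> x <= 2 -> j < j' ->
  f (x, j) < f (x', j').
Proof.
move=> hb hb' x2 jj'; have := hb; have := hb'; rewrite !tcdP => hx' hx.
have p2 := @part_ge2 j.
have le1 : f (x, j) <= f (2, j).
  have [->//|lt] : x = 2 \/ x < 2 by lia.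
  by apply/ltnW/peak_row; rewrite ?tcdP; lia.
apply: leq_ltn_trans le1 _; apply: leq_trans (peak_chain (j := j) (j' := j') _ _) _;
  try lia.
have [->//|lt] : x' = 1 \/ 1 < x' by lia.
by apply/ltnW/peak_row; rewrite ?tcdP; lia.
Qed.

Lemma peak_up b c : b \in B -> c \in B -> posP al b < posP al c -> b.2 <= c.2 -> f b < f c.
Proof.
case: b c => [x j] [x' j'] hb hc lt /=; rewrite leq_eqVlt => /predU1P[E|jj'].
  subst j'; apply: peak_row => //; rewrite ltnNge leq_eqVlt; apply/negP => /predU1P[E|lt'].
    by rewrite E ltnn in lt.
  by have := posP_row al_comp al_peak hc hb lt'; lia.
apply: peak_lt => //; exact: (posP_up al_comp al_peak hb hc jj' lt).
Qed.

End PeakFilling.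

Local Notation u := (perm_of_word n (w_LT B src)).
Local Notation v := (perm_of_word n (w_LB G (col_filling G))).
Local Notation S := (comp_set n (rev al)).
Local Notation T := (evens n l.-1).

Lemma source_permE b : b \in B -> (u (ordQ b)).+1 = src b.
Proof. by move=> hb; rewrite (source_perm al_comp al_peak n_gt0) ordQE // box_at_posQ. Qed.

(** Rows are read from the top, so the partial sums of the reversed composition mark the row
    changes. *)
Lemma mem_comp_set (k : 'I_n.-1) b c : b \in B -> c \in B ->
  ordQ b = ord_lo k -> ordQ c = ord_hi k -> (k \in S) = (c.2 < b.2).
Proof.
case: b c => [x j] [x' j'] hb hc /(congr1 val) + /(congr1 val).
rewrite /= !ordQE // !(posQ_row al_comp) // => Ek Ek'.
have := hb; have := hc; rewrite !tcdP => hx' hx.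
rewrite inE size_rev; apply/mapP/idP => [[m]|jj'].
  rewrite mem_iota take_rev sumn_rev -/(above al (l - m)) => hm Em.
  have h1 : (1, l - m) \in B by rewrite tcdP; have := @part_gt0 (l - m); lia.
  have [xE jE] : (x', j') = (1, l - m).
    by apply: ordQ_inj => //; apply: val_inj;
      rewrite /= !ordQE // !(posQ_row al_comp) //; lia.
  have := posQ_lt hb hc; rewrite /ord_LT !(posQ_row al_comp) // xpair_eqE /= xE jE; lia.
exists (l - j'); first by rewrite mem_iota; lia.
rewrite take_rev sumn_rev -/(above al (l - (l - j'))) subKn; last lia.
by have := above_ge al_comp al_peak (j := j') (i := j); lia.
Qed.

(** Column order and [ord_LB] agree within a row; across rows, [ord_LB] reads the lower one
    first. *)
Lemma mem_DesL_cover (k : 'I_n.-1) b c : b \in B -> c \in B ->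
  ordP b = ord_lo k -> ordP c = ord_hi k -> (k \in DesL v) = (c.2 < b.2).
Proof.
move=> hb hc Eb Ec; have cs := cover_size al_comp al_peak.
have cu := cover_uniq al_comp al_peak.
have lbn (d : nat * nat) : d \in B -> index (cover_box al d) (sort ord_LB G) < n.
  by move=> hd; rewrite -[X in _ < X]cs -(size_sort ord_LB) index_mem mem_sort (cover_box_mem al_comp al_peak).
have vV (d : nat * nat) (hd : d \in B) : (v^-1)%g (ordP d) = Ordinal (lbn d hd).
  apply: (@perm_inj _ v); rewrite permKV; apply: val_inj.
  rewrite (cover_perm al_comp al_peak) /= nth_index ?mem_sort ?(cover_box_mem al_comp al_peak) //.
  exact: ordPE.
rewrite DesLE -Eb -Ec !vV /= index_sort_lt ?(cover_box_mem al_comp al_peak) //.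
- have := posP_lt al_comp al_peak hb hc; rewrite -!ordPE // Eb Ec /= ltnSn.
  move=> /esym/andP[bc]; have inj := cover_box_inj al_comp al_peak hb hc.
  rewrite /ord_col /ord_LB (_ : cover_box al b = ((cover_box al b).1, b.2)) //.
  rewrite (_ : cover_box al c = ((cover_box al c).1, c.2)) //= xpair_eqE /= => h.
  have nb : ~ ((cover_box al b).1 = (cover_box al c).1 /\ b.2 = c.2).
    move=> [h1 h2]; case/eqP: bc; apply: inj.
    by rewrite [LHS]surjective_pairing [RHS]surjective_pairing h1 /= h2.
  move: nb h; move: (cover_box al b).1 (cover_box al c).1 b.2 c.2 => p q r t; lia.
- exact: ord_LB_total.
- exact: ord_LB_trans.
- exact: ord_LB_anti.
Qed.

Lemma posP_inj b c : b \in B -> c \in B -> posP al b = posP al c -> b = c.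
Proof. by move=> hb hc E; apply: ordP_inj => //; apply: val_inj; rewrite /= !ordPE. Qed.

Lemma tcd_first j : 0 < j < l -> (1, j.+1) \in B /\ (2, j) \in B.
Proof.
by move=> jl; rewrite !tcdP; have := @part_gt0 j.+1; have := @part_ge2 j; lia.
Qed.

Lemma mem_evens (k : 'I_n.-1) b c : b \in B -> c \in B ->
  ordP b = ord_lo k -> ordP c = ord_hi k -> k \in T ->
  exists2 j, 0 < j < l & b = (1, j.+1) /\ c = (2, j).
Proof.
move=> hb hc /(congr1 val) + /(congr1 val); rewrite /= !ordPE // inE => Eb Ec kT.
have jl : 0 < k.+1./2 < l by lia.
have [h1 h2] := tcd_first jl; exists k.+1./2 => //; split; apply: posP_inj => //.
  by rewrite (posP_first al_comp al_peak) //; lia.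
by rewrite (posP_second al_comp al_peak) //; lia.
Qed.

Lemma evens_index j : 0 < j < l ->
  exists2 k : 'I_n.-1, k \in T & ordP (1, j.+1) = ord_lo k /\ ordP (2, j) = ord_hi k.
Proof.
move=> jl; have [h1 h2] := tcd_first jl.
have kn : j.*2.-1 < n.-1.
  by have := ltn_ord (ordP (2, j)); rewrite ordPE // (posP_second al_comp al_peak) //; lia.
exists (Ordinal kn); first by rewrite inE /=; lia.
split; apply: val_inj; rewrite /= ordPE //.
  by rewrite (posP_first al_comp al_peak).
by rewrite (posP_second al_comp al_peak) //; lia.
Qed.

(** The upper bound says that rows increase. An inversion of the source word is between a box and
    one of the first two boxes of a lower row, so [peak_lt] gives all of them; the pairs (1, j+1),
    (2, j) are among them. *)
Lemma mem_source_interval z :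
  z \in wint u (w1S S) <-> peak_filling (fun b => z (ordQ b)).
Proof.
rewrite inE wle_w1S; split=> [/andP[/wleP uz /subsetP zS]|zp].
  split=> [x j x0 hb'|j jl].
    have hb : (x, j) \in B by move: hb'; rewrite !tcdP; lia.
    have [qb qb'] := (ordQE hb, ordQE hb'); rewrite !(posQ_row al_comp) // in qb qb'.
    have kn : ordQ (x, j) < n.-1 by have := ltn_ord (ordQ (x.+1, j)); lia.
    have Elo : ordQ (x, j) = ord_lo (Ordinal kn) by apply: val_inj.
    have Ehi : ordQ (x.+1, j) = ord_hi (Ordinal kn) by apply: val_inj; rewrite /=; lia.
    rewrite Elo Ehi ltn_permN; apply: contraTN isT => /zS.
    by rewrite (mem_comp_set hb hb' Elo Ehi) /= ltnn.
  have [h1 h2] := tcd_first jl; apply: uz.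
    by rewrite !ordQE // posQ_lt // /ord_LT xpair_eqE /=; lia.
  by rewrite -ltnS !source_permE //; apply: (source_low al_comp al_peak n_gt0).
apply/andP; split.
  apply/wleP => a d; have [b hb <-] := ordQ_surj a; have [c hc <-] := ordQ_surj d.
  rewrite !ordQE // posQ_lt // -ltnS !source_permE //.
  case: b c hb hc => [x j] [x' j'] hb hc; rewrite /ord_LT xpair_eqE /= => /andP[bc ord] sr.
  have [jj'|jj'|E] := ltngtP j j'; first lia.
    have [x2|x3] := leqP x' 2; first exact: (peak_lt zp).
    by have := source_high al_comp al_peak n_gt0 hc hb jj' x3; lia.
  subst j'; have lt : x < x' by lia.
  by have := source_row al_comp al_peak n_gt0 hb hc lt; lia.
apply/subsetP => k; have [b hb Eb] := ordQ_surj (ord_lo k).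
have [c hc Ec] := ordQ_surj (ord_hi k); rewrite (mem_comp_set hb hc Eb Ec) DesRE.
have := posQ_lt hb hc; rewrite -!ordQE // Eb Ec /= ltnSn -Eb -Ec.
case: b c hb hc {Eb Ec} => [x j] [x' j'] hb hc; rewrite /ord_LT xpair_eqE /=.
move=> /esym h dz; case: (ltngtP j' j) => //; first lia.
move=> E; subst j'; have lt : x < x' by lia.
by have := peak_row zp hb hc lt; lia.
Qed.

(** At a row change the next box is the first of a lower row, and its entry is smaller than all
    entries above that row. *)
Lemma DesR_source : DesR u = S.
Proof.
apply/setP=> k; have [b hb Eb] := ordQ_surj (ord_lo k).
have [c hc Ec] := ordQ_surj (ord_hi k); rewrite (mem_comp_set hb hc Eb Ec) DesRE.
rewrite -Eb -Ec -ltnS !source_permE //.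
have := posQ_lt hb hc; rewrite -!ordQE // Eb Ec /= ltnSn.
have := congr1 val Ec; have := congr1 val Eb; rewrite /= !ordQE //.
case: b c hb hc {Eb Ec} => [x j] [x' j'] hb hc; rewrite !(posQ_row al_comp) //.
rewrite /ord_LT xpair_eqE /= => Ek Ek' /esym h; have := hb; have := hc;
  rewrite !tcdP => hx' hx.
have [jj'|jj'|E] := ltngtP j' j; last 1 first.
- subst j'; have lt : x < x' by lia.
  by have := source_row al_comp al_peak n_gt0 hb hc lt; lia.
- apply: (source_low al_comp al_peak n_gt0) => //.
  by have := above_ge al_comp al_peak (j := j') (i := j); lia.
- lia.
Qed.

Local Notation P := (wint (w0S T) (w1S (DesL v))).
Local Notation Q := (wint u (w1S S)).

Lemma relabel_pcomp w b : b \in B -> pcomp w relabel (ordQ b) = w (ordP b).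
Proof. by move=> hb; rewrite pcompE relabelE. Qed.

Lemma mem_relabel_interval w :
  pcomp w relabel \in Q <-> peak_filling (fun b => w (ordP b)).
Proof.
rewrite mem_source_interval; split=> -[h1 h2]; split=> [x j x0 hb'|j jl].
- have hb : (x, j) \in B by move: hb'; rewrite !tcdP; lia.
  by have := h1 x j x0 hb'; rewrite !relabel_pcomp.
- by have [? ?] := tcd_first jl; have := h2 j jl; rewrite !relabel_pcomp.
- have hb : (x, j) \in B by move: hb'; rewrite !tcdP; lia.
  by have := h1 x j x0 hb'; rewrite !relabel_pcomp.
- by have [? ?] := tcd_first jl; have := h2 j jl; rewrite !relabel_pcomp.
Qed.

Lemma relabel_interval w : pcomp w relabel \in Q -> w \in P.
Proof.
move=> /mem_relabel_interval wp; rewrite wint_descent; apply/andP; split;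
  apply/subsetP => k.
  have [b hb Eb] := ordP_surj (ord_lo k); have [c hc Ec] := ordP_surj (ord_hi k).
  case/(mem_evens hb hc Eb Ec) => j jl [bE cE].
  by rewrite DesRE -Eb -Ec bE cE; apply: wp.2.
have [b hb Eb] := ordP_surj (ord_lo k); have [c hc Ec] := ordP_surj (ord_hi k).
rewrite (mem_DesL_cover hb hc Eb Ec) DesRE -Eb -Ec ltnNge; apply: contraNltn => bc.
apply/ltnW/(peak_up wp) => //; by rewrite -!ordPE // Eb Ec /=.
Qed.

(** Let [b] and [c] be the boxes with consecutive values [i] and [i.+1]. The two position orders
    could only disagree with [b] in a lower row that precedes [c] in column order. As no value lies
    strictly between, [b] and [c] are then neighbours (2, j) and (1, j+1) on the staircase, which
    the column order lists the other way round. *)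
Lemma relabel_DesL w : pcomp w relabel \in Q -> DesL (pcomp w relabel) = DesL w.
Proof.
move=> /mem_relabel_interval wp; apply/setP => i; rewrite !DesLE !pcompVE.
have [b hb Eb] := ordP_surj ((w^-1)%g (ord_lo i)).
have [c hc Ec] := ordP_surj ((w^-1)%g (ord_hi i)).
have relV d : d \in B -> (relabel^-1)%g (ordP d) = ordQ d.
  by move=> hd; rewrite -relabelE // permK.
rewrite -Eb -Ec !relV // !ordPE // !ordQE //.
have wb : w (ordP b) = i :> nat by rewrite Eb permKV.
have wc : w (ordP c) = i.+1 :> nat by rewrite Ec permKV.
have up : posP al c < posP al b -> b.2 < c.2.
  move=> lt; rewrite ltnNge; apply/negP => /(peak_up wp hc hb lt); rewrite wb wc; lia.
move: wb wc up; case: b c hb hc {Eb Ec} => [x j] [x' j'] hb hc wb wc up.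
have [jj'|jj'|E] := ltngtP j j'; last 1 first.
- subst j'; have [xx'|xx'|xx'] := ltngtP x x'; last by rewrite -xx' wb in wc; lia.
    have h1 := posP_row al_comp al_peak hb hc xx'.
    have h2 : posQ al (x, j) < posQ al (x', j).
      by rewrite posQ_lt // /ord_LT xpair_eqE /=; lia.
    by rewrite [LHS]ltnNge [RHS]ltnNge (ltnW h1) (ltnW h2).
  by have := peak_row wp hc hb xx'; rewrite wb wc; lia.
- have -> : posQ al (x', j') < posQ al (x, j).
    by rewrite posQ_lt // /ord_LT xpair_eqE /=; lia.
  suff : ~ posP al (x, j) <= posP al (x', j') by move/negP; rewrite -ltnNge.
  rewrite leq_eqVlt => /predU1P[E|lt].
    by have [_ E'] := posP_inj hb hc E; rewrite E' ltnn in jj'.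
  have x2 := posP_up al_comp al_peak hb hc jj' lt.
  have hx := hb; have hx' := hc; rewrite !tcdP in hx hx'.
  have jl : 0 < j < l by lia.
  have [h1 h2] := tcd_first jl.
  have xE : x = 2.
    have [//|x1] : x = 2 \/ x < 2 by lia.
    have := peak_row wp hb h2 x1; have := peak_lt wp h2 hc (leqnn 2) jj'.
    by rewrite wb wc; lia.
  have first2 := wp.2 j jl; rewrite /= -xE wb in first2.
  have cE : (x', j') = (1, j.+1).
    have [j'E|lt'] : j' = j.+1 \/ j.+1 < j' by lia.
      have [->|x1] : x' = 1 \/ 1 < x' by lia.
        by rewrite j'E.
      by move: hc wc; rewrite j'E => hc wc; have := peak_row wp h1 hc x1; rewrite wc; lia.
    by have := peak_lt wp h1 hc isT lt'; rewrite wc; lia.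
  move: lt; rewrite cE xE (posP_first al_comp al_peak) // (posP_second al_comp al_peak) //.
  by lia.
- have -> : (posQ al (x', j') < posQ al (x, j)) = false.
    by rewrite posQ_lt // /ord_LT xpair_eqE /=; lia.
  by apply/esym/negbTE/negP => /up /=; rewrite ltnNge ltnW.
Qed.

(** The row inequalities forbid inversions and so are inherited downwards; those between rows hold
    throughout the interval of the cover, as descents in [T]. *)
Lemma relabel_down w (i : 'I_n.-1) : w \in P -> i \notin DesL w ->
  pcomp (pcomp (adj i) w) relabel \in Q -> pcomp w relabel \in Q.
Proof.
rewrite wint_descent => /andP[/subsetP wT _] iw /mem_relabel_interval sp.
apply/mem_relabel_interval; split=> [x j x0 hb'|j jl].
  have hb : (x, j) \in B by move: hb'; rewrite !tcdP; lia.
  have lt : ordP (x, j) < ordP (x.+1, j) by rewrite !ordPE //;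
    apply: (posP_row al_comp al_peak).
  rewrite ltn_neqAle (inj_eq val_inj) (inj_eq perm_inj) -val_eqE (ltn_eqF lt) /=.
  rewrite leqNgt; apply/negP => /(inversion_up iw lt).
  by have := sp.1 x j x0 hb'; lia.
have [k kT [E1 E2]] := evens_index jl.
by have := wT _ kT; rewrite DesRE -E1 -E2.
Qed.

Lemma relabel_young w : w \in P -> w \in young (DesL v) -> pcomp w relabel \in Q.
Proof.
rewrite wint_descent => /andP[/subsetP wT _] wy.
apply/mem_relabel_interval; split=> [x j x0 hb'|j jl].
  have hb : (x, j) \in B by move: hb'; rewrite !tcdP; lia.
  have lt : ordP (x, j) < ordP (x.+1, j) by rewrite !ordPE //;
    apply: (posP_row al_comp al_peak).
  apply: (young_ltn wy lt); apply/negP => bl.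
  (* Within a block of [DesL v] the row number strictly decreases from one position to the next, so
     two boxes of one row lie in different blocks. *)
  pose row (a : 'I_n) := (nth (0, 0) (sort ord_col G) a).2.
  have rowE d : d \in B -> row (ordP d) = d.2.
    by move=> hd; rewrite /row ordPE // nth_index // mem_sort (cover_box_mem al_comp al_peak).
  have : row (ordP (x.+1, j)) < row (ordP (x, j)).
    apply: (@blk_homo _ (fun a d => row d < row a) _ _ _ _ _ lt bl) => [d a e /= h1 h2|k].
      exact: ltn_trans h2 h1.
    have [b hb2 Eb] := ordP_surj (ord_lo k); have [c hc2 Ec] := ordP_surj (ord_hi k).
    by rewrite (mem_DesL_cover hb2 hc2 Eb Ec) -Eb -Ec !rowE.
  by rewrite !rowE // ltnn.
have [k kT [E1 E2]] := evens_index jl.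
by have := wT _ kT; rewrite DesRE -E1 -E2.
Qed.

End QuotientInterval.

Local Open Scope ring_scope.

Theorem theorem5p24 (R : realType) (n : nat) (alpha : seq nat)
    (n_gt0 : (0 < n)%N)
    (alpha_comp : is_composition n alpha)
    (alpha_peak : is_peak alpha) :
  let G := cover_diagram alpha in
  let S := comp_set n (rev alpha) in
  projective_cover
    (Bbar R[i] (w0S (evens n (size alpha).-1))
               (w1S (DesL (perm_of_word n (w_LB G (col_filling G))))))
    (Qr R[i] n alpha)
  /\
  injective_hull (Bbar R[i] (w0S S) (w1S S)) (Qr R[i] n alpha)
  /\
  projective (Bbar R[i] (w0S S) (w1S S))
  /\
  indecomposable (Bbar R[i] (w0S S) (w1S S)).
Proof.
split; [|split; [|split]].
- split; first exact: projective_descent.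
  apply: (@essential_epi_translate _ _ _ _ _ _ (relabel alpha_comp alpha_peak n_gt0)).
  + by move=> w _; exact: relabel_DesL.
  + by move=> w i wP iw _; exact: relabel_down.
  + by move=> w; exact: relabel_interval.
  + by move=> w; exact: relabel_young.
- exact: injective_hull_descent (DesR_source alpha_comp alpha_peak n_gt0).
- exact: projective_descent.
- exact: indecomposable_descent.
Qed.
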